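(* Let $\beta>1$ and $0<\gamma<\pi$. Let $A=A_{\beta,\gamma}$ be the annular rectangle with inner radius $1$ and outer radius $\beta^2$ and angle $2(\pi-\gamma)$. The conformal module of the exterior $A^*=(\mathbb{C}\cup\{\infty\})\setminus\overline{A}$ is half the module of the gear domain $G_{\beta,\gamma}$ with gear angle $\gamma$ and gear ratio $\beta$.
   Context: The annular rectangle is $A_{\beta,\gamma}=\{re^{i\theta}\colon 1<r<\beta^2,\ \gamma<\theta<2\pi-\gamma\}$. Its exterior $A^*$ is a topological quadrilateral with vertices $e^{\pm i\gamma}$, $\beta^2e^{\pm i\gamma}$, whose edges are the two radial segments $\{re^{\pm i\gamma}\colon 1\le r\le\beta^2\}$ and the two circular arcs $\{e^{i\theta}\}$, $\{\beta^2e^{i\theta}\}$, $\gamma<\theta<2\pi-\gamma$. The gear domain $G_{\beta,\gamma}$ is the union of the open unit disk and the sector $\{re^{i\theta}\colon 0<r<\beta,\ -\gamma<\theta<\gamma\}$. It is a topological quadrilateral with vertices $\beta e^{\pm i\gamma}$, $e^{\pm i\gamma}$, whose edges are the two radial segments $\{re^{\pm i\gamma}\colon 1\le r\le\beta\}$ (the tooth edges), the arc of $\{|w|=1\}$ with $\gamma<\arg w<2\pi-\gamma$, and the arc of $\{|w|=\beta\}$ with $-\gamma<\arg w<\gamma$. Conformal module: for either quadrilateral, take a vertex-preserving conformal mapping from a rectangle with sides parallel to the axes onto the quadrilateral, such that the horizontal sides of the rectangle correspond to the two radial segments and the vertical sides to the two circular arcs; the conformal module is the ratio (length of vertical side)/(length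 of horizontal side) of the rectangle. *)

(* Defs.v *)
From mathcomp Require Import all_boot all_order all_algebra.
From mathcomp Require Import complex.
From mathcomp Require Import all_classical all_reals all_analysis.
Import Order.TTheory GRing.Theory Num.Theory.
Import numFieldNormedType.Exports.

Set Implicit Arguments.
Unset Strict Implicit.
Unset Printing Implicit Defensive.

Local Open Scope classical_set_scope.
Local Open Scope ring_scope.
Local Open Scope complex_scope.

(* The regular algebra [R[i]^o] carries the norm topology of the complex plane
   and is a normed module over [R[i]], so that [derivable f z 1] for
   [f : plane R -> plane R] is complex differentiability at [z]. *)
Notation plane R := (R[i]^o).

Notation sphere R := (one_point_compactification (plane R)).

Definition to_sphere (R : realType) (z : plane R) : sphere R := Some z.

(* The two charts of the sphere, near a finite point and near infinity. The
   values outside the domain of each chart are immaterial. *)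
Definition finite_chart (R : realType) (p : sphere R) : plane R :=
  if p is Some z then z else 0.

Definition infinity_chart (R : realType) (p : sphere R) : plane R :=
  if p is Some z then z^-1 else 0.

Definition holomorphic_at (R : realType) (f : plane R -> sphere R)
    (z : plane R) : Prop :=
  {for z, continuous f} /\
  (if f z is Some _ then derivable (fun w : plane R => finite_chart (f w)) z 1
   else derivable (fun w : plane R => infinity_chart (f w)) z 1).

Definition polar (R : realType) (r t : R) : plane R :=
  (r * cos t) +i* (r * sin t).

Definition polar_region (R : realType) (I J : set R) : set (plane R) :=
  [set polar r t | r in I & t in J].

Record quadrilateral (R : realType) := Quadrilateral {
  quad_domain : set (sphere R);
  quad_vertices : set (sphere R);
  quad_radial_edges : set (set (sphere R));
  quad_circular_edges : set (set (sphere R)) }.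

Definition box (R : realType) (I J : set R) : set (plane R) :=
  [set x +i* y | x in I & y in J].

(* [f] is the homeomorphic extension to the closed rectangle of a conformal
   mapping of the open rectangle onto the domain of the quadrilateral. The
   sides of the rectangle are taken with their end points exactly when the
   corresponding edges are: the radial edges are closed segments, the circular
   edges are open arcs. *)
Record quad_conformal_mapping (R : realType) (a b c d : R)
    (Q : quadrilateral R) (f : plane R -> sphere R) : Prop := {
  quad_map_continuous : {within box `[a, b] `[c, d], continuous f};
  quad_map_injective : set_inj (box `[a, b] `[c, d]) f;
  quad_map_holomorphic :
    forall z, box `]a, b[ `]c, d[ z -> holomorphic_at f z;
  quad_map_onto : f @` box `]a, b[ `]c, d[ = quad_domain Q;
  quad_map_vertices : f @` box [set a; b] [set c; d] = quad_vertices Q;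
  quad_map_horizontal :
    [set f @` box `[a, b] [set c]; f @` box `[a, b] [set d]]
    = quad_radial_edges Q;
  quad_map_vertical :
    [set f @` box [set a] `]c, d[; f @` box [set b] `]c, d[]
    = quad_circular_edges Q }.

Definition is_conformal_module (R : realType) (Q : quadrilateral R) (m : R) :
    Prop :=
  exists a b c d : R, [/\ a < b, c < d,
    exists f, quad_conformal_mapping a b c d Q f & m = (d - c) / (b - a)].

Definition annular_rectangle (R : realType) (beta gamma : R) :
    set (plane R) :=
  polar_region `]1, beta ^+ 2[ `]gamma, 2 * pi - gamma[.

Definition annular_exterior (R : realType) (beta gamma : R) :
    quadrilateral R :=
  Quadrilateral
    (~` (@to_sphere R @` closure (annular_rectangle beta gamma)))
    (@to_sphere R @` polar_region [set 1; beta ^+ 2] [set gamma; - gamma])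
    [set @to_sphere R @` polar_region `[1, beta ^+ 2] [set gamma];
         @to_sphere R @` polar_region `[1, beta ^+ 2] [set - gamma]]
    [set @to_sphere R @` polar_region [set 1] `]gamma, 2 * pi - gamma[;
         @to_sphere R @` polar_region [set beta ^+ 2]
           `]gamma, 2 * pi - gamma[].

Definition gear_domain (R : realType) (beta gamma : R) : set (plane R) :=
  [set z : plane R | `|z| < 1] `|` polar_region `]0, beta[ `]- gamma, gamma[.

Definition gear_quadrilateral (R : realType) (beta gamma : R) :
    quadrilateral R :=
  Quadrilateral
    (@to_sphere R @` gear_domain beta gamma)
    (@to_sphere R @` polar_region [set 1; beta] [set gamma; - gamma])
    [set @to_sphere R @` polar_region `[1, beta] [set gamma];
         @to_sphere R @` polar_region `[1, beta] [set - gamma]]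
    [set @to_sphere R @` polar_region [set 1] `]gamma, 2 * pi - gamma[;
         @to_sphere R @` polar_region [set beta] `]- gamma, gamma[].

(* Main.v *)
Require Import Defs.
From mathcomp Require Import all_boot all_order all_algebra.
From mathcomp Require Import complex.
From mathcomp Require Import all_classical all_reals all_analysis.
From mathcomp Require Import ring lra.
Import Order.TTheory GRing.Theory Num.Theory.
Import numFieldNormedType.Exports.
Set Implicit Arguments.
Unset Strict Implicit.
Unset Printing Implicit Defensive.
Local Open Scope classical_set_scope.
Local Open Scope ring_scope.
Local Open Scope complex_scope.
(* The real-valued real and imaginary parts. *)
Local Notation Re := complex.Re.
Local Notation Im := complex.Im.

(** The circle of radius [beta] about the origin is a symmetry axis of the annular
    rectangle: the reflection [w |-> beta^2 / conj w] exchanges the two halves of its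
    exterior.  The half inside that circle is the gear domain, since a point of modulus
    less than [beta] is outside the closed annular rectangle exactly when it lies in the
    unit disc or in the sector of half angle [gamma].  Hence a conformal map of a
    rectangle of width [b - a] onto the gear domain that sends a vertical side onto the
    outer arc extends, by reflection in that side and in that arc, to a conformal map of
    the rectangle of width [2 * (b - a)] onto the exterior ([gear_double]).  This
    produces a map of module [m / 2].

    The extension is holomorphic across the seam because a continuous function that is
    holomorphic off a vertical line is holomorphic ([painleve]).  The proof goes through
    Goursat's theorem on rectangles, which tolerates finitely many exceptional vertical
    lines, and through Cauchy's formula in the form [oint f(z)/(z-w) dz = f(w) J(w)] with
    [J(w) = oint dz/(z-w)]; that [J] does not vanish is enough, and follows from the
    positivity of its imaginary part.

    That [m / 2] is the only module of the exterior is the conformal invariance of the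
    module ([module_unique]).  Given two maps [F1] and [F2] from rectangles onto the same
    quadrilateral, the transition map [h], with [F2 o h = F1], is a homeomorphism of the
    closed rectangles.  It is holomorphic wherever the derivative of [F2] does not vanish
    at the image point; the zeros of that derivative are isolated because [F2] is
    injective ([injective_deriv_neq0]), and isolated points are removable.  So the
    integral of [h] along the boundary of the first rectangle is 0.  But [Re h] is constant
    on vertical sides and [Im h] on horizontal ones, and the imaginary part of the
    integral is, up to signs, the difference of the two products
    width of one rectangle times height of the other ([rectangle_rigidity]).  So the
    two rectangles are similar.  The point at infinity is moved away by the coordinate
    [1 / (w + beta)], as [- beta] lies inside the annular rectangle. *)

(** * The complex plane: modulus, limits and derivatives *)

Section PlaneBasics.
Context {R : realType}.
Implicit Types (z w : plane R) (e d : R).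

(** The modulus of a complex number as a real number. *)
Definition cabs (z : plane R) : R := Normc.normc z.

Lemma normE z : `|z| = (cabs z)%:C. Proof. by []. Qed.

Lemma cabsE z : cabs z = Num.sqrt (Re z ^+ 2 + Im z ^+ 2).
Proof. by case: z. Qed.

Lemma cabs_sqr z : cabs z ^+ 2 = Re z ^+ 2 + Im z ^+ 2.
Proof. by rewrite cabsE sqr_sqrtr // addr_ge0 // sqr_ge0. Qed.

Lemma cabs_ge0 z : 0 <= cabs z.
Proof. by rewrite cabsE sqrtr_ge0. Qed.

Lemma cabs0 : cabs 0 = 0. Proof. exact: Normc.normc0. Qed.

Lemma cabs1 : cabs 1 = 1. Proof. exact: Normc.normc1. Qed.

Lemma cabs_eq0 z : (cabs z == 0) = (z == 0).
Proof.
by apply/eqP/eqP => [/Normc.eq0_normc//|->]; exact: cabs0.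
Qed.

Lemma cabs_gt0 z : (0 < cabs z) = (z != 0).
Proof. by rewrite lt_def cabs_ge0 andbT cabs_eq0. Qed.

Lemma cabsM z w : cabs (z * w) = cabs z * cabs w.
Proof. exact: Normc.normcM. Qed.

Lemma cabsV z : cabs z^-1 = (cabs z)^-1.
Proof. exact: Normc.normcV. Qed.

Lemma cabsX z n : cabs (z ^+ n) = cabs z ^+ n.
Proof. by elim: n => [|n IH]; rewrite ?cabs1 // !exprS cabsM IH. Qed.

Lemma cabsD z w : cabs (z + w) <= cabs z + cabs w.
Proof. exact: le_normcD. Qed.

Lemma cabsN z : cabs (- z) = cabs z.
Proof. exact: normcN. Qed.

Lemma cabsB z w : cabs (z - w) = cabs (w - z).
Proof. by rewrite -cabsN opprB. Qed.

Lemma cabsDB z w : cabs z - cabs w <= cabs (z - w).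
Proof. by rewrite lerBlDr -{1}(subrK w z) cabsD. Qed.

Lemma cabs_tri u z w : cabs (z - w) <= cabs (z - u) + cabs (u - w).
Proof. by rewrite -{1}(subrK u z) -addrA cabsD. Qed.

Lemma cabsJ z : cabs (z^*)%C = cabs z.
Proof. by rewrite !cabsE; case: z => x y /=; rewrite sqrrN. Qed.

Lemma cabs_real (x : R) : cabs (x +i* 0) = `|x|.
Proof. by rewrite cabsE /= expr0n /= addr0 sqrtr_sqr. Qed.

Lemma Re_le_cabs z : `|Re z| <= cabs z.
Proof. by rewrite cabsE -sqrtr_sqr ler_wsqrtr // lerDl sqr_ge0. Qed.

Lemma Im_le_cabs z : `|Im z| <= cabs z.
Proof. by rewrite cabsE -sqrtr_sqr ler_wsqrtr // lerDr sqr_ge0. Qed.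

Lemma cabs_le z : cabs z <= `|Re z| + `|Im z|.
Proof.
have h0 : 0 <= `|Re z| + `|Im z| by rewrite addr_ge0.
rewrite -(ger0_norm (cabs_ge0 z)) -(ger0_norm h0).
rewrite -ler_sqr ?nnegrE ?normr_ge0 // !real_normK ?num_real // cabs_sqr.
rewrite sqrrD !real_normK ?num_real //.
by rewrite lerD2r lerDl mulrn_wge0 // mulr_ge0.
Qed.

Lemma ReD z w : Re (z + w) = Re z + Re w. Proof. by case: z w => ? ? []. Qed.
Lemma ImD z w : Im (z + w) = Im z + Im w. Proof. by case: z w => ? ? []. Qed.
Lemma ReN z : Re (- z) = - Re z. Proof. by case: z. Qed.
Lemma ImN z : Im (- z) = - Im z. Proof. by case: z. Qed.
Lemma ReB z w : Re (z - w) = Re z - Re w. Proof. by rewrite ReD ReN. Qed.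
Lemma ImB z w : Im (z - w) = Im z - Im w. Proof. by rewrite ImD ImN. Qed.
Lemma ReM z w : Re (z * w) = Re z * Re w - Im z * Im w.
Proof. by case: z w => ? ? []. Qed.
Lemma ImM z w : Im (z * w) = Re z * Im w + Im z * Re w.
Proof. by case: z w => ? ? []. Qed.

Lemma complex_ext z w : Re z = Re w -> Im z = Im w -> z = w.
Proof. by case: z w => ? ? [? ?] /= -> ->. Qed.

Lemma complex_eta z : z = Re z +i* Im z. Proof. by case: z. Qed.

Lemma plane_nbhsP z (A : set (plane R)) :
  nbhs z A <-> exists2 e, 0 < e & forall w, cabs (w - z) < e -> A w.
Proof.
split.
  move=> /nbhs_normP [[x y] /= e0 H].
  move: e0; rewrite ltcE /= => /andP [/eqP y0 x0]; subst y.
  exists x => // w hw; apply: H => /=.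
  by rewrite normE cabsB ltcR.
case=> e e0 H; apply/(@nbhs_normP _ (plane R)); exists e%:C => /=; first by rewrite ltcR.
by move=> w /=; rewrite normE ltcR cabsB; exact: H.
Qed.

Lemma continuousP z (f : plane R -> plane R) :
  {for z, continuous f} <->
  forall e, 0 < e -> exists2 d, 0 < d &
    forall w, cabs (w - z) < d -> cabs (f w - f z) < e.
Proof.
split.
  move=> cf e e0.
  have : nbhs (f z) [set w | cabs (w - f z) < e].
    by apply/plane_nbhsP; exists e.
  by move=> /cf /plane_nbhsP.
move=> H A /plane_nbhsP [e e0 HA].
have [d d0 Hd] := H e e0.
by apply/plane_nbhsP; exists d => // w /Hd; exact: HA.
Qed.

Lemma continuous_toP (T : topologicalType) (t : T) (f : T -> plane R) :
  {for t, continuous f} <->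
  forall e, 0 < e -> \forall s \near t, cabs (f s - f t) < e.
Proof.
split.
  move=> cf e e0.
  have : nbhs (f t) [set w | cabs (w - f t) < e].
    by apply/plane_nbhsP; exists e.
  exact: cf.
move=> H A /plane_nbhsP [e e0 HA].
by apply: filterS (H e e0) => s /= /HA.
Qed.

Lemma continuous_fromP z (g : plane R -> R) :
  (forall e, 0 < e -> exists2 d, 0 < d &
    forall w, cabs (w - z) < d -> `|g w - g z| < e) ->
  {for z, continuous g}.
Proof.
move=> H A /nbhs_ballP [e /= e0 HA].
have [d d0 Hd] := H e e0.
by apply/plane_nbhsP; exists d => // w /Hd; rewrite distrC => /HA.
Qed.

Lemma Re_continuous : continuous (fun z : plane R => Re z : R).
Proof.
move=> z; apply: continuous_fromP => e e0; exists e => // w.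
by apply: le_lt_trans; rewrite -ReB Re_le_cabs.
Qed.

Lemma Im_continuous : continuous (fun z : plane R => Im z : R).
Proof.
move=> z; apply: continuous_fromP => e e0; exists e => // w.
by apply: le_lt_trans; rewrite -ImB Im_le_cabs.
Qed.

Lemma cabs_continuous : continuous cabs.
Proof.
move=> z; apply: continuous_fromP => e e0; exists e => // w.
apply: le_lt_trans; rewrite ler_norml.
have := cabsDB z w; have := cabsDB w z; rewrite (cabsB z w); lra.
Qed.

Lemma conj_continuous : continuous (fun z : plane R => (z^*)%C : plane R).
Proof.
move=> z; apply/continuousP => e e0; exists e => // w.
by rewrite -rmorphB cabsJ.
Qed.

Lemma complex_continuous_at (T : topologicalType) (t : T) (f g : T -> R) :
  {for t, continuous f} -> {for t, continuous g} ->
  {for t, continuous (fun t => f t +i* g t : plane R)}.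
Proof.
move=> cf cg; apply/continuous_toP => e e0.
have e20 : 0 < e / 2 by lra.
have /cvgrPdist_lt/(_ _ e20) h1 := cf.
have /cvgrPdist_lt/(_ _ e20) h2 := cg.
near=> s.
apply: le_lt_trans (cabs_le _) _ => /=.
have : `|f t - f s| < e / 2 by near: s.
have : `|g t - g s| < e / 2 by near: s.
rewrite (distrC (f t)) (distrC (g t)); lra.
Unshelve. all: end_near. Qed.

Lemma hline_continuous (y : R) : continuous (fun x : R => x +i* y : plane R).
Proof. by move=> x; apply: complex_continuous_at; [exact: cvg_id|exact: cvg_cst]. Qed.

Lemma vline_continuous (x : R) : continuous (fun y : R => x +i* y : plane R).
Proof. by move=> y; apply: complex_continuous_at; [exact: cvg_cst|exact: cvg_id]. Qed.

(** Complex differentiability with derivative [l], with real tolerances. *)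
Definition has_deriv (f : plane R -> plane R) z (l : plane R) :=
  forall e, 0 < e -> exists2 d, 0 < d &
    forall w, cabs (w - z) < d -> cabs (f w - f z - l * (w - z)) <= e * cabs (w - z).

Lemma has_deriv_derivable f z l : has_deriv f z l -> derivable f z 1.
Proof.
move=> H; apply/cvg_ex; exists l.
move=> A /plane_nbhsP [e e0 HA].
have [d d0 Hd] := H (e / 2) ltac:(lra).
apply/plane_nbhsP; exists d => // h /=; rewrite subr0 => hd hn0.
apply: HA.
have := Hd (h + z); rewrite addrK => /(_ hd) Hh.
rewrite /shift /= scaler1.
have -> : h^-1 *: (f (h + z) - f z) - l = h^-1 * (f (h + z) - f z - l * h).
  by rewrite mulrBr (mulrC l) mulrA mulVf // mul1r.
rewrite cabsM cabsV -(ltr_pM2l (x := cabs h)) ?cabs_gt0 // mulrA divff ?cabs_eq0 // mul1r.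
apply: le_lt_trans Hh _; rewrite mulrC ltr_pM2l ?cabs_gt0 //; lra.
Qed.

Lemma derivable_has_deriv f z : derivable f z 1 -> exists l, has_deriv f z l.
Proof.
move=> /cvg_ex [l Hl]; exists l => e e0.
have : nbhs l [set w | cabs (w - l) < e] by apply/plane_nbhsP; exists e.
move=> /Hl /plane_nbhsP [d d0 Hd].
exists d => // w hw.
have [->|wz] := eqVneq w z; first by rewrite !subrr mulr0 subrr cabs0 mulr0.
have wz0 : w - z != 0 by rewrite subr_eq0.
have := Hd (w - z); rewrite subr0 => /(_ hw wz0) /=.
rewrite /shift /= scaler1 subrK => Hh.
have -> : f w - f z - l * (w - z) = ((w - z)^-1 *: (f w - f z) - l) * (w - z).
  by rewrite mulrBl mulrAC mulVf // mul1r.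
by rewrite cabsM ler_wpM2r ?cabs_ge0 // ltW.
Qed.

Lemma derivableP f z : derivable f z 1 <-> exists l, has_deriv f z l.
Proof.
by split; [exact: derivable_has_deriv|case=> l; exact: has_deriv_derivable].
Qed.

Lemma derivable_cont (f : plane R -> plane R) z :
  derivable f z 1 -> {for z, continuous f}.
Proof. by move=> df; apply: differentiable_continuous; exact/derivable1_diffP. Qed.

Lemma has_deriv_eq f g z l : (\forall w \near z, f w = g w) -> has_deriv f z l ->
  has_deriv g z l.
Proof.
move=> /plane_nbhsP [r r0 H] hf e e0.
have [d d0 Hd] := hf e e0.
exists (Num.min d r); first by rewrite lt_min d0 r0.
move=> w; rewrite lt_min => /andP [/Hd hd /H hr].
by rewrite -hr -H // subrr cabs0.
Qed.

Lemma derivable_near_eq (f g : plane R -> plane R) z : (\forall w \near z, f w = g w) ->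
  derivable f z 1 -> derivable g z 1.
Proof.
move=> H /derivableP [l hl]; apply/derivableP; exists l.
exact: has_deriv_eq hl.
Qed.

Lemma derivable_comp (f g : plane R -> plane R) z :
  derivable f (g z) 1 -> derivable g z 1 -> derivable (fun x => f (g x)) z 1.
Proof.
move=> /derivable1_diffP df /derivable1_diffP dg.
exact/derivable1_diffP/(differentiable_comp dg df).
Qed.

Lemma derivable_continuous_local (f g : plane R -> plane R) z :
  (\forall w \near z, f w = g w) -> {for z, continuous f} -> {for z, continuous g}.
Proof.
move=> H cf A; rewrite -(nbhs_singleton H) => /cf h.
by apply: filterS2 H h => w /= ->.
Qed.

Lemma plane_continuous (T : topologicalType) (f : T -> plane R) :
  (forall t, {for t, continuous f}) -> continuous f.
Proof. by []. Qed.

Lemma plane_contM (T : topologicalType) (f g : T -> plane R) t :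
  {for t, continuous f} -> {for t, continuous g} ->
  {for t, continuous (fun s => f s * g s : plane R)}.
Proof. exact: (@continuousM R[i] T f g t). Qed.

Lemma plane_contD (T : topologicalType) (f g : T -> plane R) t :
  {for t, continuous f} -> {for t, continuous g} ->
  {for t, continuous (fun s => f s + g s : plane R)}.
Proof. exact: continuousD. Qed.

Lemma plane_contN (T : topologicalType) (f : T -> plane R) t :
  {for t, continuous f} -> {for t, continuous (fun s => - f s : plane R)}.
Proof. exact: continuousN. Qed.

Lemma plane_contB (T : topologicalType) (f g : T -> plane R) t :
  {for t, continuous f} -> {for t, continuous g} ->
  {for t, continuous (fun s => f s - g s : plane R)}.
Proof. by move=> cf cg; exact: (plane_contD cf (plane_contN cg)). Qed.

Lemma plane_contV (T : topologicalType) (f : T -> plane R) t : f t != 0 ->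
  {for t, continuous f} -> {for t, continuous (fun s => (f s)^-1 : plane R)}.
Proof. exact: (@continuousV R[i] T f t). Qed.

Lemma plane_cont_cst (T : topologicalType) (k : plane R) (t : T) :
  {for t, continuous (fun=> k : plane R)}.
Proof. exact: cst_continuous. Qed.

Lemma plane_cont_id z : {for z, continuous (fun w : plane R => w)}.
Proof. exact: cvg_id. Qed.

Lemma plane_derM (f g : plane R -> plane R) z : derivable f z 1 -> derivable g z 1 ->
  derivable (fun w => f w * g w : plane R) z 1.
Proof. exact: derivableM. Qed.

Lemma plane_derB (f g : plane R -> plane R) z : derivable f z 1 -> derivable g z 1 ->
  derivable (fun w => f w - g w : plane R) z 1.
Proof. exact: derivableB. Qed.

Lemma plane_derV (f : plane R -> plane R) z : f z != 0 -> derivable f z 1 ->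
  derivable (fun w => (f w)^-1 : plane R) z 1.
Proof. exact: derivableV. Qed.

Lemma plane_der_cst (k : plane R) z : derivable (fun _ : plane R => k) z 1.
Proof. exact: derivable_cst. Qed.

Lemma plane_der_id z : derivable (fun w : plane R => w) z 1.
Proof. exact: derivable_id. Qed.

End PlaneBasics.

(** * Integrals along the sides of a rectangle *)

Section RealIntegral.
Context {R : realType}.
Implicit Types (g h : R -> R) (a b c : R).

(** The integral of a real function over the segment from [a] to [b], for [a <= b]. *)
Definition rint g a b : R := \int[lebesgue_measure]_(x in `[a, b]) g x.

Lemma continuous_integrable g a b : continuous g ->
  lebesgue_measure.-integrable `[a, b] (EFin \o g).
Proof.
move=> cg; apply: continuous_compact_integrable; first exact: segment_compact.
exact: continuous_subspaceT.
Qed.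

Lemma rintD g h a b : continuous g -> continuous h ->
  rint (fun x => g x + h x) a b = rint g a b + rint h a b.
Proof.
by move=> cg ch; rewrite /rint RintegralD //; exact: continuous_integrable.
Qed.

Lemma rintB g h a b : continuous g -> continuous h ->
  rint (fun x => g x - h x) a b = rint g a b - rint h a b.
Proof.
by move=> cg ch; rewrite /rint RintegralB //; exact: continuous_integrable.
Qed.

Lemma rintZ k g a b : continuous g ->
  rint (fun x => k * g x) a b = k * rint g a b.
Proof.
by move=> cg; rewrite /rint RintegralZl //; exact: continuous_integrable.
Qed.

Lemma rint_cst k a b : a <= b -> rint (fun=> k) a b = k * (b - a).
Proof.
move=> ab; rewrite /rint Rintegral_cst; last exact: measurable_itv.
have h : fine (lebesgue_measure `[a, b]%classic) = b - a.
  rewrite lebesgue_measure_itv /= lte_fin; case: ltP => [//|ba].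
  by rewrite (@le_anti _ _ a b) ?ab // subrr.
by rewrite -[in RHS]h.
Qed.

Lemma rint_eq g h a b : (forall x, a <= x <= b -> g x = h x) ->
  rint g a b = rint h a b.
Proof.
move=> H; apply: eq_Rintegral => x; rewrite inE /= in_itv /=; exact: H.
Qed.

Lemma rint_split g a c b : continuous g -> a <= c -> c <= b ->
  rint g a b = rint g a c + rint g c b.
Proof.
move=> cg ac cb; apply/eqP; rewrite addrC -subr_eq; apply/eqP.
have icb := continuous_integrable c b cg.
have := @Rintegral_itvB R g (BLeft a) (BRight b) c (continuous_integrable a b cg).
rewrite !bnd_simp => /(_ ac cb) ->.
apply: Rintegral_itv_obnd_cbnd; apply: integrableS icb => //.
by apply: subset_itvr; rewrite bnd_simp.
Qed.

Lemma rint_le g h a b : continuous g -> continuous h ->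
  (forall x, a <= x <= b -> g x <= h x) -> rint g a b <= rint h a b.
Proof.
move=> cg ch H; apply: le_Rintegral;
  [by []|exact: continuous_integrable|exact: continuous_integrable|].
by move=> x; rewrite /= in_itv /=; exact: H.
Qed.

Lemma rint_bound g a b M : continuous g -> a <= b ->
  (forall x, a <= x <= b -> `|g x| <= M) -> `|rint g a b| <= M * (b - a).
Proof.
move=> cg ab H; rewrite ler_norml; apply/andP; split.
  rewrite -mulNr -(rint_cst (- M) ab); apply: rint_le => //; first exact: cst_continuous.
  by move=> x /H; rewrite ler_norml => /andP [].
rewrite -(rint_cst M ab); apply: rint_le => //; first exact: cst_continuous.
by move=> x /H; rewrite ler_norml => /andP [].
Qed.

Lemma rint_id a b : a <= b -> rint id a b = (b ^+ 2 - a ^+ 2) / 2.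
Proof.
rewrite le_eqVlt => /orP [/eqP -> |ab].
  by rewrite subrr mul0r /rint set_itv1 Rintegral_set1.
pose F (x : R) := x ^+ 2 / 2.
have dF (x : R) : is_derive x 1 F x.
  rewrite /F; apply: is_derive_eq.
  by rewrite /GRing.scale /=; field.
rewrite /rint /Rintegral (@continuous_FTC2 _ id F) //.
- by rewrite /F -EFinB /= mulrBl.
- by apply: continuous_subspaceT => x; exact: cvg_id.
- have cF : continuous F.
    move=> x; apply: differentiable_continuous; apply/derivable1_diffP.
    by case: (dF x).
  split.
  + by move=> x _; case: (dF x).
  + exact/cvg_at_right_filter/cF.
  + exact/cvg_at_left_filter/cF.
- by move=> x _; rewrite derive1E; exact: derive_val.
Qed.

Lemma rint_gt0 g a b : continuous g -> a < b ->
  (forall x, a <= x <= b -> 0 < g x) -> 0 < rint g a b.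
Proof.
move=> cg ab H.
have [|c + Hc] := @EVT_min R g a b (ltW ab); first exact: continuous_subspaceT.
rewrite in_itv /= => cab.
apply: lt_le_trans (_ : g c * (b - a) <= _).
  by rewrite mulr_gt0 ?H // subr_gt0.
rewrite -(rint_cst _ (ltW ab)); apply: rint_le; [exact: cst_continuous|by []|].
by move=> x xab; apply: Hc; rewrite in_itv.
Qed.

End RealIntegral.

Section ComplexIntegral.
Context {R : realType}.
Implicit Types (g h : R -> plane R) (a b c : R).

(** The integral of a complex function of a real variable, taken componentwise. *)
Definition cint g a b : plane R := rint (fun x => Re (g x)) a b +i* rint (fun x => Im (g x)) a b.

Lemma continuous_Re g : continuous g -> continuous (fun x => Re (g x) : R).
Proof. by move=> cg x; apply: (continuous_comp (cg x)); exact: Re_continuous. Qed.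

Lemma continuous_Im g : continuous g -> continuous (fun x => Im (g x) : R).
Proof. by move=> cg x; apply: (continuous_comp (cg x)); exact: Im_continuous. Qed.

Lemma cintD g h a b : continuous g -> continuous h ->
  cint (fun x => g x + h x) a b = cint g a b + cint h a b.
Proof.
move=> cg ch; apply: complex_ext; rewrite ?ReD ?ImD /= -rintD;
  try exact: continuous_Re; try exact: continuous_Im;
  by apply: rint_eq => x _; rewrite ?ReD ?ImD.
Qed.

Lemma cintZ (k : plane R) g a b : continuous g ->
  cint (fun x => k * g x) a b = k * cint g a b.
Proof.
move=> cg; have cr := continuous_Re cg; have ci := continuous_Im cg.
have crk u : continuous (fun x => u * Re (g x) : R).
  by move=> x; apply: cvgM; [exact: cst_continuous|exact: cr].
have cik u : continuous (fun x => u * Im (g x) : R).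
  by move=> x; apply: cvgM; [exact: cst_continuous|exact: ci].
apply: complex_ext; rewrite ?ReM ?ImM /= -!rintZ // -?rintB // -?rintD //;
  by apply: rint_eq => x _; rewrite ?ReM ?ImM.
Qed.

Lemma cint_eq g h a b : (forall x, a <= x <= b -> g x = h x) ->
  cint g a b = cint h a b.
Proof. by move=> H; congr (_ +i* _); apply: rint_eq => x /H ->. Qed.

Lemma cint_split g a c b : continuous g -> a <= c -> c <= b ->
  cint g a b = cint g a c + cint g c b.
Proof.
move=> cg ac cb; rewrite /cint (rint_split (continuous_Re cg) ac cb).
by rewrite (rint_split (continuous_Im cg) ac cb).
Qed.

Lemma cint_bound g a b M : continuous g -> a <= b ->
  (forall x, a <= x <= b -> cabs (g x) <= M) -> cabs (cint g a b) <= 2 * M * (b - a).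
Proof.
move=> cg ab H; apply: le_trans (cabs_le _) _ => /=.
have -> : 2 * M * (b - a) = M * (b - a) + M * (b - a) by ring.
apply: lerD; apply: rint_bound => //; try exact: continuous_Re; try exact: continuous_Im;
  by move=> x /H; apply: le_trans; rewrite ?Re_le_cabs ?Im_le_cabs.
Qed.

(** The imaginary unit, kept folded. *)
Definition ci : plane R := 0 +i* 1.

Lemma cabs_ci : cabs ci = 1.
Proof. by rewrite cabsE /= expr0n expr1n /= add0r sqrtr1. Qed.

(** Points of the boundary of a rectangle. *)
Definition boundary (x1 x2 y1 y2 : R) : set (plane R) :=
  [set z | [/\ x1 <= Re z <= x2, y1 <= Im z <= y2 &
     [\/ Re z = x1, Re z = x2, Im z = y1 | Im z = y2]]].

(** Continuity along the four lines that carry the sides of a rectangle; the functions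
    integrated below may have poles elsewhere. *)
Definition line_continuous (f : plane R -> plane R) (x1 x2 y1 y2 : R) :=
  [/\ continuous (fun x => f (x +i* y1)), continuous (fun x => f (x +i* y2)),
      continuous (fun y => f (x1 +i* y)) & continuous (fun y => f (x2 +i* y))].

(** The integral of [f dz] along the boundary of the rectangle [x1, x2] x [y1, y2],
    counterclockwise. *)
Definition oint (f : plane R -> plane R) (x1 x2 y1 y2 : R) : plane R :=
  cint (fun x => f (x +i* y1)) x1 x2 - cint (fun x => f (x +i* y2)) x1 x2
  + ci * (cint (fun y => f (x2 +i* y)) y1 y2 - cint (fun y => f (x1 +i* y)) y1 y2).

Lemma continuous_line f x1 x2 y1 y2 : continuous f -> line_continuous f x1 x2 y1 y2.
Proof.
move=> cf; split=> x; apply: continuous_comp (cf _); try exact: hline_continuous;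
 exact: vline_continuous.
Qed.

Lemma ointD (f g : plane R -> plane R) x1 x2 y1 y2 : line_continuous f x1 x2 y1 y2 ->
  line_continuous g x1 x2 y1 y2 ->
  oint (fun z => f z + g z) x1 x2 y1 y2 = oint f x1 x2 y1 y2 + oint g x1 x2 y1 y2.
Proof.
move=> [c1 c2 c3 c4] [d1 d2 d3 d4].
rewrite /oint (cintD _ _ c1 d1) (cintD _ _ c2 d2) (cintD _ _ c3 d3) (cintD _ _ c4 d4).
by do 8 move: (cint _ _ _) => ?; move: ci => ?; ring.
Qed.

Lemma ointZ (k : plane R) (f : plane R -> plane R) x1 x2 y1 y2 : line_continuous f x1 x2 y1 y2 ->
  oint (fun z => k * f z) x1 x2 y1 y2 = k * oint f x1 x2 y1 y2.
Proof.
move=> [c1 c2 c3 c4].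
rewrite /oint (cintZ _ _ _ c1) (cintZ _ _ _ c2) (cintZ _ _ _ c3) (cintZ _ _ _ c4).
by do 4 move: (cint _ _ _) => ?; move: ci => ?; ring.
Qed.

Lemma oint_eq (f g : plane R -> plane R) x1 x2 y1 y2 : x1 <= x2 -> y1 <= y2 ->
  (forall z, boundary x1 x2 y1 y2 z -> f z = g z) ->
  oint f x1 x2 y1 y2 = oint g x1 x2 y1 y2.
Proof.
move=> x12 y12 H; rewrite /oint; congr (_ - _ + _ * (_ - _)); apply: cint_eq => t ht; apply: H;
 split => //=; rewrite ?lexx ?x12 ?y12 //;
 by [constructor 1|constructor 2|constructor 3|constructor 4].
Qed.

Lemma oint_bound f x1 x2 y1 y2 M : line_continuous f x1 x2 y1 y2 -> x1 <= x2 -> y1 <= y2 ->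
  (forall z, boundary x1 x2 y1 y2 z -> cabs (f z) <= M) ->
  cabs (oint f x1 x2 y1 y2) <= 4 * M * ((x2 - x1) + (y2 - y1)).
Proof.
move=> [c1 c2 c3 c4] x12 y12 H; rewrite /oint.
have h1 : cabs (cint (fun x => f (x +i* y1)) x1 x2) <= 2 * M * (x2 - x1).
  apply: (cint_bound c1 x12) => t ht; apply: H; split;
    [exact: ht|by rewrite /= lexx y12|by constructor 3].
have h2 : cabs (cint (fun x => f (x +i* y2)) x1 x2) <= 2 * M * (x2 - x1).
  apply: (cint_bound c2 x12) => t ht; apply: H; split;
    [exact: ht|by rewrite /= lexx y12|by constructor 4].
have h3 : cabs (cint (fun x => f (x1 +i* x)) y1 y2) <= 2 * M * (y2 - y1).
  apply: (cint_bound c3 y12) => t ht; apply: H; split;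
    [by rewrite /= lexx x12|exact: ht|by constructor 1].
have h4 : cabs (cint (fun x => f (x2 +i* x)) y1 y2) <= 2 * M * (y2 - y1).
  apply: (cint_bound c4 y12) => t ht; apply: H; split;
    [by rewrite /= lexx x12|exact: ht|by constructor 2].
apply: le_trans (cabsD _ _) _; rewrite cabsM.
rewrite cabs_ci.
have := cabsD (cint (fun x => f (x +i* y1)) x1 x2) (- cint (fun x => f (x +i* y2)) x1 x2).
have := cabsD (cint (fun x => f (x2 +i* x)) y1 y2) (- cint (fun x => f (x1 +i* x)) y1 y2).
rewrite !cabsN mul1r.
have -> : 4 * M * (x2 - x1 + (y2 - y1)) = 2 * M * (x2 - x1) + 2 * M * (x2 - x1)
  + (2 * M * (y2 - y1) + 2 * M * (y2 - y1)) by ring.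
lra.
Qed.

Lemma oint_splitx f x1 s x2 y1 y2 : continuous f -> x1 <= s -> s <= x2 ->
  oint f x1 x2 y1 y2 = oint f x1 s y1 y2 + oint f s x2 y1 y2.
Proof.
move=> cf h1 h2; have [c1 c2 _ _] := continuous_line x1 x2 y1 y2 cf.
rewrite /oint (cint_split c1 h1 h2) (cint_split c2 h1 h2).
by do 6 move: (cint _ _ _) => ?; move: ci => ?; ring.
Qed.

Lemma oint_splity f x1 x2 y1 s y2 : continuous f -> y1 <= s -> s <= y2 ->
  oint f x1 x2 y1 y2 = oint f x1 x2 y1 s + oint f x1 x2 s y2.
Proof.
move=> cf h1 h2; have [_ _ c1 c2] := continuous_line x1 x2 y1 y2 cf.
rewrite /oint (cint_split c1 h1 h2) (cint_split c2 h1 h2).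
by do 6 move: (cint _ _ _) => ?; move: ci => ?; ring.
Qed.

Lemma oint_affine (k l : plane R) x1 x2 y1 y2 : x1 <= x2 -> y1 <= y2 ->
  oint (fun z => k + l * z) x1 x2 y1 y2 = 0.
Proof.
move=> x12 y12.
have ck : continuous (fun _ : plane R => k) by exact: cst_continuous.
have cz : continuous (fun z : plane R => z) by move=> z; exact: cvg_id.
have clz : continuous (fun z : plane R => l * z).
  by move=> z; apply: plane_contM; [exact: plane_cont_cst|exact: plane_cont_id].
rewrite (ointD (continuous_line _ _ _ _ ck) (continuous_line _ _ _ _ clz)).
rewrite [oint (fun z => l * z) _ _ _ _](ointZ l (continuous_line _ _ _ _ cz)).
have -> : oint (fun _ : plane R => k) x1 x2 y1 y2 = 0.
  by rewrite /oint !subrr mulr0 addr0.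
have -> : oint (fun z : plane R => z) x1 x2 y1 y2 = 0.
  rewrite /oint /cint /= !rint_cst // !rint_id // /ci.
  apply: complex_ext; rewrite ?(ReD, ImD, ReM, ImM, ReN, ImN) /=; by field.
by rewrite mulr0 addr0.
Qed.

End ComplexIntegral.

(** * Cauchy's theorem on rectangles *)

Section Goursat.
Context {R : realType}.
Implicit Types (f : plane R -> plane R) (z w : plane R).

Lemma exp2_gt (W d : R) : 0 < d -> exists n : nat, W / 2 ^+ n < d.
Proof.
move=> d0; exists (Num.truncn (`|W| / d)).+1.
set n := (Num.truncn (`|W| / d)).+1.
rewrite ltr_pdivrMr ?exprn_gt0 // mulrC -ltr_pdivrMr //.
apply: le_lt_trans (_ : `|W| / d < _).
  by rewrite ler_pM2r ?invr_gt0 // ler_norm.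
apply: lt_trans (truncnS_gt _) _.
by rewrite -natrX ltr_nat ltn_expl.
Qed.

Lemma midpoint_itv (x y : R) : x <= y -> x <= (x + y) / 2 /\ (x + y) / 2 <= y.
Proof. by move=> xy; split; lra. Qed.

(** A property of rectangles that passes from the four quarters to the whole, and that
    holds for all small rectangles around each point, holds for the whole rectangle. *)
Lemma bisection (P : R -> R -> R -> R -> Prop) (x1 x2 y1 y2 : R) :
  x1 <= x2 -> y1 <= y2 ->
  (forall u1 u2 v1 v2, u1 <= u2 -> v1 <= v2 ->
    P u1 ((u1 + u2) / 2) v1 ((v1 + v2) / 2) ->
    P ((u1 + u2) / 2) u2 v1 ((v1 + v2) / 2) ->
    P u1 ((u1 + u2) / 2) ((v1 + v2) / 2) v2 ->
    P ((u1 + u2) / 2) u2 ((v1 + v2) / 2) v2 -> P u1 u2 v1 v2) ->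
  (forall z, x1 <= Re z <= x2 -> y1 <= Im z <= y2 ->
    exists2 d, 0 < d & forall u1 u2 v1 v2, x1 <= u1 -> u2 <= x2 -> y1 <= v1 -> v2 <= y2 ->
      u1 <= Re z <= u2 -> v1 <= Im z <= v2 -> u2 - u1 < d -> v2 - v1 < d ->
      P u1 u2 v1 v2) ->
  P x1 x2 y1 y2.
Proof.
move=> x12 y12 H1 H2; apply: contrapT => nP.
pose bad (r : (R * R) * (R * R)) :=
  [/\ r.1.1 <= r.1.2, r.2.1 <= r.2.2 & ~ P r.1.1 r.1.2 r.2.1 r.2.2].
pose half (a b : R * R) := [/\ a.1 <= b.1, b.2 <= a.2 & b.2 - b.1 = (a.2 - a.1) / 2].
have step r : bad r -> exists r', [/\ bad r', half r.1 r'.1 & half r.2 r'.2].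
  case: r => [[u1 u2] [v1 v2]] [/= u12 v12 nPr].
  apply: contrapT => nex; apply: nPr; apply: H1 => //; apply: contrapT => nPq; apply: nex.
  - by exists ((u1, (u1 + u2) / 2), (v1, (v1 + v2) / 2)); split;
      [split=> //=; lra|split=> /=; lra..].
  - by exists (((u1 + u2) / 2, u2), (v1, (v1 + v2) / 2)); split;
      [split=> //=; lra|split=> /=; lra..].
  - by exists ((u1, (u1 + u2) / 2), ((v1 + v2) / 2, v2)); split;
      [split=> //=; lra|split=> /=; lra..].
  - by exists (((u1 + u2) / 2, u2), ((v1 + v2) / 2, v2)); split;
      [split=> //=; lra|split=> /=; lra..].
have b0 : bad ((x1, x2), (y1, y2)) by split.
have {}step : forall r : {r | bad r},
    {r' : {r | bad r} | half (sval r).1 (sval r').1 /\ half (sval r).2 (sval r').2}.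
  move=> [r br]; have [r' [br' h1 h2]] := cid (step r br).
  by exists (exist _ r' br').
pose s n := sval (iter n (fun r => sval (step r)) (exist _ _ b0)).
have sbad n : bad (s n) by exact: svalP.
have shalf n : half (s n).1 (s n.+1).1 /\ half (s n).2 (s n.+1).2.
  exact: (svalP (step (iter n (fun r => sval (step r)) (exist _ _ b0)))).
have nest (q : nat -> R * R) : (forall n, half (q n) (q n.+1)) -> (forall n, (q n).1 <= (q n).2) ->
    [/\ forall n, (q 0%N).1 <= (q n).1, forall n, (q n).2 <= (q 0%N).2,
        forall n, (q n).2 - (q n).1 = ((q 0%N).2 - (q 0%N).1) / 2 ^+ n &
        exists x, forall n, (q n).1 <= x <= (q n).2].
  move=> hq oq.
  have mono1 m n : (m <= n)%N -> (q m).1 <= (q n).1.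
    move=> /subnK <-; elim: (n - m)%N => [//|k IH].
    by rewrite addSn; apply: le_trans IH _; case: (hq (k + m)%N).
  have mono2 m n : (m <= n)%N -> (q n).2 <= (q m).2.
    move=> /subnK <-; elim: (n - m)%N => [//|k IH].
    by rewrite addSn; apply: le_trans IH; case: (hq (k + m)%N).
  split; [by move=> n; exact: mono1|by move=> n; exact: mono2| |].
    elim=> [|n IH]; first by rewrite expr0 divr1.
    by have [_ _ ->] := hq n; rewrite IH exprSr invfM mulrA.
  have ub n : ubound (range (fun n => (q n).1)) (q n).2.
    move=> _ [m _ <-].
    apply: le_trans (mono1 _ _ (leq_maxl m n)) _.
    by apply: le_trans (oq _) (mono2 _ _ (leq_maxr m n)).
  exists (sup (range (fun n => (q n).1))) => n; apply/andP; split.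
    apply: sup_upper_bound; last by exists n.
    by split; [exists (q 0%N).1, 0%N|exists (q 0%N).2; exact: ub].
  by apply: ge_sup; [exists (q 0%N).1, 0%N|exact: ub].
(* The nested bad rectangles shrink to a point, around which the property holds. *)
have [|a1 a2 a3 [x xP]] := nest (fun n => (s n).1) (fun n => proj1 (shalf n)).
  by move=> n; case: (sbad n).
have [|e1 e2 e3 [y yP]] := nest (fun n => (s n).2) (fun n => proj2 (shalf n)).
  by move=> n; case: (sbad n).
have [d d0 Hd] := H2 (x +i* y) (xP 0%N) (yP 0%N).
have [n1 hn1] := @exp2_gt (x2 - x1) d d0.
have [n2 hn2] := @exp2_gt (y2 - y1) d d0.
have small (W : R) (m n : nat) : 0 <= W -> (m <= n)%N -> W / 2 ^+ n <= W / 2 ^+ m.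
  move=> W0 mn; rewrite ler_wpM2l // lef_pV2 ?posrE ?exprn_gt0 //.
  by rewrite ler_weXn2l // ler1n.
have [_ _ nPn] := sbad (maxn n1 n2).
apply: nPn; apply: Hd.
- exact: a1.
- exact: a2.
- exact: e1.
- exact: e2.
- exact: xP.
- exact: yP.
- rewrite a3 /=; apply: le_lt_trans hn1; apply: small (leq_maxl _ _); lra.
- rewrite e3 /=; apply: le_lt_trans hn2; apply: small (leq_maxr _ _); lra.
Qed.

Lemma eps_le0 (a C : R) : 0 <= C -> (forall e, 0 < e -> a <= e * C) -> a <= 0.
Proof.
move=> C0 H; rewrite leNgt; apply/negP => a0.
have := H (a / (2 * (C + 1))) ltac:(by rewrite divr_gt0 // mulr_gt0 // ltr_wpDl).
apply/negP; rewrite -ltNge -mulrA -[X in _ < X]mulr1 ltr_pM2l // mulrC ltr_pdivrMr; lra.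
Qed.

Lemma box_cabs (x1 x2 y1 y2 : R) z w : x1 <= Re z <= x2 -> y1 <= Im z <= y2 ->
  x1 <= Re w <= x2 -> y1 <= Im w <= y2 -> cabs (w - z) <= (x2 - x1) + (y2 - y1).
Proof.
move=> /andP[? ?] /andP[? ?] /andP[? ?] /andP[? ?].
apply: le_trans (cabs_le _) _; rewrite ReB ImB.
by apply: lerD; rewrite ler_norml; lra.
Qed.

(** Goursat's theorem: the integral over a small rectangle around [z] is small compared
    with the square of its size, because affine functions integrate to 0. *)
Lemma goursat_closed f (x1 x2 y1 y2 : R) : x1 <= x2 -> y1 <= y2 -> continuous f ->
  (forall z, x1 <= Re z <= x2 -> y1 <= Im z <= y2 -> derivable f z 1) ->
  oint f x1 x2 y1 y2 = 0.
Proof.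
move=> x12 y12 cf df.
apply/eqP; rewrite -cabs_eq0 eq_le cabs_ge0 andbT.
apply: (@eps_le0 _ (((x2 - x1) + (y2 - y1)) ^+ 2)); first exact: sqr_ge0.
move=> e e0.
pose P u1 u2 v1 v2 := cabs (oint f u1 u2 v1 v2) <= e * ((u2 - u1) + (v2 - v1)) ^+ 2.
apply: (@bisection P x1 x2 y1 y2 x12 y12).
  move=> u1 u2 v1 v2 u12 v12; rewrite /P.
  set us := (u1 + u2) / 2; set vs := (v1 + v2) / 2 => h1 h2 h3 h4.
  have [l1 l2] := midpoint_itv u12; have [l3 l4] := midpoint_itv v12.
  rewrite -/us in l1 l2; rewrite -/vs in l3 l4.
  rewrite (oint_splitx v1 v2 cf l1 l2).
  rewrite (oint_splity u1 us cf l3 l4) (oint_splity us u2 cf l3 l4).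
  apply: le_trans (cabsD _ _) _.
  have k1 := cabsD (oint f u1 us v1 vs) (oint f u1 us vs v2).
  have k2 := cabsD (oint f us u2 v1 vs) (oint f us u2 vs v2).
  apply: le_trans (lerD k1 k2) _.
  apply: le_trans (lerD (lerD h1 h3) (lerD h2 h4)) _.
  by rewrite le_eqVlt; apply/orP; left; apply/eqP; rewrite /us /vs; field.
move=> z zx zy; have /derivableP [l hl] := df z zx zy.
have e4 : 0 < e / 4 by lra.
have [d d0 Hd] := hl _ e4.
exists (d / 2); first lra.
move=> u1 u2 v1 v2 _ _ _ _ zu zv hu hv; rewrite /P.
have u12 : u1 <= u2 by case/andP: zu; exact: le_trans.
have v12 : v1 <= v2 by case/andP: zv; exact: le_trans.
set L := (u2 - u1) + (v2 - v1).
pose B : plane R -> plane R := fun w => (- (f z - l * z)) + (- l) * w.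
have cA : continuous B.
  apply: plane_continuous => w.
  exact: (plane_contD (@plane_cont_cst R _ (- (f z - l * z)) w)
    (plane_contM (@plane_cont_cst R _ (- l) w) (@plane_cont_id R w))).
have -> : oint f u1 u2 v1 v2 = oint (fun w => f w + B w) u1 u2 v1 v2.
  rewrite (ointD (continuous_line _ _ _ _ cf) (continuous_line _ _ _ _ cA)).
  by rewrite /B oint_affine // addr0.
have -> : e * L ^+ 2 = 4 * (e / 4 * L) * L by field.
apply: oint_bound => //.
  by apply: continuous_line; apply: plane_continuous => w; exact: (plane_contD (cf w) (cA w)).
move=> w [wu wv _].
have wz : cabs (w - z) <= L by exact: box_cabs zu zv wu wv.
have wd : cabs (w - z) < d by rewrite /L in wz; lra.
apply: le_trans (_ : e / 4 * cabs (w - z) <= _); last by rewrite ler_pM2l.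
have -> : f w + B w = f w - f z - l * (w - z) by rewrite /B; ring.
exact: Hd.
Qed.

(** Holomorphy in the interior and continuity up to the boundary suffice: the function is
    approximated uniformly by its precomposition with contractions towards the centre. *)
Lemma goursat_open f (x1 x2 y1 y2 : R) : x1 <= x2 -> y1 <= y2 -> continuous f ->
  (forall z, x1 < Re z < x2 -> y1 < Im z < y2 -> derivable f z 1) ->
  oint f x1 x2 y1 y2 = 0.
Proof.
rewrite le_eqVlt => /orP [/eqP <- _ cf _|x12].
  have := oint_splitx y1 y2 cf (lexx x1) (lexx x1).
  by move=> /esym/eqP; rewrite -subr_eq0 addrK => /eqP.
rewrite le_eqVlt => /orP [/eqP <- cf _|y12].
  have := oint_splity x1 x2 cf (lexx y1) (lexx y1).
  by move=> /esym/eqP; rewrite -subr_eq0 addrK => /eqP.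
move=> cf df.
apply/eqP; rewrite -cabs_eq0 eq_le cabs_ge0 andbT.
set L := (x2 - x1) + (y2 - y1).
have L0 : 0 < L by rewrite /L; lra.
apply: (@eps_le0 _ (4 * L)); first lra.
move=> e e0.
(* [g t] is [f] precomposed with the contraction of ratio [1 - t] towards the centre. *)
pose c : plane R := ((x1 + x2) / 2) +i* ((y1 + y2) / 2).
pose g (t : R) : plane R -> plane R := fun z => f (z - (t +i* 0) * (z - c)).
pose P u1 u2 v1 v2 := exists2 t0, 0 < t0 & forall t, 0 < t -> t < t0 ->
  forall z, u1 <= Re z <= u2 -> v1 <= Im z <= v2 -> cabs (f z - g t z) <= e.
have [t0 t00 Ht] : P x1 x2 y1 y2.
  apply: bisection; [lra|lra| |].
    move=> u1 u2 v1 v2 _ _ [a a0 Ha] [b b0 Hb] [k k0 Hk] [m m0 Hm].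
    exists (Num.min (Num.min a b) (Num.min k m)).
      by rewrite !lt_min a0 b0 k0 m0.
    move=> t tt; rewrite !lt_min => /andP [/andP [ta tb] /andP [tk tm]] z.
    move=> /andP [z1 z2] /andP [z3 z4].
    case: (lerP (Re z) ((u1 + u2) / 2)) => zx; case: (lerP (Im z) ((v1 + v2) / 2)) => zy.
    - by apply: Ha => //; apply/andP; split=> //; exact: ltW.
    - by apply: Hk => //; apply/andP; split=> //; exact: ltW.
    - by apply: Hb => //; apply/andP; split=> //; exact: ltW.
    - by apply: Hm => //; apply/andP; split=> //; exact: ltW.
  move=> z zx zy.
  have e20 : 0 < e / 2 by lra.
  have [d d0 Hd] := (iffLR (continuousP z f) (cf z)) _ e20.
  exists (d / 4); first lra.
  move=> u1 u2 v1 v2 ux1 ux2 vy1 vy2 zu zv hu hv.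
  exists (d / (2 * L)); first by rewrite divr_gt0 // mulr_gt0.
  move=> t tt; rewrite ltr_pdivlMr ?mulr_gt0 // => htd w wu wv.
  have wz : cabs (w - z) <= (u2 - u1) + (v2 - v1) by exact: box_cabs zu zv wu wv.
  have wc : cabs (w - c) <= L.
    apply: box_cabs => /=; first lra; first lra.
      by move: wu => /andP [h1 h2]; rewrite (le_trans ux1 h1) (le_trans h2 ux2).
    by move: wv => /andP [h1 h2]; rewrite (le_trans vy1 h1) (le_trans h2 vy2).
  have tc : cabs ((t +i* 0) * (w - c)) <= t * L.
    by rewrite cabsM cabs_real gtr0_norm // ler_pM2l.
  have h1 : cabs (f w - f z) < e / 2 by apply: Hd; lra.
  have h2 : cabs (g t w - f z) < e / 2.
    apply: Hd; rewrite addrAC.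
    apply: le_lt_trans (cabsD _ _) _; rewrite cabsN; lra.
  apply: le_trans (cabs_tri (f z) _ _) _; rewrite (cabsB (f z)); lra.
pose t := Num.min (t0 / 2) (1 / 2).
have t1 : 0 < t by rewrite lt_min; lra.
have t2 : t < t0 by rewrite gt_min; apply/orP; left; lra.
have t3 : t < 1 by rewrite gt_min; apply/orP; right; lra.
have dg z : derivable (fun z : plane R => z - (t +i* 0) * (z - c)) z 1.
  apply: plane_derB; first exact: plane_der_id.
  apply: plane_derM; first exact: plane_der_cst.
  by apply: plane_derB; [exact: plane_der_id|exact: plane_der_cst].
have cg : continuous (g t).
  move=> z; apply: (continuous_comp (f := fun z : plane R => z - (t +i* 0) * (z - c)));
    last exact: cf.
  exact: derivable_cont.
have og : oint (g t) x1 x2 y1 y2 = 0.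
  apply: goursat_closed => //; [exact: ltW|exact: ltW|] => z zx zy.
  apply: (derivable_comp (f := f)) => //; apply: df.
    rewrite ReB ReM /= mul0r subr0 ReB /=; case/andP: zx => zx1 zx2; apply/andP; split; nra.
  rewrite ImB ImM /= mul0r addr0 ImB /=; case/andP: zy => zy1 zy2; apply/andP; split; nra.
have cg' : continuous (fun z => -1 * g t z).
  by apply: plane_continuous => z; exact: (plane_contM (@plane_cont_cst R _ (-1) z) (cg z)).
have -> : oint f x1 x2 y1 y2 = oint (fun z => f z + -1 * g t z) x1 x2 y1 y2.
  rewrite (ointD (continuous_line _ _ _ _ cf) (continuous_line _ _ _ _ cg')).
  by rewrite (ointZ _ (continuous_line _ _ _ _ cg)) og mulr0 addr0.
have -> : e * (4 * L) = 4 * e * L by ring.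
apply: oint_bound; [|exact: ltW|exact: ltW|].
  by apply: continuous_line; apply: plane_continuous => z; exact: (plane_contD (cf z) (cg' z)).
by move=> z [zx zy _]; rewrite mulN1r; exact: Ht.
Qed.

(** Cauchy's theorem with finitely many exceptional vertical lines. *)
Lemma goursat_lines (s : seq R) f (x1 x2 y1 y2 : R) : x1 <= x2 -> y1 <= y2 -> continuous f ->
  (forall z, x1 < Re z < x2 -> y1 < Im z < y2 -> Re z \notin s -> derivable f z 1) ->
  oint f x1 x2 y1 y2 = 0.
Proof.
elim: s x1 x2 => [|a s IH] x1 x2 x12 y12 cf df.
  by apply: goursat_open => // z zx zy; exact: df.
have [/andP [a1 a2]|na] := boolP (x1 < a < x2).
  rewrite (oint_splitx y1 y2 cf (ltW a1) (ltW a2)) IH ?IH ?addr0 //; try exact: ltW.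
    move=> z /andP [z1 z2] zy zs; apply: df => //; first by rewrite (lt_trans a1 z1).
    by rewrite inE negb_or zs andbT gt_eqF.
  move=> z /andP [z1 z2] zy zs; apply: df => //; first by rewrite z1 (lt_trans z2 a2).
  by rewrite inE negb_or zs andbT lt_eqF.
apply: IH => // z zx zy zs; apply: df => //; rewrite inE negb_or zs andbT.
by apply: contra na => /eqP <-.
Qed.

End Goursat.

(** * Cauchy's formula and removable lines *)

Section CauchyFormula.
Context {R : realType}.
Implicit Types (f g h : plane R -> plane R) (z w : plane R).

(** The open rectangle. *)
Definition inside (x1 x2 y1 y2 : R) w := (x1 < Re w < x2) && (y1 < Im w < y2).

Lemma line_contM f g (x1 x2 y1 y2 : R) : line_continuous f x1 x2 y1 y2 ->
  line_continuous g x1 x2 y1 y2 -> line_continuous (fun z => f z * g z) x1 x2 y1 y2.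
Proof.
by move=> [a1 a2 a3 a4] [b1 b2 b3 b4]; split; apply: plane_continuous => t;
 [exact: (plane_contM (a1 t) (b1 t))|exact: (plane_contM (a2 t) (b2 t))
 |exact: (plane_contM (a3 t) (b3 t))|exact: (plane_contM (a4 t) (b4 t))].
Qed.

Lemma line_cont_kernel w (x1 x2 y1 y2 : R) : inside x1 x2 y1 y2 w ->
  line_continuous (fun z => (z - w)^-1) x1 x2 y1 y2.
Proof.
move=> /andP [/andP [h1 h2] /andP [h3 h4]].
have nx (a b : R) : a != Re w -> (a +i* b) - w != 0.
  move=> ha; apply: contra ha => /eqP H.
  by rewrite -subr_eq0 -[X in X - _]/(Re (a +i* b : plane R)) -ReB H.
have ny (a b : R) : b != Im w -> (a +i* b) - w != 0.
  move=> ha; apply: contra ha => /eqP H.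
  by rewrite -subr_eq0 -[X in X - _]/(Im (a +i* b : plane R)) -ImB H.
split; apply: plane_continuous => t; apply: plane_contV.
- by apply: ny; rewrite lt_eqF.
- exact: (plane_contB (@hline_continuous R y1 t) (@plane_cont_cst R _ w t)).
- by apply: ny; rewrite gt_eqF.
- exact: (plane_contB (@hline_continuous R y2 t) (@plane_cont_cst R _ w t)).
- by apply: nx; rewrite lt_eqF.
- exact: (plane_contB (@vline_continuous R x1 t) (@plane_cont_cst R _ w t)).
- by apply: nx; rewrite gt_eqF.
- exact: (plane_contB (@vline_continuous R x2 t) (@plane_cont_cst R _ w t)).
Qed.

(** The Cauchy integral of [f], without the factor [1 / (2 i pi)]. *)
Definition cauchy_int f (x1 x2 y1 y2 : R) w := oint (fun z => f z * (z - w)^-1) x1 x2 y1 y2.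

(** The points of the rectangle at distance at least [r] from its sides. *)
Definition deep (x1 x2 y1 y2 r : R) w :=
  (x1 + r <= Re w <= x2 - r) && (y1 + r <= Im w <= y2 - r).

Lemma deep_inside (x1 x2 y1 y2 r : R) w : 0 < r -> deep x1 x2 y1 y2 r w -> inside x1 x2 y1 y2 w.
Proof. by move=> r0 /andP [/andP [? ?] /andP [? ?]]; apply/andP; split; lra. Qed.

Lemma inside_deep (x1 x2 y1 y2 : R) w : inside x1 x2 y1 y2 w ->
  exists2 r, 0 < r & deep x1 x2 y1 y2 r w.
Proof.
move=> /andP [/andP [h1 h2] /andP [h3 h4]].
pose r := Num.min (Num.min (Re w - x1) (x2 - Re w)) (Num.min (Im w - y1) (y2 - Im w)).
exists r; first by rewrite !lt_min; lra.
have : r <= r by []. 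
rewrite {2}/r !le_min => /andP [/andP [? ?] /andP [? ?]].
by apply/andP; split; lra.
Qed.

Lemma deep_near (x1 x2 y1 y2 r s : R) w w' : deep x1 x2 y1 y2 r w ->
  cabs (w' - w) <= s -> deep x1 x2 y1 y2 (r - s) w'.
Proof.
move=> /andP [/andP [? ?] /andP [? ?]] h.
have := le_trans (Re_le_cabs _) h; have := le_trans (Im_le_cabs _) h.
rewrite ReB ImB !ler_norml => ? ?; apply/andP; split; lra.
Qed.

Lemma deep_dist (x1 x2 y1 y2 r : R) w z : deep x1 x2 y1 y2 r w ->
  boundary x1 x2 y1 y2 z -> r <= cabs (z - w).
Proof.
move=> /andP [/andP [? ?] /andP [? ?]] [_ _ [e|e|e|e]].
- apply: le_trans (Re_le_cabs _); rewrite ReB e ler_normr; apply/orP; right; lra.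
- apply: le_trans (Re_le_cabs _); rewrite ReB e ler_normr; apply/orP; left; lra.
- apply: le_trans (Im_le_cabs _); rewrite ImB e ler_normr; apply/orP; right; lra.
- apply: le_trans (Im_le_cabs _); rewrite ImB e ler_normr; apply/orP; left; lra.
Qed.

Lemma inside_open (x1 x2 y1 y2 : R) w : inside x1 x2 y1 y2 w ->
  \forall z \near w, inside x1 x2 y1 y2 z.
Proof.
move=> /inside_deep [r r0 dw]; apply/plane_nbhsP; exists (r / 2); first lra.
move=> z /ltW hz; apply: deep_inside (deep_near dw hz); lra.
Qed.

(** A continuous function is bounded on a closed rectangle. *)
Lemma box_bounded f (x1 x2 y1 y2 : R) : x1 <= x2 -> y1 <= y2 -> continuous f ->
  exists2 M, 0 < M & forall z, x1 <= Re z <= x2 -> y1 <= Im z <= y2 -> cabs (f z) <= M.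
Proof.
move=> x12 y12 cf.
pose P u1 u2 v1 v2 :=
  exists2 M, 0 < M & forall z, u1 <= Re z <= u2 -> v1 <= Im z <= v2 -> cabs (f z) <= M.
apply: (@bisection R P) => //.
  move=> u1 u2 v1 v2 _ _ [a a0 Ha] [b b0 Hb] [k k0 Hk] [m m0 Hm].
  exists (a + b + k + m); first lra.
  move=> z /andP [z1 z2] /andP [z3 z4].
  case: (lerP (Re z) ((u1 + u2) / 2)) => zx; case: (lerP (Im z) ((v1 + v2) / 2)) => zy.
  - have := Ha z; rewrite z1 zx z3 zy => /(_ isT isT); lra.
  - have := Hk z; rewrite z1 zx z4 (ltW zy) => /(_ isT isT); lra.
  - have := Hb z; rewrite z2 (ltW zx) z3 zy => /(_ isT isT); lra.
  - have := Hm z; rewrite z2 (ltW zx) z4 (ltW zy) => /(_ isT isT); lra.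
move=> z zx zy.
have [d d0 Hd] := (iffLR (continuousP z f) (cf z)) 1 ltr01.
exists (d / 2); first lra.
move=> u1 u2 v1 v2 _ _ _ _ zu zv hu hv; exists (cabs (f z) + 1).
  by have := cabs_ge0 (f z); lra.
move=> w wu wv.
have wz : cabs (w - z) <= (u2 - u1) + (v2 - v1) by exact: box_cabs zu zv wu wv.
have := Hd w ltac:(lra); have := cabsDB (f w) (f z); lra.
Qed.

Lemma boundary_closed (x1 x2 y1 y2 : R) z : boundary x1 x2 y1 y2 z ->
  x1 <= Re z <= x2 /\ y1 <= Im z <= y2.
Proof. by case. Qed.

Lemma line_cont_pole2 f w w' (x1 x2 y1 y2 : R) : continuous f ->
  inside x1 x2 y1 y2 w -> inside x1 x2 y1 y2 w' ->
  line_continuous (fun z => f z * (z - w)^-1 * (z - w')^-1) x1 x2 y1 y2.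
Proof.
move=> cf iw iw'; apply: line_contM (line_cont_kernel iw').
by apply: line_contM (line_cont_kernel iw); exact: continuous_line.
Qed.

(** The Cauchy integral is holomorphic; its derivative is bounded away from the sides. *)
Lemma cauchy_int_deriv f (x1 x2 y1 y2 r M : R) w : x1 <= x2 -> y1 <= y2 ->
  0 < r -> 0 <= M -> continuous f ->
  (forall z, boundary x1 x2 y1 y2 z -> cabs (f z) <= M) -> deep x1 x2 y1 y2 r w ->
  exists2 l, has_deriv (cauchy_int f x1 x2 y1 y2) w l &
    cabs l <= 4 * (M / r ^+ 2) * ((x2 - x1) + (y2 - y1)).
Proof.
move=> x12 y12 r0 M0 cf fM dw.
have iw := deep_inside r0 dw.
set L := (x2 - x1) + (y2 - y1).
have L0 : 0 <= L by rewrite /L; lra.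
have lw := line_cont_pole2 cf iw iw.
exists (oint (fun z => f z * (z - w)^-1 * (z - w)^-1) x1 x2 y1 y2).
  move=> e e0.
  pose C := 4 * (M / (r / 2) ^+ 3) * L.
  have C0 : 0 <= C by rewrite /C !mulr_ge0 // invr_ge0 exprn_ge0 //; lra.
  exists (Num.min (r / 2) (e / (C + 1))).
    by rewrite lt_min divr_gt0 ?divr_gt0 //; lra.
  move=> w'; rewrite lt_min => /andP [h1].
  rewrite ltr_pdivlMr => [h2|]; last lra.
  have dw' : deep x1 x2 y1 y2 (r / 2) w'.
    have := deep_near dw (ltW h1); have -> // : r - r / 2 = r / 2 by lra.
  have iw' : inside x1 x2 y1 y2 w' by apply: deep_inside dw'; lra.
  have lw' := line_cont_pole2 cf iw iw'.
  have lww' : line_continuous (fun z => f z * (z - w)^-1 * (z - w)^-1 * (z - w')^-1) x1 x2 y1 y2.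
    by apply: line_contM (line_cont_kernel iw').
  have lf := continuous_line x1 x2 y1 y2 cf.
  have l1 := line_contM lf (line_cont_kernel iw).
  have l1' := line_contM lf (line_cont_kernel iw').
  have nz (v z : plane R) (t : R) : 0 < t -> t <= cabs (z - v) -> z - v != 0.
    by move=> t0 tz; rewrite -cabs_gt0 (lt_le_trans t0).
  have -> : cauchy_int f x1 x2 y1 y2 w' - cauchy_int f x1 x2 y1 y2 w
      - oint (fun z => f z * (z - w)^-1 * (z - w)^-1) x1 x2 y1 y2 * (w' - w)
    = (w' - w) ^+ 2 * oint (fun z => f z * (z - w)^-1 * (z - w)^-1 * (z - w')^-1) x1 x2 y1 y2.
    rewrite -(ointZ _ lww').
    have -> : oint (fun z => (w' - w) ^+ 2 * (f z / (z - w) / (z - w) / (z - w'))) x1 x2 y1 y2 =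
      oint (fun z => (f z * (z - w')^-1 + -1 * (f z * (z - w)^-1)) +
        (- (w' - w)) * (f z * (z - w)^-1 * (z - w)^-1)) x1 x2 y1 y2.
      apply: oint_eq => // z bz.
      have n1 : z - w != 0 by apply: nz r0 (deep_dist dw bz).
      have n2 : z - w' != 0 by apply: nz (deep_dist dw' bz); lra.
      by field; rewrite n1 n2.
    have lk (k : plane R) g : line_continuous g x1 x2 y1 y2 ->
        line_continuous (fun z => k * g z) x1 x2 y1 y2.
      move=> lg; apply: line_contM lg; apply: continuous_line.
      by apply: plane_continuous => z; exact: plane_cont_cst.
    have lD g h : line_continuous g x1 x2 y1 y2 -> line_continuous h x1 x2 y1 y2 ->
        line_continuous (fun z => g z + h z) x1 x2 y1 y2.
      by move=> [a1 a2 a3 a4] [b1 b2 b3 b4]; split; apply: plane_continuous => t;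
        [exact: (plane_contD (a1 t) (b1 t))|exact: (plane_contD (a2 t) (b2 t))
        |exact: (plane_contD (a3 t) (b3 t))|exact: (plane_contD (a4 t) (b4 t))].
    rewrite (ointD (lD _ _ l1' (lk (-1) _ l1)) (lk (- (w' - w)) _ lw)).
    rewrite (ointD l1' (lk (-1) _ l1)) (ointZ (-1) l1) (ointZ (- (w' - w)) lw).
    rewrite /cauchy_int; do 3 move: (oint _ _ _ _ _) => ?; ring.
  rewrite cabsM cabsX.
  have hb : cabs (oint (fun z => f z * (z - w)^-1 * (z - w)^-1 * (z - w')^-1) x1 x2 y1 y2) <= C.
    apply: oint_bound => // z bz.
    rewrite !cabsM !cabsV.
    have -> : M / (r / 2) ^+ 3 = M * (r / 2)^-1 * (r / 2)^-1 * (r / 2)^-1 by field; lra.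
    have h3 : r / 2 <= cabs (z - w) by have := deep_dist dw bz; lra.
    have h4 := deep_dist dw' bz.
    have i3 : (cabs (z - w))^-1 <= (r / 2)^-1 by rewrite lef_pV2 // posrE; lra.
    have i4 : (cabs (z - w'))^-1 <= (r / 2)^-1 by rewrite lef_pV2 // posrE; lra.
    have p3 : 0 <= (cabs (z - w))^-1 by rewrite invr_ge0 cabs_ge0.
    have p4 : 0 <= (cabs (z - w'))^-1 by rewrite invr_ge0 cabs_ge0.
    have pf := cabs_ge0 (f z).
    by rewrite !ler_pM ?mulr_ge0 //; exact: fM.
  have hc := cabs_ge0 (w' - w).
  apply: le_trans (ler_wpM2l (exprn_ge0 2 hc) hb) _.
  have -> : cabs (w' - w) ^+ 2 * C = cabs (w' - w) * C * cabs (w' - w) by ring.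
  by apply: ler_wpM2r => //; lra.
apply: oint_bound => // z bz.
rewrite !cabsM !cabsV expr2 invfM mulrA.
have h3 := deep_dist dw bz.
have i3 : (cabs (z - w))^-1 <= r^-1 by rewrite lef_pV2 // posrE; lra.
have p3 : 0 <= (cabs (z - w))^-1 by rewrite invr_ge0 cabs_ge0.
by rewrite !ler_pM ?mulr_ge0 ?cabs_ge0 //; exact: fM.
Qed.

Lemma cauchy_int_derivable f (x1 x2 y1 y2 : R) w : continuous f ->
  inside x1 x2 y1 y2 w -> derivable (cauchy_int f x1 x2 y1 y2) w 1.
Proof.
move=> cf iw.
have [/ltW x12 /ltW y12] : x1 < x2 /\ y1 < y2.
  by case/andP: iw => /andP [? ?] /andP [? ?]; split; lra.
have [M M0 HM] := box_bounded x12 y12 cf.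
have [r r0 dw] := inside_deep iw.
have [|l hl _] := cauchy_int_deriv x12 y12 r0 (ltW M0) cf _ dw.
  by move=> z /boundary_closed [? ?]; exact: HM.
exact: has_deriv_derivable hl.
Qed.

(** Along each side, [dz / (z - w)] has positive imaginary part: the argument of
    [z - w] increases. *)
Lemma cauchy_int1_neq0 (x1 x2 y1 y2 : R) w : inside x1 x2 y1 y2 w ->
  cauchy_int (fun=> 1) x1 x2 y1 y2 w != 0.
Proof.
move=> iw; have [k1 k2 k3 k4] := line_cont_kernel iw.
have /andP [/andP [h1 h2] /andP [h3 h4]] := iw.
have x12 : x1 < x2 by lra.
have y12 : y1 < y2 by lra.
suff H : 0 < Im (cauchy_int (fun=> 1) x1 x2 y1 y2 w).
  by apply/negP => /eqP E; move: H; rewrite E ltxx.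
have -> : cauchy_int (fun=> 1) x1 x2 y1 y2 w = oint (fun z => (z - w)^-1) x1 x2 y1 y2.
  by apply: oint_eq; [exact: ltW|exact: ltW|move=> z _; rewrite mul1r].
have ImV (z : plane R) : Im z^-1 = - Im z / (Re z ^+ 2 + Im z ^+ 2).
  by case: z => x y /=; rewrite mulNr.
have ReV (z : plane R) : Re z^-1 = Re z / (Re z ^+ 2 + Im z ^+ 2) by case: z.
rewrite /oint ImD ImB ImM /= mul0r mul1r add0r.
have p1 : 0 < rint (fun x => Im ((x +i* y1 - w)^-1)) x1 x2.
  apply: rint_gt0 => //; first exact: continuous_Im k1.
  move=> x _; rewrite ImV ImB ReB /= divr_gt0 //; first lra.
  by rewrite ltr_wpDl ?sqr_ge0 // exprn_even_gt0 //= subr_eq0 lt_eqF.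
have p2 : 0 < rint (fun x => - 1 * Im ((x +i* y2 - w)^-1)) x1 x2.
  apply: rint_gt0 => //.
    by move=> x; apply: cvgM; [exact: cvg_cst|exact: (continuous_Im k2)].
  move=> x _; rewrite ImV ImB ReB /= mulN1r mulNr opprK divr_gt0 //; first lra.
  by rewrite ltr_wpDl ?sqr_ge0 // exprn_even_gt0 //= subr_eq0 gt_eqF.
have p3 : 0 < rint (fun y => Re ((x2 +i* y - w)^-1)) y1 y2.
  apply: rint_gt0 => //; first exact: continuous_Re k4.
  move=> x _; rewrite ReV ImB ReB /= divr_gt0 //; first lra.
  by rewrite ltr_pwDl ?sqr_ge0 // exprn_even_gt0 //= subr_eq0 gt_eqF.
have p4 : 0 < rint (fun y => - 1 * Re ((x1 +i* y - w)^-1)) y1 y2.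
  apply: rint_gt0 => //.
    by move=> x; apply: cvgM; [exact: cvg_cst|exact: (continuous_Re k3)].
  move=> x _; rewrite ReV ImB ReB /= mulN1r -mulNr divr_gt0 //; first lra.
  by rewrite ltr_pwDl ?sqr_ge0 // exprn_even_gt0 //= subr_eq0 lt_eqF.
rewrite rintZ in p2; last exact: continuous_Im k2.
rewrite rintZ in p4; last exact: continuous_Re k3.
lra.
Qed.

(** The difference quotient at [w], completed by the derivative. *)
Lemma quotient_continuous f w l : continuous f -> has_deriv f w l ->
  continuous (fun z => if z == w then l else (f z - f w) * (z - w)^-1).
Proof.
move=> cf hl; apply: plane_continuous => z.
have [->|zw] := eqVneq z w.
  apply/continuousP => e e0; rewrite eqxx.
  have [d d0 Hd] := hl (e / 2) ltac:(lra).
  exists d => // v hv; case: eqVneq => [_|vw]; first by rewrite subrr cabs0.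
  have vw0 : v - w != 0 by rewrite subr_eq0.
  have -> : (f v - f w) * (v - w)^-1 - l = (f v - f w - l * (v - w)) * (v - w)^-1.
    by rewrite [in RHS]mulrBl mulfK.
  rewrite cabsM cabsV ltr_pdivrMr ?cabs_gt0 //.
  apply: le_lt_trans (Hd v hv) _.
  by rewrite ltr_pM2r ?cabs_gt0 //; lra.
apply: (@derivable_continuous_local _ (fun z => (f z - f w) * (z - w)^-1)).
  apply/plane_nbhsP; exists (cabs (z - w)); first by rewrite cabs_gt0 subr_eq0.
  by move=> v; case: eqVneq => // ->; rewrite cabsB ltxx.
apply: plane_contM; first exact: (plane_contB (cf z) (@plane_cont_cst R _ (f w) z)).
apply: plane_contV; first by rewrite subr_eq0.
exact: (plane_contB (@plane_cont_id R z) (@plane_cont_cst R _ w z)).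
Qed.

Lemma quotient_derivable f w l z : z != w -> derivable f z 1 ->
  derivable (fun z => if z == w then l else (f z - f w) * (z - w)^-1) z 1.
Proof.
move=> zw df.
apply: (@derivable_near_eq _ (fun z => (f z - f w) * (z - w)^-1)).
  apply/plane_nbhsP; exists (cabs (z - w)); first by rewrite cabs_gt0 subr_eq0.
  by move=> v; case: eqVneq => // ->; rewrite cabsB ltxx.
have nz : z - w != 0 by rewrite subr_eq0.
have dz : derivable (fun v : plane R => v - w) z 1.
  exact: (plane_derB (@plane_der_id R z) (@plane_der_cst R w z)).
have dV := @plane_derV R (fun v => v - w) z nz dz.
have dB := @plane_derB R f (fun=> f w) z df (@plane_der_cst R (f w) z).
exact: (@plane_derM R _ _ z dB dV).
Qed.

(** Cauchy's formula off the exceptional lines: the difference quotient at [w] is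
    continuous and holomorphic off those lines and the vertical line of [w]. *)
Lemma cauchy_formula (s : seq R) f (x1 x2 y1 y2 : R) w : continuous f ->
  (forall z, inside x1 x2 y1 y2 z -> Re z \notin s -> derivable f z 1) ->
  inside x1 x2 y1 y2 w -> Re w \notin s ->
  cauchy_int f x1 x2 y1 y2 w = f w * cauchy_int (fun=> 1) x1 x2 y1 y2 w.
Proof.
move=> cf df iw ws.
have /derivableP [l hl] := df w iw ws.
have [/ltW x12 /ltW y12] : x1 < x2 /\ y1 < y2.
  by case/andP: iw => /andP [? ?] /andP [? ?]; split; lra.
pose g z := if z == w then l else (f z - f w) * (z - w)^-1.
have cg : continuous g by exact: quotient_continuous.
have og : oint g x1 x2 y1 y2 = 0.
  apply: (@goursat_lines _ (Re w :: s)) => // z zx zy.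
  rewrite inE negb_or => /andP [zw zs].
  apply: quotient_derivable; last by apply: df => //; apply/andP.
  by apply: contra zw => /eqP ->.
have lk := line_cont_kernel iw.
have lck : line_continuous (fun z => f w * (z - w)^-1) x1 x2 y1 y2.
  apply: line_contM lk; apply: continuous_line.
  by apply: plane_continuous => z; exact: plane_cont_cst.
have -> : cauchy_int f x1 x2 y1 y2 w = oint (fun z => g z + f w * (z - w)^-1) x1 x2 y1 y2.
  have [r r0 dw] := inside_deep iw.
  apply: oint_eq => // z /(deep_dist dw) hz; rewrite /g.
  case: eqVneq => [zw|_]; last by rewrite -mulrDl subrK.
  by move: hz; rewrite zw subrr cabs0 leNgt r0.
rewrite (ointD (continuous_line _ _ _ _ cg) lck) og add0r (ointZ _ lk).
by congr (_ * _); apply: oint_eq => // z _; rewrite mul1r.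
Qed.

Lemma avoid_seq (s : seq R) (u d : R) : 0 < d -> exists t, u < t < u + d /\ t \notin s.
Proof.
elim: s d => [|a s IH] d d0; first by exists (u + d / 2); split => //; lra.
have [t [/andP [t1 t2] ts]] := IH d d0.
have [E|ta] := eqVneq t a; last by exists t; rewrite t1 t2 inE negb_or ta ts.
have [t' [/andP [t1' t2'] ts']] := IH (t - u) ltac:(lra).
exists t'; rewrite t1' inE negb_or ts' -E; split; first lra.
by rewrite andbT lt_eqF //; lra.
Qed.

(** Both sides of Cauchy's formula are continuous in [w], so it also holds on the
    exceptional lines. *)
Lemma cauchy_formula_lines (s : seq R) f (x1 x2 y1 y2 : R) w : continuous f ->
  (forall z, inside x1 x2 y1 y2 z -> Re z \notin s -> derivable f z 1) ->
  inside x1 x2 y1 y2 w ->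
  cauchy_int f x1 x2 y1 y2 w = f w * cauchy_int (fun=> 1) x1 x2 y1 y2 w.
Proof.
move=> cf df iw.
have c1 : continuous (fun _ : plane R => 1 : plane R).
  by apply: plane_continuous => z; exact: plane_cont_cst.
pose H z := cauchy_int f x1 x2 y1 y2 z - f z * cauchy_int (fun=> 1) x1 x2 y1 y2 z.
have cH : {for w, continuous H}.
  apply: plane_contB; first exact/derivable_cont/cauchy_int_derivable.
  by apply: plane_contM; [exact: cf|exact/derivable_cont/cauchy_int_derivable].
suff : H w = 0 by rewrite /H => /eqP; rewrite subr_eq0 => /eqP.
apply/eqP; apply: contrapT => /negP Hw; rewrite -cabs_gt0 in Hw.
have [d d0 Hd] := (iffLR (continuousP w H) cH) _ Hw.
have /plane_nbhsP [r r0 Hr] := inside_open iw.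
have [t [/andP [t1 t2] ts]] := @avoid_seq s (Re w) (Num.min d r) ltac:(by rewrite lt_min d0).
have tw : cabs ((t +i* Im w) - w) < Num.min d r.
  have -> : (t +i* Im w) - w = (t - Re w) +i* 0 by case: (w) => a b; apply: complex_ext => /=; lra.
  rewrite cabs_real gtr0_norm; lra.
move: tw; rewrite lt_min => /andP [/Hd h1 /Hr h2].
move: h1; rewrite /H (@cauchy_formula s f) // subrr sub0r cabsN.
by rewrite ltxx.
Qed.

(** Painleve's theorem: vertical lines are removable for continuous functions. *)
Lemma painleve (s : seq R) f (x1 x2 y1 y2 : R) w : continuous f ->
  (forall z, inside x1 x2 y1 y2 z -> Re z \notin s -> derivable f z 1) ->
  inside x1 x2 y1 y2 w -> derivable f w 1.
Proof.
move=> cf df iw.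
have c1 : continuous (fun _ : plane R => 1 : plane R).
  by apply: plane_continuous => z; exact: plane_cont_cst.
apply: (@derivable_near_eq _ (fun z => cauchy_int f x1 x2 y1 y2 z *
   (cauchy_int (fun=> 1) x1 x2 y1 y2 z)^-1)).
  have := inside_open iw; apply: filterS => z iz.
  by rewrite (cauchy_formula_lines cf df iz) mulfK // cauchy_int1_neq0.
apply: plane_derM; first exact: cauchy_int_derivable.
by apply: plane_derV; [exact: cauchy_int1_neq0|exact: cauchy_int_derivable].
Qed.

End CauchyFormula.

(** * Critical points of injective holomorphic functions *)

Section Injective.
Context {R : realType}.
Implicit Types (f g h : plane R -> plane R) (z w q : plane R).

Lemma has_deriv_unique f z l k : has_deriv f z l -> has_deriv f z k -> l = k.
Proof.
move=> hl hk; apply/eqP; rewrite -subr_eq0 -cabs_eq0 eq_le cabs_ge0 andbT.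
apply: (@eps_le0 _ _ 2); first by [].
move=> e e0.
have [d d0 Hd] := hl e e0; have [d' d'0 Hd'] := hk e e0.
pose t := Num.min d d' / 2.
have m0 : 0 < Num.min d d' by rewrite lt_min d0.
have t0 : 0 < t by rewrite /t; lra.
have [td td'] : t < d /\ t < d'.
  by apply/andP; rewrite -lt_min /t; lra.
pose w : plane R := z + (t +i* 0).
have wz : w - z = t +i* 0 by rewrite /w addrAC subrr add0r.
have wt : cabs (w - z) = t by rewrite wz cabs_real gtr0_norm.
have h1 := Hd w; have h2 := Hd' w; rewrite wt in h1 h2.
have {}h1 := h1 td; have {}h2 := h2 td'.
rewrite -(ler_pM2r t0) -{1}wt -cabsM.
have -> : (l - k) * (w - z) = (f w - f z - k * (w - z)) - (f w - f z - l * (w - z)) by ring.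
apply: le_trans (cabsD _ _) _; rewrite cabsN; lra.
Qed.

Lemma has_derivM f g z l k : has_deriv f z l -> has_deriv g z k ->
  has_deriv (fun w => f w * g w) z (l * g z + f z * k).
Proof.
move=> hf hg e e0.
have cg := derivable_cont (has_deriv_derivable hg).
set S := cabs (g z) + 1 + cabs l + cabs (f z).
have [g0 l0 f0] : [/\ 0 <= cabs (g z), 0 <= cabs l & 0 <= cabs (f z)] by split; exact: cabs_ge0.
have S0 : 0 < S by rewrite /S; lra.
pose a := Num.min 1 (e / S).
have a0 : 0 < a by rewrite lt_min ltr01 divr_gt0.
have a1 : a <= 1 by rewrite ge_min lexx.
have aS : a * S <= e by rewrite -ler_pdivlMr // ge_min lexx orbT.
have [d1 d10 H1] := hf a a0; have [d2 d20 H2] := hg a a0.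
have [d3 d30 H3] := (iffLR (continuousP z g) cg) _ a0.
exists (Num.min (Num.min d1 d2) d3); first by rewrite !lt_min d10 d20 d30.
move=> w; rewrite !lt_min => /andP [/andP [/H1 h1 /H2 h2] /H3 /ltW h3].
have -> : f w * g w - f z * g z - (l * g z + f z * k) * (w - z) =
  (f w - f z - l * (w - z)) * g w + l * (w - z) * (g w - g z) +
  f z * (g w - g z - k * (w - z)) by ring.
set D := cabs (w - z) in h1 h2 *.
have D0 : 0 <= D by exact: cabs_ge0.
have gw : cabs (g w) <= cabs (g z) + 1 by have := cabsDB (g w) (g z); lra.
have k1 := ler_pM (cabs_ge0 _) (cabs_ge0 _) h1 gw.
have k2 := ler_pM (mulr_ge0 l0 D0) (cabs_ge0 _) (lexx (cabs l * D)) h3.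
have k3 := ler_wpM2l f0 h2.
apply: le_trans (cabsD _ _) _.
apply: le_trans (lerD (cabsD _ _) (lexx _)) _.
rewrite !cabsM -/D.
apply: le_trans (lerD (lerD k1 k2) k3) _.
have -> : a * D * (cabs (g z) + 1) + cabs l * D * a + cabs (f z) * (a * D) = a * S * D.
  by rewrite /S; ring.
exact: ler_wpM2r.
Qed.

Lemma has_deriv_pow w z (n : nat) :
  has_deriv (fun v => (v - w) ^+ n.+1) z (n.+1%:R * (z - w) ^+ n).
Proof.
elim: n => [|n IH].
  rewrite expr0 mul1r => e e0; exists 1 => // v _.
  have -> : (v - w) ^+ 1 - (z - w) ^+ 1 - 1 * (v - z) = 0 by ring.
  by rewrite cabs0 mulr_ge0 ?cabs_ge0 // ltW.
have h1 : has_deriv (fun v => v - w) z 1.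
  move=> e e0; exists 1 => // v _.
  have -> : v - w - (z - w) - 1 * (v - z) = 0 by ring.
  by rewrite cabs0 mulr_ge0 ?cabs_ge0 // ltW.
have := has_derivM h1 IH.
have -> : (fun v => (v - w) * (v - w) ^+ n.+1) = (fun v => (v - w) ^+ n.+2).
  by apply/funext => v; rewrite -exprS.
have -> // : 1 * (z - w) ^+ n.+1 + (z - w) * (n.+1%:R * (z - w) ^+ n) = n.+2%:R * (z - w) ^+ n.+1.
by rewrite mul1r mulrCA -exprS -[in RHS]natr1 mulrDl mul1r addrC.
Qed.

(** The factor [h] is holomorphic at [q] too, as isolated points are removable. *)
Lemma divide_root f (x1 x2 y1 y2 : R) q : continuous f ->
  (forall z, inside x1 x2 y1 y2 z -> derivable f z 1) -> inside x1 x2 y1 y2 q ->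
  exists h, [/\ continuous h, forall z, inside x1 x2 y1 y2 z -> derivable h z 1 &
    forall z, f z - f q = (z - q) * h z].
Proof.
move=> cf df iq; have /derivableP [l hl] := df q iq.
exists (fun z => if z == q then l else (f z - f q) * (z - q)^-1).
have cq := quotient_continuous cf hl.
split; first exact: cq.
  move=> z iz; apply: (@painleve _ [:: Re q] _ x1 x2 y1 y2 _ cq _ iz) => v iv; rewrite inE => vq.
  have vq' : v != q by apply: contra vq => /eqP ->.
  exact: (@quotient_derivable R f q l v vq' (df v iv)).
move=> z; case: eqVneq => [->|zq]; first by rewrite !subrr mul0r.
by rewrite mulrC mulfVK // subr_eq0.
Qed.

(** The derivative of a holomorphic function is locally bounded; it is read off from
    [f J = I] with [J] and [I] the Cauchy integrals of [1] and of [f]. *)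
Lemma derivative_bounded f (x1 x2 y1 y2 : R) q : continuous f ->
  (forall z, inside x1 x2 y1 y2 z -> derivable f z 1) -> inside x1 x2 y1 y2 q ->
  exists C r, [/\ 0 < C, 0 < r & forall z, cabs (z - q) < r ->
     inside x1 x2 y1 y2 z /\ forall l, has_deriv f z l -> cabs l <= C].
Proof.
move=> cf df iq.
have [/ltW x12 /ltW y12] : x1 < x2 /\ y1 < y2.
  by case/andP: iq => /andP [? ?] /andP [? ?]; split; lra.
have c1 : continuous (fun _ : plane R => 1 : plane R).
  by apply: plane_continuous => z; exact: plane_cont_cst.
have [M M0 HM] := box_bounded x12 y12 cf.
have [r r0 dq] := inside_deep iq.
pose J := cauchy_int (fun=> 1 : plane R) x1 x2 y1 y2.
have Jq : 0 < cabs (J q) / 2 by rewrite divr_gt0 // cabs_gt0 cauchy_int1_neq0.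
have cJ : {for q, continuous J} by exact/derivable_cont/cauchy_int_derivable.
have [d d0 Hd] := (iffLR (continuousP q J) cJ) _ Jq.
pose L := (x2 - x1) + (y2 - y1).
have L0 : 0 <= L by rewrite /L; lra.
pose A := 4 * (M / (r / 2) ^+ 2) * L.
pose B := 4 * (1 / (r / 2) ^+ 2) * L.
have A0 : 0 <= A by rewrite /A !mulr_ge0 ?invr_ge0 ?exprn_ge0 //; lra.
have B0 : 0 <= B by rewrite /B !mulr_ge0 ?invr_ge0 ?exprn_ge0 //; lra.
exists ((A + M * B + 1) / (cabs (J q) / 2)), (Num.min d (r / 2)); split.
- by rewrite divr_gt0 //; have := mulr_ge0 (ltW M0) B0; lra.
- by rewrite lt_min d0 divr_gt0.
move=> z; rewrite lt_min => /andP [/Hd zd /ltW zr].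
have dz : deep x1 x2 y1 y2 (r / 2) z.
  by have := deep_near dq zr; have -> : r - r / 2 = r / 2 by lra.
have r20 : 0 < r / 2 by lra.
have iz := deep_inside r20 dz.
split=> // l hl.
have [|a ha Ha] := cauchy_int_deriv x12 y12 r20 (ltW M0) cf _ dz.
  by move=> v /boundary_closed [? ?]; exact: HM.
have [|b hb Hb] := cauchy_int_deriv x12 y12 r20 ler01 c1 _ dz.
  by move=> v _; rewrite cabs1.
have E : has_deriv (fun v => f v * J v) z a.
  apply: has_deriv_eq ha; have := inside_open iz; apply: filterS => v iv.
  by rewrite (@cauchy_formula_lines _ [::] f _ _ _ _ v cf (fun z iz _ => df z iz) iv).
have /(has_deriv_unique E) aE := has_derivM hl hb.
have Jz : cabs (J q) / 2 <= cabs (J z).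
  by have := cabsDB (J q) (J z); rewrite (cabsB (J q)); lra.
rewrite ler_pdivlMr //.
apply: le_trans (ler_wpM2l (cabs_ge0 l) Jz) _; rewrite -cabsM.
have -> : l * J z = a - f z * b by rewrite aE addrK.
apply: le_trans (cabsD _ _) _; rewrite cabsN cabsM.
have fz : cabs (f z) <= M.
  by case/andP: iz => /andP [? ?] /andP [? ?]; apply: HM; apply/andP; split; exact: ltW.
have := ler_pM (cabs_ge0 _) (cabs_ge0 _) fz Hb.
rewrite -/A -/B -/L in Ha *; lra.
Qed.

(** A holomorphic function that takes the value [f q] only at [q] does so to finite order:
    if [f - f q] were divisible by all powers of [z - q], then Cauchy's formula for the
    quotients would bound it near [q] by arbitrarily small quantities. *)
Lemma finite_order f (x1 x2 y1 y2 : R) q : continuous f ->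
  (forall z, inside x1 x2 y1 y2 z -> derivable f z 1) -> inside x1 x2 y1 y2 q ->
  (forall z, inside x1 x2 y1 y2 z -> f z = f q -> z = q) ->
  exists (k : nat) h, [/\ continuous h, forall z, inside x1 x2 y1 y2 z -> derivable h z 1,
    h q != 0 & forall z, f z - f q = (z - q) ^+ k.+1 * h z].
Proof.
move=> cf df iq finj; apply: contrapT => nex.
have pw (n : nat) : exists h, [/\ continuous h, forall z, inside x1 x2 y1 y2 z -> derivable h z 1 &
    forall z, f z - f q = (z - q) ^+ n.+1 * h z].
  elim: n => [|n [h [ch dh fh]]].
    have [h [ch dh fh]] := divide_root cf df iq.
    by exists h; split=> // z; rewrite expr1.
  have hq : h q = 0.
    apply/eqP; apply: contrapT => /negP hq; apply: nex.
    by exists n, h.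
  have [h' [ch' dh' fh']] := divide_root ch dh iq.
  exists h'; split=> // z; rewrite fh -(subr0 (h z)) -hq fh' mulrA -exprSr.
  by [].
have [/ltW x12 /ltW y12] : x1 < x2 /\ y1 < y2.
  by case/andP: iq => /andP [? ?] /andP [? ?]; split; lra.
have [r r0 dq] := inside_deep iq.
have [M M0 HM] := box_bounded x12 y12 cf.
(* A point at half the distance [r] from [q] to the sides: the n-th quotient is at most
   [2 M / r^n] on the boundary, which beats [(r / 2)^n] at [w]. *)
pose w : plane R := q + (r / 2 +i* 0).
have wq : w - q = r / 2 +i* 0 by rewrite /w addrAC subrr add0r.
have wqc : cabs (w - q) = r / 2 by rewrite wq cabs_real ger0_norm //; lra.
have dw : deep x1 x2 y1 y2 (r / 2) w.
  have := @deep_near _ x1 x2 y1 y2 r (r / 2) q w dq.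
  by rewrite wqc lexx => /(_ isT); have -> : r - r / 2 = r / 2 by lra.
have r20 : 0 < r / 2 by lra.
have iw := deep_inside r20 dw.
have wnq : w != q by rewrite -subr_eq0 -cabs_gt0 wqc.
pose L := (x2 - x1) + (y2 - y1).
have L0 : 0 <= L by rewrite /L; lra.
pose J := cauchy_int (fun=> 1 : plane R) x1 x2 y1 y2.
have Jw : J w != 0 by exact: cauchy_int1_neq0.
pose C := 4 * (2 * M * (r / 2)^-1) * L.
have fw : 0 < cabs (f w - f q) * cabs (J w).
  rewrite mulr_gt0 ?cabs_gt0 // subr_eq0; apply: contra wnq => /eqP E.
  by apply/eqP; exact: finj.
have [n Hn] := @exp2_gt R C _ fw.
have [h [ch dh fh]] := pw n.
have lh : line_continuous (fun z => h z * (z - w)^-1) x1 x2 y1 y2.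
  by apply: line_contM (line_cont_kernel iw); exact: continuous_line.
have hb : cabs (cauchy_int h x1 x2 y1 y2 w) <= 4 * (2 * M / r ^+ n.+1 * (r / 2)^-1) * L.
  apply: oint_bound => // z bz; rewrite cabsM cabsV.
  have zq := deep_dist dq bz.
  have zw := deep_dist dw bz.
  apply: ler_pM; rewrite ?invr_ge0 ?cabs_ge0 //; last by rewrite lef_pV2 // posrE; lra.
  rewrite ler_pdivlMr ?exprn_gt0 //.
  apply: le_trans (_ : cabs (h z) * cabs (z - q) ^+ n.+1 <= _).
    by apply: ler_wpM2l; [exact: cabs_ge0|rewrite lerXn2r // ?nnegrE ?cabs_ge0 // ltW].
  rewrite mulrC -cabsX -cabsM -fh.
  have [bx by_] := boundary_closed bz.
  apply: le_trans (cabsD _ _) _; rewrite cabsN.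
  have := HM z bx by_.
  have : cabs (f q) <= M.
    by case/andP: iq => /andP [? ?] /andP [? ?]; apply: HM; apply/andP; split; exact: ltW.
  lra.
rewrite (@cauchy_formula_lines _ [::] h _ _ _ _ w ch (fun z iz _ => dh z iz) iw) in hb.
rewrite cabsM -/J in hb.
have : cabs (f w - f q) * cabs (J w) <= C / 2 ^+ n.
  rewrite fh cabsM cabsX wqc -mulrA.
  apply: le_trans (ler_wpM2l (exprn_ge0 _ (ltW r20)) hb) _.
  have X0 : 0 <= C / 2 ^+ n.
    by rewrite /C !mulr_ge0 ?invr_ge0 ?exprn_ge0 //; lra.
  have rn : r ^+ n.+1 != 0 by rewrite expf_eq0 /= gt_eqF.
  have e2 : (2 : R) ^+ n != 0 by rewrite expf_eq0 /= pnatr_eq0 andbF.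
  set X := (r / 2) ^+ n.+1 * _.
  suff -> : X = C / 2 ^+ n / 2 by lra.
  rewrite /X expr_div_n (exprS (2 : R) n) /C.
  move: rn e2; move: (r ^+ n.+1) (2 ^+ n) => a b a0 b0.
  by field; rewrite a0 b0 gt_eqF.
by rewrite leNgt Hn.
Qed.

(** The zeros of the derivative of an injective holomorphic function are isolated. (There are
    none, but this is not needed.) *)
Lemma injective_deriv_neq0 f (x1 x2 y1 y2 : R) q : continuous f ->
  (forall z, inside x1 x2 y1 y2 z -> derivable f z 1) -> inside x1 x2 y1 y2 q ->
  (forall z, inside x1 x2 y1 y2 z -> f z = f q -> z = q) ->
  exists2 r, 0 < r & forall z, cabs (z - q) < r -> z != q ->
    exists2 l, l != 0 & has_deriv f z l.
Proof.
move=> cf df iq finj.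
have [k [h [ch dh hq fh]]] := finite_order cf df iq finj.
have [C [r [C0 r0 HC]]] := derivative_bounded ch dh iq.
have hq2 : 0 < cabs (h q) / 2 by rewrite divr_gt0 // cabs_gt0.
have [d d0 Hd] := (iffLR (continuousP q h) (ch q)) _ hq2.
exists (Num.min (Num.min r d) (cabs (h q) / 2 / C)).
  by rewrite !lt_min r0 d0 divr_gt0.
move=> z; rewrite !lt_min => /andP [/andP [zr zd] zC] zq.
rewrite ltr_pdivlMr // in zC.
have [iz Hl] := HC z zr.
have /derivableP [m hm] := dh z iz.
have lm := Hl m hm.
exists ((z - q) ^+ k * (k.+1%:R * h z + (z - q) * m)); last first.
  have H := has_derivM (@has_deriv_pow q z k) hm.
  move=> e e0; have [d' d'0 Hd'] := H e e0; exists d' => // w /Hd'.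
  congr (cabs _ <= _).
  have -> : f w - f z = (f w - f q) - (f z - f q) by ring.
  rewrite !fh !exprS.
  by move: (k.+1%:R : plane R) ((w - q) ^+ k) ((z - q) ^+ k) => a b c; ring.
rewrite mulf_neq0 ?expf_neq0 ?subr_eq0 //.
apply/negP => /eqP /addr0_eq E.
have hz : cabs (h q) / 2 < cabs (h z).
  by have := Hd z zd; have := cabsDB (h q) (h z); rewrite (cabsB (h q)); lra.
have : cabs (k.+1%:R * h z) <= cabs (z - q) * C.
  by rewrite -cabsN E cabsM; apply: ler_wpM2l => //; exact: cabs_ge0.
have : cabs (h z) <= cabs (k.+1%:R * h z).
  rewrite cabsM; apply: ler_peMl; first exact: cabs_ge0.
  have -> : (k.+1%:R : plane R) = (k.+1%:R : R) +i* 0 by rewrite -(rmorph_nat (real_complex R)).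
  by rewrite cabs_real ger0_norm // ler1n.
lra.
Qed.

End Injective.

(** * Rigidity of rectangles *)

Section Clamp.
Context {R : realType}.

(** The closed rectangle. *)
Definition inbox (a b c d : R) (z : plane R) := (a <= Re z <= b) && (c <= Im z <= d).

(** The retraction of the line onto a segment. *)
Definition clamp1 (a b x : R) : R := Num.max a (Num.min b x).

(** The retraction of the plane onto a closed rectangle; precomposing with it turns a
    function that is continuous on the rectangle into a continuous function. *)
Definition clamp (a b c d : R) (z : plane R) : plane R :=
  clamp1 a b (Re z) +i* clamp1 c d (Im z).

Lemma clamp1_itv a b x : a <= b -> a <= clamp1 a b x <= b.
Proof. by move=> ab; rewrite /clamp1 le_max lexx /= ge_max ab ge_min lexx. Qed.

Lemma clamp1_id a b x : a <= x <= b -> clamp1 a b x = x.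
Proof. by move=> /andP [ax xb]; rewrite /clamp1 (min_idPr xb) (max_idPr ax). Qed.

Lemma clamp1_lip a b x y : `|clamp1 a b x - clamp1 a b y| <= `|x - y|.
Proof.
have := ler_norm (x - y); have := ler_norm (y - x); rewrite (distrC y x) => h1 h2.
rewrite /clamp1; case: (leP b x) => ?; case: (leP b y) => ?.
- by rewrite subrr normr0.
- by case: (leP a b) => ?; case: (leP a y) => ?; rewrite ler_norml; lra.
- by case: (leP a x) => ?; case: (leP a b) => ?; rewrite ler_norml; lra.
- by case: (leP a x) => ?; case: (leP a y) => ?; rewrite ler_norml; lra.
Qed.

Lemma clamp_inbox (a b c d : R) z : a <= b -> c <= d -> inbox a b c d (clamp a b c d z).
Proof. by move=> ab cd; rewrite /inbox /= !clamp1_itv. Qed.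

Lemma clamp_id (a b c d : R) z : inbox a b c d z -> clamp a b c d z = z.
Proof. by move=> /andP [h1 h2]; rewrite /clamp !clamp1_id // -complex_eta. Qed.

Lemma clamp_continuous (a b c d : R) : continuous (clamp a b c d).
Proof.
apply: plane_continuous => z; apply/continuousP => e e0; exists (e / 2); first lra.
move=> w hw; apply: le_lt_trans (cabs_le _) _; rewrite ReB ImB /=.
have := clamp1_lip a b (Re w) (Re z); have := clamp1_lip c d (Im w) (Im z).
have := Re_le_cabs (w - z); have := Im_le_cabs (w - z); rewrite ReB ImB; lra.
Qed.

Lemma inside_inbox (a b c d : R) z : inside a b c d z -> inbox a b c d z.
Proof.
move=> /andP [/andP [? ?] /andP [? ?]].
by apply/andP; split; apply/andP; split; exact: ltW.
Qed.

Lemma inbox_order (a b c d : R) z : inbox a b c d z -> a <= b /\ c <= d.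
Proof. by move=> /andP [/andP [? ?] /andP [? ?]]; split; lra. Qed.

End Clamp.

Section Rigidity.
Context {R : realType}.
Implicit Types (f g h : plane R -> plane R) (z w q : plane R).

(** The inverse of an injective continuous function on a closed rectangle is continuous. *)
Lemma inverse_stable f (a b c d : R) p e : continuous f -> inbox a b c d p ->
  (forall q, inbox a b c d q -> f q = f p -> q = p) -> 0 < e ->
  exists2 m, 0 < m & forall q, inbox a b c d q -> cabs (f q - f p) < m -> cabs (q - p) < e.
Proof.
move=> cf bp finj e0.
have [ab cd] := inbox_order bp.
pose P u1 u2 v1 v2 := exists2 m, 0 < m & forall q, inbox a b c d q -> inbox u1 u2 v1 v2 q ->
   cabs (f q - f p) < m -> cabs (q - p) < e.
suff [m m0 H] : P a b c d by exists m => // q bq; exact: H.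
apply: (@bisection R P) => //.
  move=> u1 u2 v1 v2 _ _ [a' a0 Ha] [b' b0 Hb] [k k0 Hk] [m m0 Hm].
  exists (Num.min (Num.min a' b') (Num.min k m)).
    by rewrite !lt_min a0 b0 k0 m0.
  move=> z bz; rewrite !lt_min => /andP [/andP [z1 z2] /andP [z3 z4]].
  move=> /andP [/andP [ta tb] /andP [tk tm]].
  case: (lerP (Re z) ((u1 + u2) / 2)) => zx; case: (lerP (Im z) ((v1 + v2) / 2)) => zy.
  - by apply: Ha => //; rewrite /inbox z1 zx z3 zy.
  - by apply: Hk => //; rewrite /inbox z1 zx z4 (ltW zy).
  - by apply: Hb => //; rewrite /inbox z2 (ltW zx) z3 zy.
  - by apply: Hm => //; rewrite /inbox z2 (ltW zx) z4 (ltW zy).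
move=> z zx zy.
have [fz|fz] := eqVneq (f z) (f p).
  have -> : z = p by apply: finj => //; rewrite /inbox zx zy.
  exists (e / 2); first lra.
  move=> u1 u2 v1 v2 _ _ _ _ pu pv hu hv; exists 1 => // q _ /andP [qu qv] _.
  by have := box_cabs pu pv qu qv; lra.
have h0 : 0 < cabs (f z - f p) / 2 by rewrite divr_gt0 // cabs_gt0 subr_eq0.
have [r r0 Hr] := (iffLR (continuousP z f) (cf z)) _ h0.
exists (r / 2); first lra.
move=> u1 u2 v1 v2 _ _ _ _ zu zv hu hv; exists (cabs (f z - f p) / 2) => // q _ /andP [qu qv] hq.
have qz := box_cabs zu zv qu qv.
have := Hr q ltac:(lra).
have := cabs_tri (f q) (f z) (f p); rewrite (cabsB (f z) (f q)); lra.
Qed.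

(** The derivative of a continuous solution [h] of [g (h w) = f w]. *)
Lemma inverse_deriv h f g z l k : {for z, continuous h} -> k != 0 ->
  has_deriv g (h z) k -> has_deriv f z l ->
  (\forall w \near z, g (h w) = f w) -> has_deriv h z (l / k).
Proof.
move=> ch k0 hg hf /plane_nbhsP [r r0 E] e e0.
have K0 : 0 < cabs k by rewrite cabs_gt0.
have L0 : 0 <= cabs l := cabs_ge0 l.
pose C := 2 * (cabs l + cabs k) / cabs k.
have C0 : 0 <= C by rewrite /C !mulr_ge0 ?invr_ge0 //; lra.
pose a := Num.min (cabs k / 2) (e * cabs k / (C + 1)).
have a0 : 0 < a by rewrite lt_min !divr_gt0 // ?mulr_gt0 //; lra.
have a1 : a <= cabs k / 2 by rewrite ge_min lexx.
have a2 : a * (C + 1) <= e * cabs k.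
  by rewrite -ler_pdivlMr ?ge_min ?lexx ?orbT //; lra.
have [d d0 Hd] := hg a a0; have [d' d'0 Hd'] := hf a a0.
have [s s0 Hs] := (iffLR (continuousP z h) ch) _ d0.
exists (Num.min (Num.min r d') s); first by rewrite !lt_min r0 d'0 s0.
move=> w; rewrite !lt_min => /andP [/andP [wr /Hd' h1] /Hs /Hd h2].
have Ew := E w wr; have Ez : g (h z) = f z by apply: E; rewrite subrr cabs0.
rewrite Ew Ez in h2.
set D := cabs (w - z) in h1 *; set H := cabs (h w - h z) in h2 *.
have D0 : 0 <= D by exact: cabs_ge0.
have H0 : 0 <= H by exact: cabs_ge0.
have h3 : cabs (k * (h w - h z) - l * (w - z)) <= a * H + a * D.
  have -> : k * (h w - h z) - l * (w - z) =
    (f w - f z - l * (w - z)) - (f w - f z - k * (h w - h z)) by ring.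
  by apply: le_trans (cabsD _ _) _; rewrite cabsN; lra.
have h4 : cabs k * H <= cabs l * D + (a * H + a * D).
  rewrite -cabsM.
  have -> : k * (h w - h z) = l * (w - z) + (k * (h w - h z) - l * (w - z)) by ring.
  by apply: le_trans (cabsD _ _) _; rewrite cabsM -/D; lra.
have h5 : H <= C * D.
  have aH : a * H <= cabs k / 2 * H by exact: ler_wpM2r.
  have aD : a * D <= cabs k / 2 * D by exact: ler_wpM2r.
  have -> : C * D = (2 * (cabs l + cabs k) * D) / cabs k by rewrite /C; ring.
  by rewrite ler_pdivlMr //; nra.
have -> : h w - h z - l / k * (w - z) = k^-1 * (k * (h w - h z) - l * (w - z)).
  by field.
rewrite cabsM cabsV mulrC ler_pdivrMr //.
apply: le_trans h3 _.
apply: le_trans (_ : a * (C * D) + a * D <= _).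
  by rewrite lerD2r ler_pM2l.
have -> : a * (C * D) + a * D = a * (C + 1) * D by ring.
have -> : e * D * cabs k = e * cabs k * D by ring.
exact: ler_wpM2r.
Qed.

Lemma continuous_const_closed (g : R -> R) (m c d : R) : continuous g -> c < d ->
  (forall x, c < x < d -> g x = m) -> forall x, c <= x <= d -> g x = m.
Proof.
move=> cg cd H x xcd; apply/eqP; rewrite -subr_eq0 -normr_eq0 eq_le normr_ge0 andbT.
apply: (@eps_le0 _ _ 1); first by [].
move=> e e0; rewrite mulr1.
have /cvgrPdist_lt/(_ _ e0) := cg x.
move=> /nbhs_ballP [r /= r0 Hr].
pose s := Num.min (r / 2) (d - c) / 2.
have m0 : 0 < Num.min (r / 2) (d - c) by rewrite lt_min; lra.
have m1 : Num.min (r / 2) (d - c) <= r / 2 by rewrite ge_min lexx.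
have m2 : Num.min (r / 2) (d - c) <= d - c by rewrite ge_min lexx orbT.
have [y xy ycd] : exists2 y, `|x - y| < r & c < y < d.
  have [hx|hx] := lerP x ((c + d) / 2).
    exists (x + s / 2); last by rewrite /s; lra.
    by rewrite opprD addrA subrr sub0r normrN gtr0_norm /s; lra.
  exists (x - s / 2); last by rewrite /s; lra.
  by rewrite opprB addrCA subrr addr0 gtr0_norm /s; lra.
by have := Hr y xy; rewrite (H y ycd) => /ltW.
Qed.

(** Let [f] and [g] be injective holomorphic maps of two rectangles, the image of [f] being
    contained in that of [g], and let the transition map from the first rectangle to the
    second have imaginary part
    [k1] on the bottom, [k2] on the top, and real part [m1] on the left side, [m2] on the
    right side.  The conclusion says that the imaginary part of its integral along the
    boundary is 0. *)
Lemma rectangle_rigidity f g (a1 b1 c1 d1 a2 b2 c2 d2 k1 k2 m1 m2 : R) :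
  a1 < b1 -> c1 < d1 -> continuous f -> continuous g ->
  (forall z, inside a1 b1 c1 d1 z -> derivable f z 1) ->
  (forall z, inside a2 b2 c2 d2 z -> derivable g z 1) ->
  (forall z w, inbox a1 b1 c1 d1 z -> inbox a1 b1 c1 d1 w -> f z = f w -> z = w) ->
  (forall z w, inbox a2 b2 c2 d2 z -> inbox a2 b2 c2 d2 w -> g z = g w -> z = w) ->
  (forall z, inbox a1 b1 c1 d1 z -> exists2 q, inbox a2 b2 c2 d2 q & g q = f z) ->
  (forall z, inside a1 b1 c1 d1 z -> exists2 q, inside a2 b2 c2 d2 q & g q = f z) ->
  (forall x, a1 <= x <= b1 -> exists q, [/\ inbox a2 b2 c2 d2 q, Im q = k1 & g q = f (x +i* c1)]) ->
  (forall x, a1 <= x <= b1 -> exists q, [/\ inbox a2 b2 c2 d2 q, Im q = k2 & g q = f (x +i* d1)]) ->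
  (forall y, c1 < y < d1 -> exists q, [/\ inbox a2 b2 c2 d2 q, Re q = m1 & g q = f (a1 +i* y)]) ->
  (forall y, c1 < y < d1 -> exists q, [/\ inbox a2 b2 c2 d2 q, Re q = m2 & g q = f (b1 +i* y)]) ->
  (k1 - k2) * (b1 - a1) + (m2 - m1) * (d1 - c1) = 0.
Proof.
move=> ab cd cf cg df dg finj ginj Hbox Hin Hk1 Hk2 Hm1 Hm2.
have ab' := ltW ab; have cd' := ltW cd.
pose cl := clamp a1 b1 c1 d1.
have icl z : inbox a1 b1 c1 d1 (cl z) by exact: clamp_inbox.
have /choice [h hP] : forall z, exists q, inbox a2 b2 c2 d2 q /\ g q = f (cl z).
  by move=> z; have [q q1 q2] := Hbox _ (icl z); exists q.
have hbox z : inbox a2 b2 c2 d2 (h z) by case: (hP z).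
have hE z : g (h z) = f (cl z) by case: (hP z).
have hU z q : inbox a1 b1 c1 d1 z -> inbox a2 b2 c2 d2 q -> g q = f z -> h z = q.
  by move=> bz bq E; apply: ginj => //; rewrite hE /cl clamp_id.
have cfcl : continuous (fun z => f (cl z)).
  apply: plane_continuous => z.
  exact: (continuous_comp (@clamp_continuous R a1 b1 c1 d1 z) (cf (cl z))).
have ch : continuous h.
  apply: plane_continuous => z; apply/continuousP => e e0.
  have [|m m0 Hm] := inverse_stable cg (hbox z) _ e0.
    by move=> q bq; exact: ginj.
  have [r r0 Hr] := (iffLR (continuousP z _) (cfcl z)) _ m0.
  by exists r => // w /Hr; rewrite -!hE; exact: Hm.
have dh z : inside a1 b1 c1 d1 z -> derivable h z 1.
  move=> iz.
  have [q iq gq] := Hin z iz.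
  have hz : h z = q by apply: hU => //; exact: inside_inbox.
  (* Off the vertical line of [z], and near [z], the derivative of [g] does not vanish. *)
  have [|r r0 Hr] := injective_deriv_neq0 cg dg iq.
    by move=> v iv; apply: ginj; exact: inside_inbox.
  have [s s0 Hs] := (iffLR (continuousP z h) (ch z)) _ r0.
  have /plane_nbhsP [t t0 Ht] := inside_open iz.
  pose u := Num.min s t / 2.
  have m0 : 0 < Num.min s t by rewrite lt_min s0.
  have u0 : 0 < u by rewrite /u; lra.
  have us : 2 * u <= s /\ 2 * u <= t.
    by apply/andP; rewrite -le_min /u mulrC divfK.
  apply: (@painleve _ [:: Re z] h (Re z - u) (Re z + u) (Im z - u) (Im z + u)) => //; last first.
    by rewrite /inside; lra.
  move=> w /andP [/andP [w1 w2] /andP [w3 w4]]; rewrite inE => wz.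
  have wzu : cabs (w - z) < 2 * u.
    apply: le_lt_trans (cabs_le _) _; rewrite ReB ImB.
    have : `|Re w - Re z| < u by rewrite ltr_norml; lra.
    have : `|Im w - Im z| < u by rewrite ltr_norml; lra.
    lra.
  have iw : inside a1 b1 c1 d1 w by apply: Ht; lra.
  have hwq : h w != q.
    apply: contra wz => /eqP E; have := hE w; rewrite /cl clamp_id ?inside_inbox //.
    rewrite E gq => /finj -> //; exact: inside_inbox.
  have [|k k0 gk] := Hr (h w) _ hwq.
    by rewrite -hz; apply: Hs; lra.
  have /derivableP [l fl] := df w iw.
  apply: has_deriv_derivable (l / k) _; apply: inverse_deriv (ch w) k0 gk fl _.
  have := inside_open iw; apply: filterS => v iv.
  by rewrite hE /cl clamp_id // inside_inbox.
have O : oint h a1 b1 c1 d1 = 0.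
  apply: goursat_open => // z zx zy; apply: dh.
  by rewrite /inside zx zy.
have ibot x : a1 <= x <= b1 -> inbox a1 b1 c1 d1 (x +i* c1).
  by move=> hx; rewrite /inbox /= hx lexx.
have itop x : a1 <= x <= b1 -> inbox a1 b1 c1 d1 (x +i* d1).
  by move=> hx; rewrite /inbox /= hx lexx cd'.
have ileft y : c1 <= y <= d1 -> inbox a1 b1 c1 d1 (a1 +i* y).
  by move=> hx; rewrite /inbox /= hx lexx ab'.
have iright y : c1 <= y <= d1 -> inbox a1 b1 c1 d1 (b1 +i* y).
  by move=> hx; rewrite /inbox /= hx lexx ab'.
have [_ _ cl_ cr_] := continuous_line a1 b1 c1 d1 ch.
have e1 x : a1 <= x <= b1 -> Im (h (x +i* c1)) = k1.
  by move=> hx; have [q [bq <- gq]] := Hk1 x hx; rewrite (hU _ _ (ibot x hx) bq gq).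
have e2 x : a1 <= x <= b1 -> Im (h (x +i* d1)) = k2.
  by move=> hx; have [q [bq <- gq]] := Hk2 x hx; rewrite (hU _ _ (itop x hx) bq gq).
have e3 y : c1 <= y <= d1 -> Re (h (a1 +i* y)) = m1.
  apply: (continuous_const_closed (continuous_Re cl_) cd) => {}y hy.
  have hy' : c1 <= y <= d1 by lra.
  by have [q [bq <- gq]] := Hm1 y hy; rewrite (hU _ _ (ileft y hy') bq gq).
have e4 y : c1 <= y <= d1 -> Re (h (b1 +i* y)) = m2.
  apply: (continuous_const_closed (continuous_Re cr_) cd) => {}y hy.
  have hy' : c1 <= y <= d1 by lra.
  by have [q [bq <- gq]] := Hm2 y hy; rewrite (hU _ _ (iright y hy') bq gq).
have : Im (oint h a1 b1 c1 d1) = 0 by rewrite O.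
rewrite /oint ImD ImB ImM ReB /= mul0r add0r mul1r.
rewrite (rint_eq e1) (rint_eq e2) (rint_eq e3) (rint_eq e4) !rint_cst //.
lra.
Qed.

End Rigidity.

(** * Polar coordinates and the Riemann sphere *)

Section Polar.
Context {R : realType}.
Implicit Types (z w : plane R) (r t gamma : R).

Lemma polar_2pi r t : polar r (2 * pi + t) = polar r t.
Proof. by rewrite /polar mulr_natl addrC cosD2pi sinD2pi. Qed.

Lemma cabs_polar r t : 0 <= r -> cabs (polar r t) = r.
Proof.
move=> r0; rewrite cabsE /= !exprMn -mulrDr cos2Dsin2 mulr1 sqrtr_sqr.
exact: ger0_norm.
Qed.

(** The argument of a nonzero complex number, up to sign. *)
Lemma polar_exists z : z != 0 -> exists t, [/\ 0 <= t <= pi, cos t = Re z / cabs z &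
  z = polar (cabs z) t \/ z = polar (cabs z) (- t)].
Proof.
rewrite -cabs_gt0 => r0.
set x := Re z / cabs z.
have x1 : -1 <= x <= 1.
  have := Re_le_cabs z; rewrite ler_norml => /andP [h1 h2].
  by rewrite /x ler_pdivlMr // ler_pdivrMr // mulN1r mul1r h1 h2.
have [t0 cx] := acos_def x1.
exists (acos x); split => //.
have rx : cabs z * x = Re z by rewrite /x mulrC divfK // gt_eqF.
have ry : cabs z * sin (acos x) = `|Im z|.
  have s0 : 0 <= sin (acos x) by exact: sin_ge0_pi.
  apply/eqP; rewrite -(@eqrXn2 _ 2) ?mulr_ge0 ?normr_ge0 //; last exact: ltW.
  rewrite exprMn sin2cos2 cx mulrBr mulr1 -exprMn rx cabs_sqr real_normK ?num_real //.
  by apply/eqP; ring.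
case: (lerP 0 (Im z)) => h; [left|right]; apply: complex_ext;
  rewrite /= ?cosN ?sinN ?cx ?mulrN ?ry ?rx //.
  by rewrite ger0_norm.
by rewrite ltr0_norm // opprK.
Qed.

(** The open sector around the positive real axis with half angle [gamma]. *)
Definition sector gamma z := cabs z * cos gamma < Re z.

Lemma sector_polar gamma r t : 0 < gamma -> gamma < pi -> 0 < r -> - gamma < t < gamma ->
  sector gamma (polar r t).
Proof.
move=> g0 gpi r0 tg; rewrite /sector (cabs_polar _ (ltW r0)) /= ltr_pM2l //.
wlog t0 : t tg / 0 <= t.
  move=> H; case: (lerP 0 t) => [|t0]; first exact: H.
  by rewrite -[cos t]cosN; apply: H; lra.
by rewrite ltr_cos //; rewrite ?in_itv /=; lra.
Qed.

Lemma sector_exists gamma z : 0 < gamma -> gamma < pi -> sector gamma z ->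
  exists2 t, - gamma < t < gamma & z = polar (cabs z) t.
Proof.
move=> g0 gpi; rewrite /sector => hz.
have z0 : z != 0 by apply: contraTneq hz => ->; rewrite cabs0 mul0r ltxx.
have [t [tpi ct zt]] := polar_exists z0.
have r0 : 0 < cabs z by rewrite cabs_gt0.
have tg : t < gamma.
  by rewrite -ltr_cos ?in_itv /= ?tpi ?ct ?ltr_pdivlMr 1?mulrC //; lra.
by case: zt => zt; [exists t|exists (- t)] => //; lra.
Qed.

Lemma cosector_polar gamma r t : 0 < gamma -> gamma < pi -> 0 < r -> gamma <= t <= 2 * pi - gamma ->
  ~ sector gamma (polar r t).
Proof.
move=> g0 gpi r0 tg; rewrite /sector (cabs_polar _ (ltW r0)) /= ltr_pM2l //.
apply/negP; rewrite -leNgt.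
wlog tpi : t tg / t <= pi.
  move=> H; case: (lerP t pi) => [|t0]; first exact: H.
  have -> : cos t = cos (2 * pi - t) by rewrite cosB mulr_natl cos2pi sin2pi mul1r mul0r addr0.
  by apply: H; lra.
by rewrite leNgt ltr_cos ?in_itv /= -?leNgt; lra.
Qed.

Lemma cosector_exists gamma z : 0 < gamma -> gamma < pi -> z != 0 -> ~ sector gamma z ->
  exists2 t, gamma <= t <= 2 * pi - gamma & z = polar (cabs z) t.
Proof.
move=> g0 gpi z0 hz.
have [t [tpi ct zt]] := polar_exists z0.
have r0 : 0 < cabs z by rewrite cabs_gt0.
have tg : gamma <= t.
  rewrite leNgt; apply/negP => tg; apply: hz; rewrite /sector.
  have : cos gamma < cos t by rewrite ltr_cos ?in_itv /=; lra.
  by rewrite ct ltr_pdivlMr // mulrC.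
case: zt => zt; [exists t|exists (2 * pi - t)] => //; first lra.
  lra.
by rewrite polar_2pi.
Qed.

Lemma gear_domainP beta gamma z : 0 < gamma -> gamma < pi -> 0 < beta ->
  gear_domain beta gamma z <-> cabs z < 1 \/ cabs z < beta /\ sector gamma z.
Proof.
move=> g0 gpi b0; split.
  case=> [h|]; first by left; rewrite /= normE (_ : 1 = 1%:C) ?ltcR in h.
  case=> r /=; rewrite in_itv /= => /andP [r0 rb] [t]; rewrite in_itv /= => tg <-.
  by right; rewrite (cabs_polar _ (ltW r0)); split=> //; exact: sector_polar.
case=> [h|[h1 h2]]; first by left; rewrite /= normE (_ : 1 = 1%:C) ?ltcR.
have [t tg zt] := sector_exists g0 gpi h2.
right; exists (cabs z) => /=.
  rewrite in_itv /= h1 andbT cabs_gt0; apply: contraTneq h2 => ->.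
  by rewrite /sector cabs0 mul0r ltxx.
by exists t; rewrite ?in_itv.
Qed.

Lemma sector_inv gamma beta z : beta != 0 ->
  sector gamma ((beta ^+ 2 +i* 0) * (z^*)%C^-1) <-> sector gamma z.
Proof.
move=> b0; rewrite /sector.
have [->|z0] := eqVneq z 0; first by rewrite conjc0 invr0 mulr0.
have r0 : 0 < cabs z by rewrite cabs_gt0.
rewrite cabsM cabsV cabsJ cabs_real ger0_norm ?sqr_ge0 //.
have -> : Re ((beta ^+ 2 +i* 0) * (z^*)%C^-1) = beta ^+ 2 * Re z / cabs z ^+ 2.
  by rewrite cabs_sqr ReM /=; case: (z) => x y /=; rewrite mul0r subr0 sqrrN mulrA.
have -> : beta ^+ 2 / cabs z * cos gamma = beta ^+ 2 * (cabs z * cos gamma) / cabs z ^+ 2.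
  by field; rewrite gt_eqF.
rewrite ltr_pM2r ?invr_gt0 ?exprn_gt0 // ltr_pM2l //.
by rewrite exprn_even_gt0.
Qed.

Lemma polar_continuous (f g : R -> R) s : {for s, continuous f} -> {for s, continuous g} ->
  {for s, continuous (fun s => polar (f s) (g s))}.
Proof.
move=> cf cg; apply: complex_continuous_at.
  by apply: cvgM; [exact: cf|exact: (continuous_comp cg (@continuous_cos R _))].
by apply: cvgM; [exact: cf|exact: (continuous_comp cg (@continuous_sin R _))].
Qed.

(** The closed annular rectangle, with its angular condition stated by the sector. *)
Lemma closure_annular beta gamma z : 1 < beta -> 0 < gamma -> gamma < pi ->
  closure (annular_rectangle beta gamma) z <->
  1 <= cabs z <= beta ^+ 2 /\ ~ sector gamma z.
Proof.
move=> b1 g0 gpi.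
have b2 : 1 < beta ^+ 2 by rewrite exprn_egt1.
split.
  move=> hz; split.
    apply/andP; split; rewrite leNgt; apply/negP => h.
      have e0 : 0 < 1 - cabs z by lra.
      have /hz [_ [[r hr [t ht <-]] hw]] : nbhs z [set w | cabs (w - z) < 1 - cabs z].
        by apply/plane_nbhsP; exists (1 - cabs z).
      move: hr hw; rewrite /= in_itv /= => /andP [r1 r2].
      have r0 : 0 <= r by lra.
      by have := cabsDB (polar r t) z; rewrite cabs_polar //; lra.
    have e0 : 0 < cabs z - beta ^+ 2 by lra.
    have /hz [_ [[r hr [t ht <-]] hw]] : nbhs z [set w | cabs (w - z) < cabs z - beta ^+ 2].
      by apply/plane_nbhsP; exists (cabs z - beta ^+ 2).
    move: hr hw; rewrite /= in_itv /= => /andP [r1 r2].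
    have r0 : 0 <= r by lra.
    by have := cabsDB z (polar r t); rewrite cabsB cabs_polar //; lra.
  rewrite /sector => hs.
  pose F w : R := Re w - cabs w * cos gamma.
  have cF : {for z, continuous F}.
    have c1 := @Re_continuous R z; have c2 := @cabs_continuous R z.
    exact: (continuousB c1 (continuousM c2 (@cst_continuous _ _ (cos gamma) z))).
  have F0 : 0 < F z by rewrite /F subr_gt0.
  have /hz [_ [[r hr [t ht <-]] hw]] : nbhs z [set w | 0 < F w] by exact: (cF _ (lt_nbhsr F0)).
  move: hr ht hw; rewrite /= !in_itv /= => /andP [r1 r2] tg.
  rewrite /F subr_gt0; apply: cosector_polar; lra.
case=> /andP [z1 z2] hs B hB.
have z0 : z != 0 by rewrite -cabs_gt0; lra.
have [t tg zt] := cosector_exists g0 gpi z0 hs.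
set r := cabs z in zt z1 z2.
(* A path from [z] to the middle of the annular rectangle. *)
pose r0 := (1 + beta ^+ 2) / 2.
pose phi (s : R) := polar (r + s * (r0 - r)) (t + s * (pi - t)).
have cphi : {for 0, continuous phi}.
  by apply: polar_continuous; (apply: cvgD; first exact: cvg_cst); apply: cvgM;
    [exact: cvg_id|exact: cvg_cst|exact: cvg_id|exact: cvg_cst].
have phi0 : phi 0 = z by rewrite /phi !mul0r !addr0 -zt.
rewrite -phi0 in hB.
have /nbhs_ballP [e /= e0 He] := cphi _ hB.
pose s := Num.min (e / 2) (1 / 2).
have s0 : 0 < s by rewrite lt_min; lra.
have s1 : s <= e / 2 by rewrite ge_min lexx.
have s2 : s <= 1 / 2 by rewrite ge_min lexx orbT.
exists (phi s); split; last first.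
  by apply: He; rewrite /ball /= sub0r normrN gtr0_norm //; lra.
exists (r + s * (r0 - r)).
  by rewrite /= in_itv /= /r0; apply/andP; split; nra.
exists (t + s * (pi - t)) => //.
by rewrite /= in_itv /=; case/andP: tg => t1 t2; apply/andP; split; nra.
Qed.

End Polar.

Section Sphere.
Context {R : realType}.
Implicit Types (z w p : plane R) (s : sphere R).

Lemma closed_disc_compact (M : R) : compact [set w : plane R | cabs w <= M].
Proof.
pose e (u : R * R) : plane R := u.1 +i* u.2.
have ce : continuous e.
  by apply: plane_continuous => u; apply: complex_continuous_at; [exact: cvg_fst|exact: cvg_snd].
have cB : compact (e @` (`[- M, M] `*` `[- M, M])).
  apply: continuous_compact; first exact: continuous_subspaceT.
  by apply: compact_setX; exact: segment_compact.
apply: (subclosed_compact _ cB).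
  rewrite (_ : mkset _ = cabs @^-1` [set x : R | x <= M]) //.
  by apply: preimage_closed; [move=> x _; exact: cabs_continuous|exact: closed_le].
move=> w /= wM; exists (Re w, Im w); last by rewrite /e -complex_eta.
by split; rewrite /= in_itv /= -ler_norml (le_trans _ wM) // ?Re_le_cabs ?Im_le_cabs.
Qed.

Lemma closed_disc_closed (M : R) : closed [set w : plane R | cabs w <= M].
Proof.
rewrite (_ : mkset _ = cabs @^-1` [set x : R | x <= M]) //.
by apply: preimage_closed; [move=> x _; exact: cabs_continuous|exact: closed_le].
Qed.

Lemma plane_compact_bounded (K : set (plane R)) : compact K ->
  exists2 M : R, 0 < M & forall w, K w -> cabs w <= M.
Proof.
move=> cK.
have cI : compact (cabs @` K).
  by apply: continuous_compact => //; apply: continuous_subspaceT; exact: cabs_continuous.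
have [M [Mr HM]] := compact_bounded cI.
exists (`|M| + 1); first by rewrite ltr_wpDl.
move=> w Kw; have MM : M < `|M| + 1 by have := ler_norm M; lra.
have := HM (`|M| + 1) MM (cabs w) (ex_intro2 _ _ w Kw erefl).
by rewrite /= ger0_norm ?cabs_ge0.
Qed.

(** Neighbourhoods of infinity contain the complements of large discs, and conversely. *)
Lemma nbhs_infinityP (U : set (sphere R)) : nbhs (None : sphere R) U <->
  U None /\ exists2 M : R, 0 < M & forall w, M < cabs w -> U (Some w).
Proof.
split.
  case=> K [cK _] HK; split; first by apply: HK; right.
  have [M M0 HM] := plane_compact_bounded cK.
  exists M => // w Mw; apply: HK; left; exists w => //= Kw.
  by have := HM _ Kw; lra.
case=> U0 [M M0 HM]; exists [set w | cabs w <= M].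
  by split; [exact: closed_disc_compact|exact: closed_disc_closed].
move=> s [[w /= wM <-]|-> //]; apply: HM.
by rewrite ltNge; exact/negP.
Qed.

(** The Moebius coordinate of the sphere with pole [p]. *)
Definition coord p s : plane R := if s is Some w then (w - p)^-1 else 0.

Lemma coord_inj p s s' : s <> Some p -> s' <> Some p -> coord p s = coord p s' -> s = s'.
Proof.
have nz (w : plane R) : Some w <> Some p -> w - p != 0.
  by move=> h; rewrite subr_eq0; apply/eqP => wp; apply: h; rewrite wp.
case: s => [w|]; case: s' => [w'|] //= h h'.
- by move=> /invr_inj /addIr ->.
- by move=> /eqP; rewrite invr_eq0 (negbTE (nz _ h)).
- by move=> /esym/eqP; rewrite invr_eq0 (negbTE (nz _ h')).
Qed.

Lemma coord_continuous p s : s <> Some p -> {for s, continuous (coord p)}.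
Proof.
case: s => [w|] hp A.
  have wp : w - p != 0.
    by rewrite subr_eq0; apply/eqP => wp; apply: hp; rewrite wp.
  have : {for w, continuous (fun w : plane R => (w - p)^-1)}.
    apply: (@plane_contV R _ (fun w => w - p)) => //.
    exact: (plane_contB (@plane_cont_id R w) (@plane_cont_cst R _ p w)).
  exact.
move=> /plane_nbhsP [e e0 HA]; apply/nbhs_infinityP; split.
  by apply: HA; rewrite subrr cabs0.
exists (cabs p + e^-1); first by rewrite ltr_wpDl ?cabs_ge0 // invr_gt0.
move=> w hw; apply: HA; rewrite subr0 cabsV.
have h : e^-1 < cabs (w - p) by have := cabsDB w p; lra.
have e1 : 0 < e^-1 by rewrite invr_gt0.
by rewrite -[X in _ < X]invrK ltf_pV2 // posrE (lt_trans e1).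
Qed.

Lemma some_near (f : plane R -> sphere R) z w : {for z, continuous f} -> f z = Some w ->
  \forall v \near z, f v <> None.
Proof.
move=> cf fz.
have : nbhs (f z) [set s | s <> None].
  by rewrite fz; apply: (@filterS _ (nbhs w) _ setT) => //; exact: filterT.
by move=> /cf.
Qed.

Lemma coord_derivable p (f : plane R -> sphere R) z : holomorphic_at f z -> f z <> Some p ->
  derivable (fun w => coord p (f w)) z 1.
Proof.
case=> cf; case fz : (f z) => [w|] df hp.
  have wp : w - p != 0.
    by rewrite subr_eq0; apply/eqP => wp; apply: hp; rewrite wp.
  apply: (@derivable_near_eq _ (fun v => (finite_chart (f v) - p)^-1)).
    by have := some_near cf fz; apply: filterS => v; case: (f v).
  apply: (@plane_derV R (fun v => finite_chart (f v) - p)); first by rewrite fz.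
  exact: (plane_derB df (@plane_der_cst R p z)).
apply: (@derivable_near_eq _ (fun v => infinity_chart (f v) * (1 - p * infinity_chart (f v))^-1)).
  have h0 : nbhs (f z) [set s | s <> Some 0].
    rewrite fz; apply/nbhs_infinityP; split=> //; exists 1 => // v v1 [v0].
    by move: v1; rewrite v0 cabs0 ltr10.
  have h1 : \forall v \near z, f v <> Some 0 by move: h0 => /cf.
  apply: filterS h1 => v /=; case: (f v) => [u|] /=; last by rewrite mul0r.
  move=> u0; have {}u0 : u != 0 by apply/eqP => u00; apply: u0; rewrite u00.
  by rewrite -invfM mulrBr mulr1 mulrCA mulrA mulfK.
have d1 := plane_derM (@plane_der_cst R p z) df.
have d2 := plane_derB (@plane_der_cst R 1 z) d1.
apply: (plane_derM df); apply: (@plane_derV R (fun v => 1 - p * infinity_chart (f v))) => //.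
by rewrite fz /= mulr0 subr0 oner_neq0.
Qed.

(** The rectangles [inbox] and [inside] are the products of intervals. *)
Lemma boxP (a b c d : R) z : box `[a, b] `[c, d] z <-> inbox a b c d z.
Proof.
split=> [[x /=]|].
  by rewrite in_itv /= => hx [y]; rewrite /= in_itv /= => hy <-; rewrite /inbox /= hx hy.
move=> /andP [hx hy]; exists (Re z); first by rewrite /= in_itv.
by exists (Im z); [rewrite /= in_itv|rewrite -complex_eta].
Qed.

Lemma box_insideP (a b c d : R) z : box `]a, b[ `]c, d[ z <-> inside a b c d z.
Proof.
split=> [[x /=]|].
  by rewrite in_itv /= => hx [y]; rewrite /= in_itv /= => hy <-; rewrite /inside /= hx hy.
move=> /andP [hx hy]; exists (Re z); first by rewrite /= in_itv.
by exists (Im z); [rewrite /= in_itv|rewrite -complex_eta].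
Qed.

Lemma clamp_comp_continuous (T : topologicalType) (f : plane R -> T) (a b c d : R) :
  a <= b -> c <= d -> {within box `[a, b] `[c, d], continuous f} ->
  continuous (fun z => f (clamp a b c d z)).
Proof.
move=> ab cd /subspace_continuousP cf z U hU.
have bz : box `[a, b] `[c, d] (clamp a b c d z) by apply/boxP; exact: clamp_inbox.
have h : within (box `[a, b] `[c, d]) (nbhs (clamp a b c d z)) (f @^-1` U) := cf _ bz U hU.
have h2 : \forall w \near z, box `[a, b] `[c, d] (clamp a b c d w) -> U (f (clamp a b c d w)).
  exact: (@clamp_continuous R a b c d z _ h).
apply: filterS h2 => w; apply.
by apply/boxP; exact: clamp_inbox.
Qed.

Lemma pair_eq (T : Type) (X Y U V : T) : [set X; Y] = [set U; V] ->
  (X = U /\ Y = V) \/ (X = V /\ Y = U).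
Proof.
move=> E.
have hX : [set U; V] X by rewrite -E; left.
have hY : [set U; V] Y by rewrite -E; right.
have hU : [set X; Y] U by rewrite E; left.
have hV : [set X; Y] V by rewrite E; right.
by case: hX hY hU hV => /= hX [] /= hY [] /= hU [] /= hV; subst; auto.
Qed.

End Sphere.

(** * Uniqueness of the conformal module *)

Section ModuleUnique.
Context {R : realType}.

(** The closed rectangle is mapped into the domain and its edges; the corners belong to the
    radial edges. *)
Lemma quad_map_box (a b c d : R) (Q : quadrilateral R) (F : plane R -> sphere R) z :
  quad_conformal_mapping a b c d Q F -> inbox a b c d z ->
  quad_domain Q (F z) \/ (exists2 E, quad_radial_edges Q E & E (F z)) \/
  (exists2 E, quad_circular_edges Q E & E (F z)).
Proof.
move=> [_ _ _ FQ _ Fh Fv] /andP [/andP [z1 z2] /andP [z3 z4]].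
have [zc|zc] := eqVneq (Im z) c.
  right; left; rewrite -Fh; exists (F @` box `[a, b] [set c]); first by left.
  exists z => //; exists (Re z); first by rewrite /= in_itv /= z1.
  by exists (Im z) => //; rewrite -complex_eta.
have [zd|zd] := eqVneq (Im z) d.
  right; left; rewrite -Fh; exists (F @` box `[a, b] [set d]); first by right.
  exists z => //; exists (Re z); first by rewrite /= in_itv /= z1.
  by exists (Im z) => //; rewrite -complex_eta.
have yP : (`]c, d[%classic : set R) (Im z) by rewrite /= in_itv /= !lt_neqAle z3 z4 eq_sym zc zd.
have [za|za] := eqVneq (Re z) a.
  right; right; rewrite -Fv; exists (F @` box [set a] `]c, d[); first by left.
  exists z => //; exists (Re z) => //.
  by exists (Im z) => //; rewrite -complex_eta.
have [zb|zb] := eqVneq (Re z) b.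
  right; right; rewrite -Fv; exists (F @` box [set b] `]c, d[); first by right.
  exists z => //; exists (Re z) => //.
  by exists (Im z) => //; rewrite -complex_eta.
left; rewrite -FQ; exists z => //; exists (Re z).
  by rewrite /= in_itv /= !lt_neqAle z1 z2 eq_sym za zb.
by exists (Im z) => //; rewrite -complex_eta.
Qed.

Lemma quad_map_surj (a b c d : R) (Q : quadrilateral R) (F : plane R -> sphere R) s :
  a <= b -> c <= d ->
  quad_conformal_mapping a b c d Q F ->
  quad_domain Q s \/ (exists2 E, quad_radial_edges Q E & E s) \/
  (exists2 E, quad_circular_edges Q E & E s) ->
  exists2 z, inbox a b c d z & F z = s.
Proof.
move=> ab cd [_ _ _ FQ _ Fh Fv]; rewrite -FQ -Fh -Fv.
case=> [[z /box_insideP hz <-]|]; first by exists z => //; exact: inside_inbox.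
case=> [[E [|] ->]|[E [|] ->]]; move=> [_ [x hx [y hy <-]] <-]; exists (x +i* y) => //;
  move: hx hy; rewrite /inbox /= ?in_itv /=.
- by move=> -> ->; rewrite lexx.
- by move=> -> ->; rewrite lexx cd.
- by move=> -> /andP [/ltW -> /ltW ->]; rewrite lexx ab.
- by move=> -> /andP [/ltW -> /ltW ->]; rewrite lexx ab.
Qed.

(** Conformal invariance of the module, for a quadrilateral whose closure omits a point. *)
Lemma module_unique (Q : quadrilateral R) (p : plane R) (m1 m2 : R) :
  (forall (a b c d : R) F z, quad_conformal_mapping a b c d Q F -> inbox a b c d z ->
    F z <> Some p) ->
  is_conformal_module Q m1 -> is_conformal_module Q m2 -> m1 = m2.
Proof.
move=> avoid [a1 [b1 [c1 [d1 [ab1 cd1 [F1 Q1] ->]]]]] [a2 [b2 [c2 [d2 [ab2 cd2 [F2 Q2] ->]]]]].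
have [_ _ _ O1 _ R1 V1] := Q1; have [_ _ _ O2 _ R2 V2] := Q2.
have ab1' := ltW ab1; have cd1' := ltW cd1; have ab2' := ltW ab2; have cd2' := ltW cd2.
pose f z := coord p (F1 (clamp a1 b1 c1 d1 z)).
pose g z := coord p (F2 (clamp a2 b2 c2 d2 z)).
have cont (a b c d : R) F : a <= b -> c <= d -> quad_conformal_mapping a b c d Q F ->
    continuous (fun z => coord p (F (clamp a b c d z))).
  move=> ab cd QF; apply: plane_continuous => z.
  have [CF _ _ _ _ _ _] := QF.
  have av := avoid _ _ _ _ _ _ QF (@clamp_inbox R a b c d z ab cd).
  exact: (continuous_comp (clamp_comp_continuous ab cd CF (x := z)) (coord_continuous av)).
have deriv (a b c d : R) F : quad_conformal_mapping a b c d Q F ->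
    forall z, inside a b c d z -> derivable (fun z => coord p (F (clamp a b c d z))) z 1.
  move=> QF z iz; have [_ _ HF _ _ _ _] := QF.
  apply: (@derivable_near_eq _ (fun z => coord p (F z))).
    by have := inside_open iz; apply: filterS => v /inside_inbox iv; rewrite clamp_id.
  apply: coord_derivable; first by apply: HF; apply/box_insideP.
  exact: avoid QF (inside_inbox iz).
have inj (a b c d : R) F : quad_conformal_mapping a b c d Q F ->
    forall z w, inbox a b c d z -> inbox a b c d w ->
      coord p (F (clamp a b c d z)) = coord p (F (clamp a b c d w)) -> z = w.
  move=> QF z w hz hw; rewrite !clamp_id // => /coord_inj E.
  have [_ IF _ _ _ _ _] := QF.
  apply: IF; rewrite ?inE; [exact/boxP|exact/boxP|].
  by apply: E; exact: avoid QF _.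
have transfer z q : inbox a1 b1 c1 d1 z -> inbox a2 b2 c2 d2 q -> F2 q = F1 z -> g q = f z.
  by move=> hz hq E; rewrite /g /f !clamp_id // E.
have ibot x : a1 <= x <= b1 -> inbox a1 b1 c1 d1 (x +i* c1).
  by move=> hx; rewrite /inbox /= hx lexx.
have itop x : a1 <= x <= b1 -> inbox a1 b1 c1 d1 (x +i* d1).
  by move=> hx; rewrite /inbox /= hx lexx cd1'.
have ileft y : c1 < y < d1 -> inbox a1 b1 c1 d1 (a1 +i* y).
  by move=> /andP [y1 y2]; rewrite /inbox /= lexx ab1' !ltW.
have iright y : c1 < y < d1 -> inbox a1 b1 c1 d1 (b1 +i* y).
  by move=> /andP [y1 y2]; rewrite /inbox /= lexx ab1' !ltW.
have hor (k1 k2 : R) : F1 @` box `[a1, b1] [set k1] = F2 @` box `[a2, b2] [set k2] ->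
    (k2 = c2 \/ k2 = d2) -> (k1 = c1 \/ k1 = d1) ->
    forall x, a1 <= x <= b1 -> exists q, [/\ inbox a2 b2 c2 d2 q, Im q = k2 & g q = f (x +i* k1)].
  move=> E hk2 hk1 x hx.
  have : (F1 @` box `[a1, b1] [set k1]) (F1 (x +i* k1)).
    by exists (x +i* k1) => //; exists x; [rewrite /= in_itv|exists k1].
  rewrite E => -[_ [x' hx' [y' /= ey <-]] EF]; subst y'.
  rewrite /= in_itv /= in hx'.
  have bq : inbox a2 b2 c2 d2 (x' +i* k2).
    by rewrite /inbox /= hx'; case: hk2 => ->; rewrite lexx ?andbT.
  exists (x' +i* k2); split => //; apply: transfer => //.
  by case: hk1 => ->; [exact: ibot|exact: itop].
have ver (k1 k2 : R) : F1 @` box [set k1] `]c1, d1[ = F2 @` box [set k2] `]c2, d2[ ->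
    (k2 = a2 \/ k2 = b2) -> (k1 = a1 \/ k1 = b1) ->
    forall y, c1 < y < d1 -> exists q, [/\ inbox a2 b2 c2 d2 q, Re q = k2 & g q = f (k1 +i* y)].
  move=> E hk2 hk1 y hy.
  have : (F1 @` box [set k1] `]c1, d1[) (F1 (k1 +i* y)).
    by exists (k1 +i* y) => //; exists k1 => //; exists y; rewrite /= ?in_itv.
  rewrite E => -[_ [x' /= ex [y' hy' <-]] EF]; subst x'.
  move: hy'; rewrite /= in_itv /= => /andP [/ltW h1 /ltW h2].
  have bq : inbox a2 b2 c2 d2 (k2 +i* y').
    by rewrite /inbox /= h1 h2; case: hk2 => ->; rewrite lexx ?andbT.
  exists (k2 +i* y'); split => //; apply: transfer => //.
  by case: hk1 => ->; [exact: ileft|exact: iright].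
have key (k1 k2 m1 m2 : R) := @rectangle_rigidity R f g a1 b1 c1 d1 a2 b2 c2 d2 k1 k2 m1 m2 ab1 cd1
  (cont _ _ _ _ _ ab1' cd1' Q1) (cont _ _ _ _ _ ab2' cd2' Q2)
  (deriv _ _ _ _ _ Q1) (deriv _ _ _ _ _ Q2)
  (inj _ _ _ _ _ Q1) (inj _ _ _ _ _ Q2).
have eq_ratio : (d2 - c2) * (b1 - a1) = (b2 - a2) * (d1 - c1) ->
    (d1 - c1) / (b1 - a1) = (d2 - c2) / (b2 - a2).
  move=> E; have n1 : b1 - a1 != 0 by rewrite subr_eq0 gt_eqF.
  have n2 : b2 - a2 != 0 by rewrite subr_eq0 gt_eqF.
  by apply/eqP; rewrite eqr_div // E mulrC.
have p1 : 0 < (d2 - c2) * (b1 - a1) by rewrite mulr_gt0 // subr_gt0.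
have p2 : 0 < (b2 - a2) * (d1 - c1) by rewrite mulr_gt0 // subr_gt0.
have Hbox z : inbox a1 b1 c1 d1 z -> exists2 q, inbox a2 b2 c2 d2 q & g q = f z.
  move=> hz; have [q hq E] := quad_map_surj ab2' cd2' Q2 (quad_map_box Q1 hz).
  by exists q => //; exact: transfer.
have Hin z : inside a1 b1 c1 d1 z -> exists2 q, inside a2 b2 c2 d2 q & g q = f z.
  move=> hz.
  have : (F1 @` box `]a1, b1[ `]c1, d1[) (F1 z) by exists z => //; exact/box_insideP.
  rewrite O1 -O2 => -[q /box_insideP hq E].
  by exists q => //; apply: transfer => //; exact: inside_inbox.
have {}key (k1 k2 n1 n2 : R) := key k1 k2 n1 n2 Hbox Hin.
have ER : [set F1 @` box `[a1, b1] [set c1]; F1 @` box `[a1, b1] [set d1]] =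
  [set F2 @` box `[a2, b2] [set c2]; F2 @` box `[a2, b2] [set d2]] by rewrite R1 R2.
have EV : [set F1 @` box [set a1] `]c1, d1[; F1 @` box [set b1] `]c1, d1[] =
  [set F2 @` box [set a2] `]c2, d2[; F2 @` box [set b2] `]c2, d2[] by rewrite V1 V2.
by case: (pair_eq ER) => -[e1 e2]; case: (pair_eq EV) => -[e3 e4];
  have := key _ _ _ _ (hor _ _ e1 ltac:(auto) ltac:(auto)) (hor _ _ e2 ltac:(auto) ltac:(auto))
    (ver _ _ e3 ltac:(auto) ltac:(auto)) (ver _ _ e4 ltac:(auto) ltac:(auto)) => E;
  try (apply: eq_ratio; lra); exfalso; lra.
Qed.

(** The point [- beta] is inside the annular rectangle, hence off the closed exterior. *)
Lemma annular_exterior_avoids (beta gamma : R) (a b c d : R) F z :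
  1 < beta -> 0 < gamma -> gamma < pi ->
  quad_conformal_mapping a b c d (annular_exterior beta gamma) F -> inbox a b c d z ->
  F z <> Some ((- beta) +i* 0).
Proof.
move=> b1 g0 gpi QF hz Fz.
have b2 : beta < beta ^+ 2 by rewrite expr2 ltr_pMr //; lra.
have bc : cabs ((- beta) +i* 0 : plane R) = beta by rewrite cabs_real normrN ger0_norm //; lra.
have radial (u : R) : 0 < sin gamma -> (u = gamma \/ u = - gamma) ->
    (@to_sphere R @` polar_region `[1, beta ^+ 2] [set u]) (Some ((- beta) +i* 0)) -> False.
  move=> s0 hu [_ [r hr [t /= et <-]] [_ es]]; move: hr; rewrite /= in_itv /= => /andP [r1 r2].
  have r0 : r != 0 by apply/eqP; lra.
  move/eqP: es; rewrite et mulf_eq0 (negbTE r0) /=.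
  by case: hu => ->; rewrite ?sinN ?oppr_eq0 => /eqP; lra.
have s0 : 0 < sin gamma by apply: sin_gt0_pi; lra.
have circ (u : R) I : 0 <= u -> u <> beta ->
    (@to_sphere R @` polar_region [set u] I) (Some ((- beta) +i* 0)) -> False.
  move=> u0 ub [_ [v /= ev [t _ <-]] [e1 e2]]; apply: ub; rewrite ev in e1 e2.
  by rewrite -(cabs_polar t u0) -bc /polar e1 e2.
have := quad_map_box QF hz; rewrite Fz.
case=> [|[[E [|] -> HE]|[E [|] -> HE]]].
- apply; exists ((- beta) +i* 0) => //; apply/closure_annular => //; split.
    by rewrite bc; lra.
  rewrite /sector bc /=; have := @cos_geN1 R gamma => h; apply/negP; rewrite -leNgt; nra.
- exact: (radial _ s0 (or_introl erefl) HE).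
- exact: (radial _ s0 (or_intror erefl) HE).
- have n1 : (1 : R) <> beta by move=> e1; rewrite -e1 ltxx in b1.
  exact: (circ _ _ ler01 n1 HE).
- have n2 : beta ^+ 2 <> beta by move=> e1; rewrite e1 ltxx in b2.
  exact: (circ _ _ (sqr_ge0 _) n2 HE).
Qed.

End ModuleUnique.

(** * The reflection principle *)

Section Reflection.
Context {R : realType}.
Implicit Types (z w : plane R) (b beta : R).

(** Reflection in the circle of radius [beta] about the origin, which goes to infinity. *)
Definition circle_inv beta w : sphere R :=
  if w == 0 then None else Some ((beta ^+ 2 +i* 0) * (w^*)%C^-1).

(** Reflection in the line of real part [b]. *)
Definition mirror b z : plane R := (2 * b - Re z) +i* Im z.

(** The extension of [h] across the line of real part [b] by reflection. *)
Definition glue beta b (h : plane R -> plane R) z : sphere R :=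
  if Re z <= b then Some (h z) else circle_inv beta (h (mirror b z)).

Lemma mirrorK b : involutive (mirror b).
Proof. by move=> z; apply: complex_ext => //=; lra. Qed.

Lemma mirror_id b z : Re z = b -> mirror b z = z.
Proof. by move=> h; apply: complex_ext => //=; lra. Qed.

Lemma mirrorB b z w : mirror b z - mirror b w = - ((z - w)^*)%C.
Proof. by case: z w => x y [x' y']; apply: complex_ext => /=; ring. Qed.

Lemma mirror_cont b : continuous (mirror b).
Proof.
apply: plane_continuous => z; apply/continuousP => e e0; exists e => // w.
by rewrite mirrorB cabsN cabsJ.
Qed.

Lemma mirror_deriv b (f : plane R -> plane R) z l : has_deriv f (mirror b z) l ->
  has_deriv (fun z => (f (mirror b z))^*%C) z (- l^*%C).
Proof.
have conjE (u v k x : plane R) : (u - v - k * - x^*%C)^*%C = u^*%C - v^*%C - - k^*%C * x :> R[i].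
  by case: u v k x => [u1 u2] [v1 v2] [k1 k2] [x1 x2]; apply: complex_ext => /=; ring.
move=> H e e0; have [d d0 Hd] := H e e0; exists d => // w hw.
have := Hd (mirror b w); rewrite mirrorB cabsN cabsJ => /(_ hw).
rewrite -[X in X <= _ -> _]cabsJ; congr (_ <= _); congr cabs.
exact: conjE.
Qed.

Lemma circle_inv_inj beta z w : beta != 0 -> circle_inv beta z = circle_inv beta w -> z = w.
Proof.
move=> b0; rewrite /circle_inv; case: eqVneq => [->|z0]; case: eqVneq => [->|w0] // [].
have n0 : (beta ^+ 2 +i* 0 : plane R) != 0.
  by rewrite -cabs_gt0 cabs_real normr_gt0 expf_neq0.
by move=> /(mulfI n0) /invr_inj /(inv_inj (@conjcK R)).
Qed.

Lemma circle_inv_fixed beta w : 0 < beta -> cabs w = beta -> circle_inv beta w = Some w.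
Proof.
move=> b0 wb; have w0 : w != 0 by rewrite -cabs_gt0 wb.
rewrite /circle_inv (negbTE w0); congr Some.
have cw0 : (w^*)%C != 0 by rewrite conjc_eq0.
apply: (mulIf cw0); rewrite mulfVK //.
rewrite -wb cabs_sqr; case: (w) => x y; apply: complex_ext => /=; ring.
Qed.

Lemma circle_inv_polar beta r t : 0 < r ->
  circle_inv beta (polar r t) = Some (polar (beta ^+ 2 / r) t).
Proof.
move=> r0; have p0 : polar r t != 0 by rewrite -cabs_gt0 cabs_polar // ltW.
rewrite /circle_inv (negbTE p0); congr Some.
have cw0 : ((polar r t)^*)%C != 0 by rewrite conjc_eq0.
apply: (mulIf cw0); rewrite mulfVK //.
have E : beta ^+ 2 / r * r = beta ^+ 2 by rewrite divfK // gt_eqF.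
apply: complex_ext; rewrite ?ReM ?ImM /=; last by ring.
have -> : beta ^+ 2 / r * cos t * (r * cos t) - beta ^+ 2 / r * sin t * - (r * sin t) =
  (beta ^+ 2 / r * r) * (cos t ^+ 2 + sin t ^+ 2) by ring.
by rewrite E cos2Dsin2 mulr1.
Qed.

Lemma circle_inv_continuous beta w : 0 < beta -> {for w, continuous (circle_inv beta)}.
Proof.
move=> b0; have [->|w0] := eqVneq w 0.
  move=> U; rewrite {1}/circle_inv eqxx => /nbhs_infinityP [U0 [M M0 HM]].
  apply/plane_nbhsP; exists (beta ^+ 2 / M); first by rewrite divr_gt0 // exprn_gt0.
  move=> v; rewrite subr0 ltr_pdivlMr // => hv; rewrite /= /circle_inv; case: eqVneq => // v0.
  apply: HM; rewrite cabsM cabsV cabsJ cabs_real ger0_norm ?sqr_ge0 //.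
  by rewrite ltr_pdivlMr ?cabs_gt0 // mulrC.
have cg : {for w, continuous (fun v : plane R => (beta ^+ 2 +i* 0) * (v^*)%C^-1 : plane R)}.
  apply: plane_contM; first exact: plane_cont_cst.
  by apply: plane_contV; [rewrite conjc_eq0|exact: conj_continuous].
move=> U; rewrite {1}/circle_inv (negbTE w0) => hU.
have h1 : \forall v \near w, U (Some ((beta ^+ 2 +i* 0) * (v^*)%C^-1)) := cg _ hU.
have h2 : \forall v \near w, v != 0.
  apply/plane_nbhsP; exists (cabs w); first by rewrite cabs_gt0.
  by move=> v hv; apply: contraTneq hv => ->; rewrite sub0r cabsN ltxx.
by apply: filterS2 h1 h2 => v Uv v0; rewrite /= /circle_inv (negbTE v0).
Qed.

Lemma Re_lt_near b z : Re z < b -> \forall w \near z, Re w < b.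
Proof.
move=> zb; apply/plane_nbhsP; exists (b - Re z); first lra.
by move=> w hw; have := le_lt_trans (Re_le_cabs _) hw; rewrite ReB ltr_norml; lra.
Qed.

Lemma Re_gt_near b z : b < Re z -> \forall w \near z, b < Re w.
Proof.
move=> zb; apply/plane_nbhsP; exists (Re z - b); first lra.
by move=> w hw; have := le_lt_trans (Re_le_cabs _) hw; rewrite ReB ltr_norml; lra.
Qed.

Section Glue.
Context (beta b : R) (h : plane R -> plane R).
Context (beta0 : 0 < beta) (ch : continuous h).
Context (seam : forall z, Re z = b -> cabs (h z) = beta).

Lemma glue_ge z : b <= Re z -> glue beta b h z = circle_inv beta (h (mirror b z)).
Proof.
rewrite /glue le_eqVlt => /orP [/eqP zb|zb]; last by rewrite leNgt zb.
by rewrite -zb lexx mirror_id // circle_inv_fixed // seam.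
Qed.

Lemma glue_le z : Re z <= b -> glue beta b h z = Some (h z).
Proof. by rewrite /glue => ->. Qed.

Lemma glue_continuous z : {for z, continuous (glue beta b h)}.
Proof.
have c1 (w : plane R) (U : set (sphere R)) : nbhs (Some (h w) : sphere R) U ->
    \forall v \near w, U (Some (h v)).
  exact: (@ch w).
have c2 (w : plane R) (U : set (sphere R)) : nbhs (circle_inv beta (h (mirror b w))) U ->
    \forall v \near w, U (circle_inv beta (h (mirror b v))).
  move=> hU.
  have h1 : \forall u \near h (mirror b w), U (circle_inv beta u) := circle_inv_continuous beta0 hU.
  have h2 : \forall u \near mirror b w, U (circle_inv beta (h u)) := @ch _ _ h1.
  exact: (@mirror_cont b w _ h2).
move=> U; case: (ltgtP (Re z) b) => zb.
- rewrite glue_le ?(ltW zb) // => /c1 h1.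
  by apply: filterS2 h1 (Re_lt_near zb) => v Uv vb; rewrite /= glue_le // ltW.
- rewrite glue_ge ?(ltW zb) // => /c2 h1.
  by apply: filterS2 h1 (Re_gt_near zb) => v Uv vb; rewrite /= glue_ge // ltW.
- move=> hU.
  have h1 : \forall v \near z, U (Some (h v)) by apply: c1; rewrite -glue_le ?zb.
  have h2 : \forall v \near z, U (circle_inv beta (h (mirror b v))).
    by apply: c2; rewrite -glue_ge ?zb.
  apply: filterS2 h1 h2 => v U1 U2; rewrite /=.
  by case: (leP (Re v) b) => vb; [rewrite glue_le|rewrite glue_ge // ltW].
Qed.

Lemma finite_chart_continuous (s : sphere R) : s <> None -> {for s, continuous (@finite_chart R)}.
Proof. by case: s => // w _ A. Qed.

(** The Schwarz reflection principle for a map that sends a segment of the line of real part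
    [b] into the circle of radius [beta]. *)
Lemma glue_holomorphic (a c d : R) z : a < b ->
  (forall z, inside a b c d z -> derivable h z 1) ->
  inside a (2 * b - a) c d z -> holomorphic_at (glue beta b h) z.
Proof.
move=> ab dh iz; split; first exact: glue_continuous.
have side v : inside a (2 * b - a) c d v -> b < Re v -> inside a b c d (mirror b v).
  by move=> /andP [/andP [? ?] ?]; rewrite /inside /= => ?; apply/andP; split => //; lra.
have left v : inside a (2 * b - a) c d v -> Re v < b -> inside a b c d v.
  by move=> /andP [/andP [? ?] ?] ?; apply/andP; split => //; lra.
have dl v : inside a (2 * b - a) c d v -> Re v < b ->
    derivable (fun w => finite_chart (glue beta b h w)) v 1.
  move=> iv vb; apply: (@derivable_near_eq _ h); last by apply: dh; exact: left.
  by have := Re_lt_near vb; apply: filterS => w /ltW wb; rewrite glue_le.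
have dm v : inside a (2 * b - a) c d v -> b < Re v ->
    derivable (fun w : plane R => (h (mirror b w))^*%C : plane R) v 1.
  move=> iv vb; have /derivableP [l hl] := dh _ (side v iv vb).
  exact: has_deriv_derivable (mirror_deriv hl).
have dr v : inside a (2 * b - a) c d v -> b < Re v -> h (mirror b v) != 0 ->
    derivable (fun w => finite_chart (glue beta b h w)) v 1.
  move=> iv vb h0.
  apply: (@derivable_near_eq _ (fun w => (beta ^+ 2 +i* 0) * ((h (mirror b w))^*%C)^-1 : plane R)).
    have n0 : \forall w \near v, h (mirror b w) != 0.
      have h1 : \forall u \near h (mirror b v), u != 0.
        apply/plane_nbhsP; exists (cabs (h (mirror b v))); first by rewrite cabs_gt0.
        by move=> u hu; apply: contraTneq hu => ->; rewrite sub0r cabsN ltxx.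
      have h2 : \forall u \near mirror b v, h u != 0 := @ch _ _ h1.
      exact: (@mirror_cont b v _ h2).
    apply: filterS2 n0 (Re_gt_near vb) => w w0 /ltW wb.
    by rewrite glue_ge // /circle_inv (negbTE w0).
  have hV := @plane_derV R (fun w => (h (mirror b w))^*%C) v _ (dm v iv vb).
  apply: (plane_derM (@plane_der_cst R _ v)); apply: hV.
  by rewrite conjc_eq0.
case: (ltgtP (Re z) b) => zb.
- by rewrite glue_le ?(ltW zb) //; exact: dl.
- rewrite glue_ge ?(ltW zb) //; have [E|E] := eqVneq (h (mirror b z)) 0; last first.
    by rewrite /circle_inv (negbTE E); exact: dr.
  rewrite /circle_inv E eqxx.
  apply: (@derivable_near_eq _ (fun w => (beta ^+ 2 +i* 0)^-1 * (h (mirror b w))^*%C : plane R)).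
    have := Re_gt_near zb; apply: filterS => w /ltW wb.
    rewrite glue_ge // /circle_inv; case: eqVneq => [->|w0].
      by rewrite conjc0 mulr0.
    by rewrite /infinity_chart invfM invrK.
  exact: (plane_derM (@plane_der_cst R _ z) (dm z iz zb)).
- rewrite glue_le ?zb //.
  (* On a small rectangle around [z] the map omits infinity, and [painleve] applies. *)
  have n0 : \forall w \near z, glue beta b h w <> None.
    by apply: (some_near (w := h z) (glue_continuous (z := z))); rewrite glue_le // zb.
  have /plane_nbhsP [r r0 Hr] := n0.
  have /plane_nbhsP [t t0 Ht] := inside_open iz.
  pose u := Num.min r t / 4.
  have m0 : 0 < Num.min r t by rewrite lt_min r0.
  have u0 : 0 < u by rewrite /u; lra.
  have [us ut] : 2 * u < r /\ 2 * u < t.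
    apply/andP; rewrite -lt_min /u; lra.
  pose cl := clamp (Re z - u) (Re z + u) (Im z - u) (Im z + u).
  have near w : inbox (Re z - u) (Re z + u) (Im z - u) (Im z + u) w -> cabs (w - z) <= 2 * u.
    move=> /andP [wx wy]; apply: le_trans (cabs_le _) _; rewrite ReB ImB.
    have : `|Re w - Re z| <= u by rewrite ler_norml; lra.
    have : `|Im w - Im z| <= u by rewrite ler_norml; lra.
    lra.
  pose g w := finite_chart (glue beta b h (cl w)).
  have icl w : inbox (Re z - u) (Re z + u) (Im z - u) (Im z + u) (cl w).
    by apply: clamp_inbox; lra.
  have cg : continuous g.
    apply: plane_continuous => w.
    have fin : glue beta b h (cl w) <> None.
      by apply: Hr; apply: le_lt_trans us; exact: near.
    have h1 := continuous_comp (@clamp_continuous R _ _ _ _ w) (glue_continuous (z := cl w)).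
    exact: (continuous_comp h1 (finite_chart_continuous fin)).
  have iz' : inside (Re z - u) (Re z + u) (Im z - u) (Im z + u) z.
    by rewrite /inside; lra.
  have gE w : inside (Re z - u) (Re z + u) (Im z - u) (Im z + u) w ->
      \forall v \near w, g v = finite_chart (glue beta b h v).
    move=> iw; have := inside_open iw; apply: filterS => v /inside_inbox iv.
    by rewrite /g /cl clamp_id.
  apply: derivable_near_eq (gE z iz') _.
  apply: (painleve (s := [:: b]) cg _ iz') => w iw; rewrite inE => wb.
  have wn := le_lt_trans (near w (inside_inbox iw)).
  have iw' : inside a (2 * b - a) c d w by apply: Ht; exact: wn.
  apply: (@derivable_near_eq _ (fun v => finite_chart (glue beta b h v))).
    by have := gE w iw; apply: filterS => v ->.
  move: wb; rewrite neq_lt => /orP [wb|wb]; first exact: dl.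
  apply: dr => //; apply: contraPneq (Hr w (wn _ us)) => E; apply/contrapT => nE; apply: nE.
  by rewrite glue_ge ?(ltW wb) // /circle_inv E eqxx.
Qed.

End Glue.

End Reflection.

(** * Doubling the gear domain *)

Section Gear.
Context {R : realType}.
Implicit Types (z w : plane R) (h : plane R -> plane R).

(** A conformal map onto the gear domain, with values in the plane and normalised on the
    boundary: the bottom side is mapped onto the radial edge of argument [t] and the right
    side onto the outer arc. *)
Record gear_map (beta gamma t a b c d : R) (f : plane R -> plane R) : Prop := {
  gear_continuous : continuous f;
  gear_injective : forall z w, inbox a b c d z -> inbox a b c d w -> f z = f w -> z = w;
  gear_derivable : forall z, inside a b c d z -> derivable f z 1;
  gear_onto : f @` box `]a, b[ `]c, d[ = gear_domain beta gamma;
  gear_bottom : f @` box `[a, b] [set c] = polar_region `[1, beta] [set t];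
  gear_top : f @` box `[a, b] [set d] = polar_region `[1, beta] [set - t];
  gear_left : f @` box [set a] `]c, d[ = polar_region [set 1] `]gamma, 2 * pi - gamma[;
  gear_right : f @` box [set b] `]c, d[ = polar_region [set beta] `]- gamma, gamma[ }.

(** Equality of images in the sphere descends to the plane. *)
Lemma some_image (f : plane R -> plane R) (F : plane R -> sphere R) (B P : set (plane R)) :
  (forall z, B z -> F z = Some (f z)) -> F @` B = @to_sphere R @` P -> f @` B = P.
Proof.
move=> E H; apply/seteqP; split=> [_ [z Bz <-]|w Pw].
  have : (F @` B) (F z) by exists z.
  by rewrite H E // => -[w Pw [<-]].
have : (@to_sphere R @` P) (Some w) by exists w.
by rewrite -H => -[z Bz]; rewrite E // => -[zw]; exists z.
Qed.

(** A conformal map onto the gear domain takes finite values up to the boundary. *)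
Lemma gear_unpack (beta gamma a b c d : R) (F : plane R -> sphere R) : a <= b -> c <= d ->
  quad_conformal_mapping a b c d (gear_quadrilateral beta gamma) F ->
  exists2 f, [/\ continuous f,
      forall z w, inbox a b c d z -> inbox a b c d w -> f z = f w -> z = w &
    forall z, inside a b c d z -> derivable f z 1] &
    forall z, inbox a b c d z -> F z = Some (f z).
Proof.
move=> ab cd QF; have [CF IF HF _ _ _ _] := QF.
have fin z : inbox a b c d z -> F z <> None.
  move=> /(quad_map_box QF) [[w _ <-] //|[[E [|] -> [w _ <-]]|[E [|] -> [w _ <-]]]] //.
have fE z : inbox a b c d z -> F z = Some (finite_chart (F (clamp a b c d z))).
  by move=> hz; rewrite clamp_id //; have := fin z hz; case: (F z).
exists (fun z => finite_chart (F (clamp a b c d z))); last exact: fE.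
split.
- apply: plane_continuous => z.
  have fz := fin _ (@clamp_inbox R a b c d z ab cd).
  exact: (continuous_comp (clamp_comp_continuous ab cd CF (x := z)) (finite_chart_continuous fz)).
- move=> z w hz hw E; apply: IF; rewrite ?inE; [exact/boxP|exact/boxP|].
  by rewrite fE // E -fE.
- move=> z iz.
  apply: (@derivable_near_eq _ (fun z => finite_chart (F z))).
    by have := inside_open iz; apply: filterS => v /inside_inbox iv; rewrite clamp_id.
  have [_] := HF z ltac:(exact/box_insideP).
  by rewrite fE //; exact: inside_inbox.
Qed.

(** The half turn [z |-> (p + i q) - z] permutes rectangles. *)
Lemma rotation_image (f : plane R -> plane R) (I J I' J' : set R) (p q : R) :
  (forall x, I x <-> I' (p - x)) -> (forall y, J y <-> J' (q - y)) ->
  (fun z => f ((p +i* q) - z)) @` box I J = f @` box I' J'.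
Proof.
move=> hI hJ; apply/seteqP; split=> _ [_ [x hx [y hy <-]] <-].
  exists ((p - x) +i* (q - y)) => //; exists (p - x); first exact/hI.
  by exists (q - y) => //; exact/hJ.
exists ((p - x) +i* (q - y)); first (exists (p - x); [by apply/hI; rewrite subKr|]).
  by exists (q - y) => //; apply/hJ; rewrite subKr.
by congr f; apply: complex_ext => /=; rewrite subKr.
Qed.

Lemma gear_map_exists (beta gamma a b c d : R) (F : plane R -> sphere R) : a <= b -> c <= d ->
  quad_conformal_mapping a b c d (gear_quadrilateral beta gamma) F ->
  exists t f, (t = gamma \/ t = - gamma) /\ gear_map beta gamma t a b c d f.
Proof.
move=> ab cd QF; have [f [cf inj df] fE] := gear_unpack ab cd QF.
have [_ _ _ OF _ RF VF] := QF.
have img (B P : set (plane R)) : (forall z, B z -> inbox a b c d z) ->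
    F @` B = @to_sphere R @` P -> f @` B = P.
  by move=> HB; apply: some_image => z /HB; exact: fE.
have iO : f @` box `]a, b[ `]c, d[ = gear_domain beta gamma.
  by apply: img OF => z /box_insideP /inside_inbox.
have hB z : box `[a, b] [set c] z -> inbox a b c d z.
  by move=> [x /=]; rewrite in_itv /= => hx [y /= -> <-]; rewrite /inbox /= hx lexx.
have hT z : box `[a, b] [set d] z -> inbox a b c d z.
  by move=> [x /=]; rewrite in_itv /= => hx [y /= -> <-]; rewrite /inbox /= hx lexx cd.
have hL z : box [set a] `]c, d[ z -> inbox a b c d z.
  move=> [x /= -> [y /=]]; rewrite in_itv /= => /andP [/ltW h1 /ltW h2] <-.
  by rewrite /inbox /= h1 h2 lexx ab.
have hR z : box [set b] `]c, d[ z -> inbox a b c d z.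
  move=> [x /= -> [y /=]]; rewrite in_itv /= => /andP [/ltW h1 /ltW h2] <-.
  by rewrite /inbox /= h1 h2 lexx ab.
have [t [tg iB iT]] : exists t, [/\ t = gamma \/ t = - gamma,
    f @` box `[a, b] [set c] = polar_region `[1, beta] [set t] &
    f @` box `[a, b] [set d] = polar_region `[1, beta] [set - t]].
  case: (pair_eq RF) => -[e1 e2].
    by exists gamma; split; [left|exact: img hB e1|exact: img hT e2].
  exists (- gamma); split; [by right|exact: img hB e1|].
  by rewrite opprK; exact: img hT e2.
case: (pair_eq VF) => -[e1 e2].
  by exists t, f; split => //; split => //; [exact: img hL e1|exact: img hR e2].
(* The outer arc is the image of the left side: rotate the rectangle by a half turn. *)
pose rho z : plane R := ((a + b) +i* (c + d)) - z.
have rd z : has_deriv rho z (-1).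
  move=> e e0; exists 1 => // w _; rewrite /rho.
  rewrite (_ : _ - _ = 0) ?cabs0 ?mulr_ge0 ?cabs_ge0 ?(ltW e0) //.
  by move: (_ +i* _) => k; ring.
have crho : continuous rho.
  by apply: plane_continuous => z; exact/derivable_cont/has_deriv_derivable/rd.
have rbox z : inbox a b c d z -> inbox a b c d (rho z).
  by move=> /andP [hx hy]; rewrite /inbox ReB ImB /=; apply/andP; split; lra.
have rin z : inside a b c d z -> inside a b c d (rho z).
  by move=> /andP [hx hy]; rewrite /inside ReB ImB /=; apply/andP; split; lra.
exists (- t), (fun z => f (rho z)); split; first by case: tg => ->; rewrite ?opprK; auto.
split.
- by apply: plane_continuous => z; exact: (continuous_comp (crho z) (cf (rho z))).
- move=> z w hz hw /inj E; have := E (rbox z hz) (rbox w hw).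
  by move=> /(addrI _) /oppr_inj.
- move=> z iz; apply: derivable_comp; first exact/df/rin.
  exact: has_deriv_derivable (rd z).
- rewrite -iO; apply: rotation_image => x; rewrite /= !in_itv /=; split; lra.
- rewrite -iT; apply: rotation_image => x; rewrite /= ?in_itv /=; split; lra.
- rewrite opprK -iB; apply: rotation_image => x; rewrite /= ?in_itv /=; split; lra.
- rewrite -(img _ _ hR e2); apply: rotation_image => x; rewrite /= ?in_itv /=; split; lra.
- rewrite -(img _ _ hL e1); apply: rotation_image => x; rewrite /= ?in_itv /=; split; lra.
Qed.

(** The image of the open doubled rectangle: the left half gives the gear domain, the seam
    the outer arc, and the right half the reflection of the gear domain. *)
Lemma glue_onto_exterior (beta gamma a b c d : R) h (F : plane R -> sphere R) :
  1 < beta -> 0 < gamma -> gamma < pi -> a < b ->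
  (forall z, Re z <= b -> F z = Some (h z)) ->
  (forall z, b <= Re z -> F z = circle_inv beta (h (mirror b z))) ->
  (forall z, inside a b c d z -> gear_domain beta gamma (h z)) ->
  (forall w, gear_domain beta gamma w -> exists2 z, inside a b c d z & h z = w) ->
  (forall y, c < y < d ->
    exists2 s, (`]- gamma, gamma[%classic : set R) s & h (b +i* y) = polar beta s) ->
  (forall s, (`]- gamma, gamma[%classic : set R) s ->
    exists2 y, c < y < d & h (b +i* y) = polar beta s) ->
  F @` box `]a, (2 * b - a)[ `]c, d[ = quad_domain (annular_exterior beta gamma).
Proof.
move=> b1 g0 gpi ab FL FR inO outO rig rig'.
have bt0 : 0 < beta by lra.
have bn0 : beta != 0 by rewrite gt_eqF.
have b2 : beta < beta ^+ 2 by rewrite expr2 ltr_pMr //; lra.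
have b20 : 0 < beta ^+ 2 by lra.
have gP w := @gear_domainP R beta gamma w g0 gpi bt0.
have clP w := @closure_annular R beta gamma w b1 g0 gpi.
apply/seteqP; split.
  move=> _ [z /box_insideP iz <-] [w /clP [/andP [w1 w2] ws] /esym].
  have [/andP [x1 x2] y12] := andP iz.
  case: (ltgtP (Re z) b) => zb.
  + have /inO/gP gz : inside a b c d z by rewrite /inside x1 zb.
    rewrite FL ?(ltW zb) // => -[E]; rewrite E in gz.
    by case: gz => [|[]] //; lra.
  + have /inO/gP gz : inside a b c d (mirror b z).
      by rewrite /inside /= y12 andbT; lra.
    rewrite FR ?(ltW zb) // /circle_inv; case: eqVneq => // h0 [E].
    case: gz => [gz|[_ gz]]; last by apply: ws; rewrite -E; exact/sector_inv.
    move: w2; rewrite -E cabsM cabsV cabsJ cabs_real ger0_norm ?sqr_ge0 //.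
    rewrite ler_pdivrMr ?cabs_gt0 //.
    have := cabs_gt0 (h (mirror b z)); rewrite h0 => ? ?; nra.
  + rewrite FL ?zb // => -[E].
    have [s hs Es] := rig (Im z) y12.
    by apply: ws; rewrite -E (complex_eta z) zb Es; apply: sector_polar.
move=> s hs.
have inner w : cabs w < beta -> cabs w < 1 \/ sector gamma w ->
    exists2 z, inside a (2 * b - a) c d z & F z = Some w.
  move=> wb hw; have [|z /andP [/andP [h1 h2] h3] <-] := outO w.
    by apply/gP; case: hw; auto.
  exists z; last by rewrite FL // ltW.
  by rewrite /inside h3 h1 andbT; lra.
have outer w : cabs w < beta -> cabs w < 1 \/ sector gamma w ->
    exists2 z, inside a (2 * b - a) c d z & F z = circle_inv beta w.
  move=> wb hw; have [|z /andP [/andP [h1 h2] h3] <-] := outO w.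
    by apply/gP; case: hw; auto.
  exists (mirror b z); last by rewrite FR ?mirrorK //=; lra.
  by rewrite /inside /= h3 andbT; lra.
suff [z iz <-] : exists2 z, inside a (2 * b - a) c d z & F z = s.
  by exists z => //; exact/box_insideP.
case: s hs => [w|] hs; last first.
  have [||z iz Ez] := outer 0; rewrite ?cabs0 //; first by left.
  by exists z => //; rewrite Ez /circle_inv eqxx.
have hw : cabs w < 1 \/ beta ^+ 2 < cabs w \/ sector gamma w.
  apply: contrapT => /not_orP [n1 /not_orP [n2 n3]]; apply: hs; exists w => //.
  apply/clP; split => //; apply/andP; split; rewrite leNgt; exact/negP.
have dual : beta < cabs w -> beta ^+ 2 < cabs w \/ sector gamma w ->
    exists2 z, inside a (2 * b - a) c d z & F z = Some w.
  move=> wb hw'.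
  have wc0 : 0 < cabs w by lra.
  have w0 : w != 0 by rewrite -cabs_gt0.
  pose w' : plane R := (beta ^+ 2 +i* 0) * (w^*)%C^-1.
  have cw' : cabs w' = beta ^+ 2 / cabs w.
    by rewrite cabsM cabsV cabsJ cabs_real ger0_norm ?sqr_ge0.
  have w'0 : w' != 0 by rewrite -cabs_gt0 cw' divr_gt0.
  have [||z iz Ez] := outer w'.
  + by rewrite cw' ltr_pdivrMr // expr2 ltr_pM2l.
  + case: hw' => hw'; [left|right; exact/sector_inv].
    by rewrite cw' ltr_pdivrMr // mul1r.
  exists z => //; rewrite Ez /circle_inv (negbTE w'0); congr Some.
  have cw0 : (w'^*)%C != 0 by rewrite conjc_eq0.
  apply: (mulIf cw0); rewrite mulfVK //.
  have wc : (w^*)%C != 0 by rewrite conjc_eq0.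
  have -> : (w'^*)%C = (beta ^+ 2 +i* 0) * w^-1 :> R[i].
    rewrite [LHS]rmorphM; congr (_ * _); first by apply: complex_ext; rewrite /= ?oppr0.
    by rewrite [LHS]conjc_inv; congr (_^-1); exact: conjcK.
  by rewrite mulrCA mulfV // mulr1.
case: (ltgtP (cabs w) beta) => wb.
- by apply: inner => //; case: hw => [|[]]; [by left|lra|by right].
- by apply: dual => //; case: hw => [|[]]; [lra|by left|by right].
- have sw : sector gamma w by case: hw => [|[]] //; lra.
  have [s hs' Es] := sector_exists g0 gpi sw.
  have [|y hy Ey] := rig' s; first by rewrite /= in_itv.
  exists (b +i* y); first by rewrite /inside /= hy andbT; lra.
  by rewrite FL // Ey Es wb.
Qed.

(** The image of a horizontal side of the doubled rectangle. *)
Lemma glue_radial_edge (beta a b y u : R) h (F : plane R -> sphere R) : 1 < beta -> a < b ->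
  (forall z, Re z <= b -> F z = Some (h z)) ->
  (forall z, b <= Re z -> F z = circle_inv beta (h (mirror b z))) ->
  (forall x, a <= x <= b -> exists2 r, 1 <= r <= beta & h (x +i* y) = polar r u) ->
  (forall r, 1 <= r <= beta -> exists2 x, a <= x <= b & h (x +i* y) = polar r u) ->
  F @` box `[a, 2 * b - a] [set y] = @to_sphere R @` polar_region `[1, beta ^+ 2] [set u].
Proof.
move=> b1 ab FL FR E E'.
have b2 : beta < beta ^+ 2 by rewrite expr2 ltr_pMr //; lra.
have b20 : 0 < beta ^+ 2 by lra.
have bt0 : 0 < beta by lra.
have mbc x v : mirror b (x +i* v) = (2 * b - x) +i* v by [].
apply/seteqP; split.
  move=> _ [_ [x hx [v /= -> <-]] <-]; move: hx; rewrite /= in_itv /= => /andP [x1 x2].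
  case: (lerP x b) => xb.
    have [r /andP [r1 r2] Er] := E x ltac:(by rewrite x1 xb).
    rewrite FL // Er; exists (polar r u) => //; exists r; last by exists u.
    by rewrite /= in_itv /= r1 (le_trans r2 (ltW b2)).
  have [|r /andP [r1 r2] Er] := E (2 * b - x); first by lra.
  have r0 : 0 < r by lra.
  rewrite FR ?(ltW xb) // mbc Er circle_inv_polar //.
  exists (polar (beta ^+ 2 / r) u) => //; exists (beta ^+ 2 / r); last by exists u.
  by rewrite /= in_itv /= ler_pdivlMr // ler_pdivrMr // mul1r; apply/andP; split; nra.
move=> _ [_ [r hr [v /= -> <-]] <-]; move: hr; rewrite /= in_itv /= => /andP [r1 r2].
case: (lerP r beta) => rb.
  have [x hx Ex] := E' r ltac:(by rewrite r1 rb).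
  exists (x +i* y); last by rewrite FL ?Ex //; case/andP: hx.
  by exists x; [rewrite /= in_itv /=; lra|exists y].
have r0 : 0 < r by lra.
have [|x hx Ex] := E' (beta ^+ 2 / r).
  by rewrite ler_pdivlMr // ler_pdivrMr // mul1r r2 expr2 ler_pM2l // ltW.
exists ((2 * b - x) +i* y); first by exists (2 * b - x); [rewrite /= in_itv /=; lra|exists y].
have e : 2 * b - (2 * b - x) = x by ring.
rewrite FR /=; last by lra.
rewrite mbc e Ex circle_inv_polar; last by rewrite divr_gt0.
by congr (Some (polar _ _)); rewrite invf_div mulrC divfK // gt_eqF.
Qed.

(** The images of the vertical sides of the doubled rectangle. *)
Lemma glue_circular_edges (beta a b c d : R) h (F : plane R -> sphere R) (J : set R) :
  0 < beta -> a < b ->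
  (forall z, Re z <= b -> F z = Some (h z)) ->
  (forall z, b <= Re z -> F z = circle_inv beta (h (mirror b z))) ->
  (forall y, c < y < d -> exists2 s, J s & h (a +i* y) = polar 1 s) ->
  (forall s, J s -> exists2 y, c < y < d & h (a +i* y) = polar 1 s) ->
  [set F @` box [set a] `]c, d[; F @` box [set 2 * b - a] `]c, d[] =
  [set @to_sphere R @` polar_region [set 1] J; @to_sphere R @` polar_region [set beta ^+ 2] J].
Proof.
move=> bt0 ab FL FR lef lef'.
have mbc x v : mirror b (x +i* v) = (2 * b - x) +i* v by [].
rewrite /=; congr ([set _; _]).
  apply/seteqP; split.
    move=> _ [_ [x /= -> [y hy <-]] <-]; move: hy; rewrite /= in_itv /= => hy.
    have [s hs Es] := lef y hy.
    by rewrite FL ?(ltW ab) // Es; exists (polar 1 s) => //; exists 1 => //; exists s.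
  move=> _ [_ [r /= -> [s hs <-]] <-]; have [y hy Ey] := lef' s hs.
  exists (a +i* y); last by rewrite FL ?(ltW ab) // Ey.
  by exists a => //; exists y => //; rewrite /= in_itv.
have e : 2 * b - (2 * b - a) = a by ring.
apply/seteqP; split.
  move=> _ [_ [x /= -> [y hy <-]] <-]; move: hy; rewrite /= in_itv /= => hy.
  have [s hs Es] := lef y hy.
  rewrite FR /=; last by lra.
  rewrite mbc e Es circle_inv_polar // divr1.
  by exists (polar (beta ^+ 2) s) => //; exists (beta ^+ 2) => //; exists s.
move=> _ [_ [r /= -> [s hs <-]] <-]; have [y hy Ey] := lef' s hs.
exists ((2 * b - a) +i* y).
  by exists (2 * b - a) => //; exists y => //; rewrite /= in_itv.
rewrite FR /=; last by lra.
by rewrite mbc e Ey circle_inv_polar // divr1.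
Qed.

(** Reflection in the outer arc extends a gear map to a conformal map of the doubled
    rectangle onto the exterior of the annular rectangle. *)
Lemma gear_double (beta gamma t a b c d : R) (f : plane R -> plane R) :
  1 < beta -> 0 < gamma -> gamma < pi -> a < b -> c < d -> (t = gamma \/ t = - gamma) ->
  gear_map beta gamma t a b c d f ->
  exists F, quad_conformal_mapping a (2 * b - a) c d (annular_exterior beta gamma) F.
Proof.
move=> b1 g0 gpi ab cd tg [cf inj df iO iB iT iL iR].
have ab' := ltW ab; have cd' := ltW cd.
have bt0 : 0 < beta by lra.
have bn0 : beta != 0 by rewrite gt_eqF.
have b2 : beta < beta ^+ 2 by rewrite expr2 ltr_pMr //; lra.
have b20 : 0 < beta ^+ 2 by lra.
pose cl := clamp a b c d.
have icl z : inbox a b c d (cl z) by exact: clamp_inbox.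
pose h z := f (cl z).
have hE z : inbox a b c d z -> h z = f z by move=> hz; rewrite /h /cl clamp_id.
have ch : continuous h.
  apply: plane_continuous => z.
  exact: (continuous_comp (@clamp_continuous R a b c d z) (cf (cl z))).
have [_ _ cvl cvr] := continuous_line a b c d cf.
have vert (x r : R) J : 0 <= r -> continuous (fun y : R => f (x +i* y)) ->
    f @` box [set x] `]c, d[ = polar_region [set r] J ->
    forall y, c <= y <= d -> cabs (f (x +i* y)) = r.
  move=> r0 cv E; apply: (continuous_const_closed (g := fun y => cabs (f (x +i* y))) _ cd).
    by move=> y; apply: (continuous_comp (cv y)); exact: cabs_continuous.
  move=> y hy; have : (f @` box [set x] `]c, d[) (f (x +i* y)).
    by exists (x +i* y) => //; exists x => //; exists y; rewrite /= ?in_itv.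
  by rewrite E => -[_ /= -> [s _ <-]]; rewrite cabs_polar.
have cleft := vert a 1 _ ler01 cvl iL.
have cright := vert b beta _ (ltW bt0) cvr iR.
have seam z : Re z = b -> cabs (h z) = beta.
  move=> zb; rewrite /h /cl /clamp zb clamp1_id ?ab' ?lexx //.
  by apply: cright; exact: clamp1_itv.
pose F := glue beta b h.
have FL z : Re z <= b -> F z = Some (h z) by exact: glue_le.
have FR z : b <= Re z -> F z = circle_inv beta (h (mirror b z)) by exact: (glue_ge bt0 seam).
have cF z : {for z, continuous F} by exact: glue_continuous.
have mB z : inbox a (2 * b - a) c d z -> b <= Re z -> inbox a b c d (mirror b z).
  by move=> /andP [hx hy] zb; rewrite /inbox /=; apply/andP; split => //; lra.
have lB z : inbox a (2 * b - a) c d z -> Re z <= b -> inbox a b c d z.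
  by move=> /andP [hx hy] zb; rewrite /inbox; apply/andP; split => //; lra.
have gP w := @gear_domainP R beta gamma w g0 gpi bt0.
have inO z : inside a b c d z -> gear_domain beta gamma (h z).
  move=> iz; rewrite hE; last exact: inside_inbox.
  by rewrite -iO; exists z => //; exact/box_insideP.
have outO w : gear_domain beta gamma w -> exists2 z, inside a b c d z & h z = w.
  rewrite -iO => -[z /box_insideP iz <-]; exists z => //.
  by rewrite hE //; exact: inside_inbox.
have inbot x : a <= x <= b -> inbox a b c d (x +i* c) by move=> hx; rewrite /inbox /= hx lexx.
have intop x : a <= x <= b -> inbox a b c d (x +i* d) by move=> hx; rewrite /inbox /= hx lexx cd'.
have bE (y u : R) : (forall x, a <= x <= b -> inbox a b c d (x +i* y)) ->
    f @` box `[a, b] [set y] = polar_region `[1, beta] [set u] ->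
    (forall x, a <= x <= b -> exists2 r, 1 <= r <= beta & h (x +i* y) = polar r u) /\
    (forall r, 1 <= r <= beta -> exists2 x, a <= x <= b & h (x +i* y) = polar r u).
  move=> hin E; split=> [x hx|r hr].
    have : (f @` box `[a, b] [set y]) (f (x +i* y)).
      by exists (x +i* y) => //; exists x; rewrite /= ?in_itv //; exists y.
    rewrite E => -[r hr [v /= -> Er]]; move: hr; rewrite /= in_itv /= => hr.
    by exists r => //; rewrite hE ?hin.
  have : (polar_region `[1, beta] [set u]) (polar r u).
    by exists r; rewrite /= ?in_itv //; exists u.
  rewrite -E => -[_ [x hx [v /= -> <-]] Er]; move: hx; rewrite /= in_itv /= => hx.
  by exists x => //; rewrite hE ?hin.
have [bot bot'] := bE c t inbot iB.
have [top top'] := bE d (- t) intop iT.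
have rE (x r : R) J : (forall y, c < y < d -> inbox a b c d (x +i* y)) ->
    f @` box [set x] `]c, d[ = polar_region [set r] J ->
    (forall y, c < y < d -> exists2 s, J s & h (x +i* y) = polar r s) /\
    (forall s, J s -> exists2 y, c < y < d & h (x +i* y) = polar r s).
  move=> hin E; split=> [y hy|s hs].
    have : (f @` box [set x] `]c, d[) (f (x +i* y)).
      by exists (x +i* y) => //; exists x => //; exists y; rewrite /= ?in_itv.
    by rewrite E => -[v /= -> [s hs Es]]; exists s => //; rewrite hE ?hin.
  have : (polar_region [set r] J) (polar r s) by exists r => //; exists s.
  rewrite -E => -[_ [v /= -> [y hy <-]] Er]; move: hy; rewrite /= in_itv /= => hy.
  by exists y => //; rewrite hE ?hin.
have inleft y : c < y < d -> inbox a b c d (a +i* y).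
  by move=> /andP [/ltW h1 /ltW h2]; rewrite /inbox /= lexx ab' h1 h2.
have inright y : c < y < d -> inbox a b c d (b +i* y).
  by move=> /andP [/ltW h1 /ltW h2]; rewrite /inbox /= lexx ab' h1 h2.
have [lef lef'] := rE a 1 _ inleft iL.
have rigP := rE b beta _ inright iR.
have hcl y : c <= y <= d -> cabs (h (a +i* y)) = 1.
  by move=> hy; rewrite hE ?cleft // /inbox /= lexx ab'.
have hcr y : c <= y <= d -> cabs (h (b +i* y)) = beta.
  by move=> hy; rewrite hE ?cright // /inbox /= lexx ab'.
(* The end points of the radial edges are determined by their moduli, which are known on
   the closed vertical sides by continuity. *)
have corner (y u : R) : c <= y <= d ->
    (forall x, a <= x <= b -> exists2 r, 1 <= r <= beta & h (x +i* y) = polar r u) ->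
    h (a +i* y) = polar 1 u /\ h (b +i* y) = polar beta u.
  move=> hy E; split.
    have [r /andP [r1 _] Er] := E a ltac:(by rewrite lexx ab').
    by have := hcl y hy; rewrite Er cabs_polar ?(le_trans ler01) // => ->.
  have [r /andP [r1 _] Er] := E b ltac:(by rewrite lexx ab').
  by have := hcr y hy; rewrite Er cabs_polar ?(le_trans ler01) // => ->.
have cc : c <= c <= d by rewrite lexx.
have dd : c <= d <= d by rewrite lexx cd'.
have [hac _] := corner c t cc bot.
have [had _] := corner d (- t) dd top.
have injh z w : inbox a b c d z -> inbox a b c d w -> h z = h w -> z = w.
  by move=> hz hw; rewrite !hE //; exact: inj.
have horiz (y u : R) x : c <= y <= d ->
    (forall x, a <= x <= b -> exists2 r, 1 <= r <= beta & h (x +i* y) = polar r u) ->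
    a <= x -> x < b -> cabs (h (x +i* y)) < beta.
  move=> hy E ax xb; have [r /andP [r1 r2] Er] := E x ltac:(by rewrite ax ltW).
  rewrite Er cabs_polar ?(le_trans ler01) // lt_neqAle r2 andbT; apply/eqP => rb.
  have [_ Eb] := corner y u hy E.
  have : x +i* y = b +i* y :> plane R.
    by apply: injh; rewrite /inbox /= ?ax ?lexx ?ab' ?(ltW xb) ?hy // Er Eb rb.
  by case=> xE; rewrite xE ltxx in xb.
have lt_beta z : inbox a b c d z -> Re z < b -> cabs (h z) < beta.
  move=> /andP [/andP [z1 z2] /andP [z3 z4]] zb.
  have [zc|zc] := eqVneq (Im z) c.
    by rewrite (complex_eta z) zc; exact: (horiz c t).
  have [zd|zd] := eqVneq (Im z) d.
    by rewrite (complex_eta z) zd; exact: (horiz d (- t)).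
  have [za|za] := eqVneq (Re z) a.
    by rewrite (complex_eta z) za hcl ?z3.
  have /inO/gP : inside a b c d z.
    by rewrite /inside zb !lt_neqAle z1 z3 z4 eq_sym za eq_sym zc zd.
  by case=> [|[]] //; lra.
have le_beta z : inbox a b c d z -> cabs (h z) <= beta.
  move=> hz; have [zb|zb] := ltP (Re z) b; first exact/ltW/lt_beta.
  by rewrite seam //; case/andP: hz => /andP [? ?] _; lra.
have gt_beta z w : inbox a (2 * b - a) c d z -> b < Re z -> F z = Some w -> beta < cabs w.
  move=> hz zb; rewrite FR ?(ltW zb) // /circle_inv; case: eqVneq => // h0 [<-].
  have h1 : cabs (h (mirror b z)) < beta.
    by apply: lt_beta; [apply: mB; rewrite ?(ltW zb)|rewrite /=; lra].
  rewrite cabsM cabsV cabsJ cabs_real ger0_norm ?sqr_ge0 //.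
  by rewrite ltr_pdivlMr ?cabs_gt0 // expr2 ltr_pM2l.
have mbc x y : mirror b (x +i* y) = (2 * b - x) +i* y by [].
exists F; split.
- exact: continuous_subspaceT.
- move=> z w; rewrite !inE => /boxP hz /boxP hw.
  case: (lerP (Re z) b) => zb; case: (lerP (Re w) b) => wb.
  + by rewrite !FL // => -[]; apply: injh; exact: lB.
  + rewrite FL // => /esym E.
    by exfalso; have := gt_beta w _ hw wb E; have := le_beta z (lB z hz zb); lra.
  + rewrite [F w]FL // => E.
    by exfalso; have := gt_beta z _ hz zb E; have := le_beta w (lB w hw wb); lra.
  + rewrite !FR ?(ltW zb) ?(ltW wb) // => /(circle_inv_inj bn0) /injh E.
    by apply: (can_inj (mirrorK b)); apply: E; apply: mB; rewrite // ltW.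
- have dh v : inside a b c d v -> derivable h v 1.
    move=> iv; apply: (@derivable_near_eq _ f _ _ _ (df v iv)).
    by have := inside_open iv; apply: filterS => u /inside_inbox iu; rewrite hE.
  by move=> z /box_insideP iz; exact: (glue_holomorphic bt0 ch seam ab dh iz).
- by case: rigP => rig rig'; exact: (glue_onto_exterior b1 g0 gpi ab FL FR inO outO rig rig').
- have vert4 : F (a +i* c) = Some (polar 1 t) /\ F (a +i* d) = Some (polar 1 (- t)) /\
      F ((2 * b - a) +i* c) = Some (polar (beta ^+ 2) t) /\
      F ((2 * b - a) +i* d) = Some (polar (beta ^+ 2) (- t)).
    have e : 2 * b - (2 * b - a) = a by ring.
    have fl y : F (a +i* y) = Some (h (a +i* y)) by rewrite FL //= ltW.
    have fr y : F ((2 * b - a) +i* y) = circle_inv beta (h (a +i* y)).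
      by rewrite FR /=; [rewrite mbc e|lra].
    by rewrite !fl !fr hac had !circle_inv_polar // divr1.
  have [v1 [v2 [v3 v4]]] := vert4.
  have pmt : [set gamma; - gamma] = [set t; - t].
    by case: tg => ->; rewrite ?opprK // setUC.
  rewrite /= pmt; apply/seteqP; split.
    move=> _ [_ [x [|] -> [y [|] -> <-]] <-].
    + by rewrite v1; exists (polar 1 t) => //; exists 1; [left|exists t => //; left].
    + by rewrite v2; exists (polar 1 (- t)) => //; exists 1; [left|exists (- t) => //; right].
    + by rewrite v3; exists (polar (beta ^+ 2) t) => //; exists (beta ^+ 2);
        [right|exists t => //; left].
    + by rewrite v4; exists (polar (beta ^+ 2) (- t)) => //; exists (beta ^+ 2);
        [right|exists (- t) => //; right].
  move=> _ [_ [r [|] -> [u [|] -> <-]] <-].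
  + by exists (a +i* c) => //; exists a; [left|exists c => //; left].
  + by exists (a +i* d) => //; exists a; [left|exists d => //; right].
  + by exists ((2 * b - a) +i* c) => //; exists (2 * b - a); [right|exists c => //; left].
  + by exists ((2 * b - a) +i* d) => //; exists (2 * b - a); [right|exists d => //; right].
- have edge := fun y u => @glue_radial_edge beta a b y u h F b1 ab FL FR.
  rewrite (edge c t bot bot') (edge d (- t) top top') /=.
  by case: tg => ->; rewrite ?opprK // setUC.
- exact: (glue_circular_edges bt0 ab FL FR lef lef').
Qed.

End Gear.

Theorem theorem7p1 (R : realType) (beta gamma : R)
    (beta_gt1 : 1 < beta) (gamma_gt0 : 0 < gamma) (gamma_ltpi : gamma < pi)
    (m : R) (gear_module : is_conformal_module (gear_quadrilateral beta gamma) m) :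
  forall m' : R,
    is_conformal_module (annular_exterior beta gamma) m' <-> m' = m / 2.
Proof.
have half : is_conformal_module (annular_exterior beta gamma) (m / 2).
  case: gear_module => a [b [c [d [ab cd [F QF] ->]]]].
  have [t [f [tg gf]]] := gear_map_exists (ltW ab) (ltW cd) QF.
  have [G QG] := gear_double beta_gt1 gamma_gt0 gamma_ltpi ab cd tg gf.
  exists a, (2 * b - a), c, d; split; [lra|exact: cd|by exists G|].
  have n0 : b - a != 0 by rewrite subr_eq0 gt_eqF.
  have -> : 2 * b - a - a = 2 * (b - a) by ring.
  by field.
move=> m'; split=> [hm'|-> //].
apply: module_unique hm' half => a b c d F z QF hz.
exact: annular_exterior_avoids QF hz.
Qed.
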